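(* Let $\Phi$ be a root system of affine type, not of type $A^{(2)}_{2k}$, and let $c$ be a Coxeter element. For $\alpha\in\Phi_c$ the following are equivalent: (1) $(\alpha\|\delta)_c=1=(\delta\|\alpha)_c$; (2) there exists $\beta\in\Phi_c$ such that the pair $\{\alpha,\beta\}$ is $c$-exchangeable with $\delta$. When these conditions hold, $\alpha$ lies in the $\tau_c$-orbit of a negative simple root $-\alpha_j$ such that some automorphism of the Dynkin diagram takes $\alpha_j$ to $\alpha_{\mathrm{aff}}$.
   Context: $A=[a_{ij}]$ is an $n\times n$ symmetrizable Cartan matrix of affine type with symmetrizing constants $d_i$; type $A^{(2)}_{2k}$ is in Kac's notation. $V$ has basis of simple roots $\Pi=\{\alpha_1,\dots,\alpha_n\}$, co-roots $\alpha_i^\vee=d_i^{-1}\alpha_i$, symmetric form $K(\alpha_i^\vee,\alpha_j)=a_{ij}$, reflections $s_i(v)=v-K(\alpha_i^\vee,v)\alpha_i$. $\Phi$ is the root system, $\Phi^+$ the positive roots; $[v:\alpha_i]$, $[v:\alpha_i^\vee]$ coordinates in root and co-root bases; $[x]_+=\max(x,0)$; $\beta^\vee=\frac2{K(\beta,\beta)}\beta$ for real roots, $(-\alpha_i)^\vee=-\alpha_i^\vee$; $\delta$ is the positive imaginary root closest to $0$ and $\delta^\vee$ the positive imaginary root closest to $0$ of the dual root system (Cartan matrix $A^T$). $\alpha_{\mathrm{aff}}$ is the affine simple root (the node added to the finite Dynkin diagram in Kac's classification), $V_{\mathrm{fin}}$ the span of the other simple roots, $\Phi_{\mathrm{fin}}=\Phi\cap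 V_{\mathrm{fin}}$. A diagram automorphism is a permutation $\pi$ of $\{1,\dots,n\}$ with $a_{\pi(i)\pi(j)}=a_{ij}$. The Coxeter element is indexed $c=s_1\cdots s_n$; $\sigma_i(\alpha)=\alpha$ for $\alpha\in-\Pi\setminus\{-\alpha_i\}$ and $s_i\alpha$ otherwise; $\tau_c=\sigma_1\cdots\sigma_n$. $\gamma_c\in V_{\mathrm{fin}}$ is unique with $c\gamma_c=\gamma_c+\delta$, $U_c=\{v:K(\gamma_c,v)=0\}$, $\Upsilon_c=\Phi\cap U_c$, $\Upsilon^{\mathrm{re}}_c$ the positive real roots in $U_c$ whose $c$-orbit contains a root of $\Phi_{\mathrm{fin}}$, $\Phi_c=-\Pi\cup(\Phi^+\setminus U_c)\cup\Upsilon^{\mathrm{re}}_c\cup\{\delta\}$. Real roots of $\Upsilon_c$ form a root system with irreducible components of affine type A; $\Pi_c$ is the unique minimal subset of $\Upsilon_c\cap\Phi^+$ whose nonnegative span contains $\Upsilon_c\cap\Phi^+$. Tube support $\mathrm{Supp}_{\Pi_c}(\beta)$: elements of $\Pi_c$ with nonzero coefficient in the unique expansion of $\beta$ in simple roots of its component; union for sets; component-full: containing all simple roots of some component. $\mathrm{adj}(\alpha,\beta)$ counts elements $\beta_j$ of $\mathrm{Supp}_{\Pi_c}(\beta)$ with $\beta_j\in\mathrm{Supp}_{\Pi_c}(c\alpha)\cup\mathrm{Supp}_{\Pi_c}(c^{-1}\alpha)$ and $\beta_j\notin\mathrm{Supp}_{\Pi_c}(\alpha)$. $(\alpha\|\beta)_c^{\to}=-\sum_{i}[\alpha^\vee:\alpha_i^\vee][\beta:\alpha_i]-\sum_{j<i}a_{ij}[\alpha^\vee:\alpha_i^\vee]_+[\beta:\alpha_j]_+$,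 $(\alpha\|\beta)_c^{\leftarrow}=-\sum_{i}[\alpha^\vee:\alpha_i^\vee][\beta:\alpha_i]-\sum_{i<j}a_{ij}[\alpha^\vee:\alpha_i^\vee]_+[\beta:\alpha_j]_+$; $(\alpha\|\beta)_c=\mathrm{adj}(\alpha,\beta)$ if $\alpha,\beta\in\Upsilon^{\mathrm{re}}_c$ and $\{\alpha,\beta\}$ is component-full, otherwise the maximum of these two. Distinct roots are $c$-compatible if their degree is $0$; a $c$-cluster is a maximal set of pairwise $c$-compatible roots in $\Phi_c$. A pair $\{\alpha,\beta\}$ is $c$-exchangeable with $\delta$ if there exist a $c$-cluster $C$ with $\delta\in C$ and a $c$-cluster $C'$ with $\alpha,\beta\in C'$ such that $C\setminus\{\delta\}=C'\setminus\{\alpha,\beta\}$. *)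

(* Defs.v *)
(* Vectors of V are rational row vectors 'rV[rat]_n, written in
   the basis of simple roots: the coordinate [v : alpha_i] is  v ord0 i. *)
From HB Require Import structures.
From mathcomp Require Import all_boot all_order all_fingroup all_algebra.
Set Implicit Arguments. Unset Strict Implicit. Unset Printing Implicit Defensive.
Import Order.TTheory GRing.Theory Num.Theory.
Local Open Scope ring_scope.

(* Hypotheses on the Cartan matrix (a_ij = A i j, Kac's convention)    *)

Definition is_GCM (n : nat) (A : 'M[int]_n) : Prop :=
  (forall i, A i i = 2) /\ (forall i j, i != j -> A i j <= 0) /\
  (forall i j, A i j = 0 <-> A j i = 0).

Definition indecomposable (n : nat) (A : 'M[int]_n) : Prop :=
  forall S : {set 'I_n}, S != set0 -> S != setT ->
    exists i j, [/\ i \in S, j \notin S & A i j != 0].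

(* Kac, Ch. 4, type (Aff): corank 1, exists u > 0 with Au = 0, and
   Av >= 0 implies Av = 0. *)
Definition affine_type (n : nat) (A : 'M[int]_n) : Prop :=
  let Ar := map_mx (fun z : int => z%:~R : rat) A in
  is_GCM A /\ indecomposable A /\
  (\rank Ar = n.-1)%N /\
  (exists u : 'cV[rat]_n, (forall i, 0 < u i ord0) /\ Ar *m u = 0) /\
  (forall v : 'cV[rat]_n, (forall i, 0 <= (Ar *m v) i ord0) -> Ar *m v = 0).

Definition symmetrizing (n : nat) (A : 'M[int]_n) (d : 'I_n -> rat) : Prop :=
  (forall i, 0 < d i) /\ (forall i j, d i * (A i j)%:~R = d j * (A j i)%:~R).

(* The Cartan matrix of type A^(2)_(2k) in Kac's numbering, with n = k+1
   nodes alpha_0, ..., alpha_k: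
   k = 1 : [[2,-4],[-1,2]];
   k >= 2: alpha_0 <= alpha_1 - ... - alpha_(k-1) <= alpha_k, a_01 = -2,
           a_(k-1)k = -2, all other nonzero off-diagonal entries -1. *)
Definition A2even_entry (n : nat) (i j : 'I_n) : int :=
  if i == j then 2
  else if n == 2%N then (if (i : nat) == 0%N then -4 else -1)
  else if ((i : nat).+1 == j) then
         (if (i : nat) == 0%N then -2 else if (j : nat) == n.-1 then -2 else -1)
  else if ((j : nat).+1 == i) then -1 else 0.

Definition is_type_A2even (n : nat) (A : 'M[int]_n) : Prop :=
  (2 <= n)%N /\ exists p : {perm 'I_n}, forall i j, A (p i) (p j) = A2even_entry i j.

(* u is the positive imaginary root "closest to 0": the minimal positive
   integer null vector of A (resp. of A^T for delta^vee) *)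
Definition is_min_null (n : nat) (A : 'M[int]_n) (u : 'I_n -> nat) : Prop :=
  (forall i, (0 < u i)%N) /\ (forall i, \sum_j A i j * (u j)%:Z = 0) /\
  (forall w : 'I_n -> nat, (forall i, (0 < w i)%N) ->
     (forall i, \sum_j A i j * (w j)%:Z = 0) -> forall i, (u i <= w i)%N).

Record cdata (n : nat) := CData {
  cA : 'M[int]_n;
  cd : 'I_n -> rat;
  cdl : 'I_n -> nat;     (* [delta : alpha_i] *)
  cdvl : 'I_n -> nat;    (* [delta^vee : alpha_i^vee] *)
  caff : 'I_n
}.

(* Hypotheses: A affine, not A^(2)_(2k), d symmetrizing, delta and delta^vee
   as in the context, and caff a node added to the finite diagram in Kac's
   tables (up to diagram automorphism these are exactly the nodes with
   [delta:alpha_i] = 1 = [delta^vee:alpha_i^vee]). *)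
Definition good_data (n : nat) (D : cdata n) : Prop :=
  affine_type (cA D) /\ ~ is_type_A2even (cA D) /\ symmetrizing (cA D) (cd D) /\
  is_min_null (cA D) (cdl D) /\ is_min_null (cA D)^T (cdvl D) /\
  cdl D (caff D) = 1%N /\ cdvl D (caff D) = 1%N.

Section RootDefs.
Variable n : nat.
Variable D : cdata n.

Definition vec := 'rV[rat]_n.

Definition a (i j : 'I_n) : rat := (cA D i j)%:~R.

Definition sr (i : 'I_n) : vec := delta_mx ord0 i.

Definition K (u v : vec) : rat :=
  \sum_i \sum_j u ord0 i * v ord0 j * cd D i * a i j.

(* K(alpha_i^vee, v) *)
Definition Kcv (i : 'I_n) (v : vec) : rat := \sum_j a i j * v ord0 j.

Definition refl (i : 'I_n) (v : vec) : vec := v - Kcv i v *: sr i.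

(* c = s_1 ... s_n  (s_n applied first) and its inverse *)
Definition cox (v : vec) : vec := foldr (fun i w => refl i w) v (enum 'I_n).
Definition coxinv (v : vec) : vec := foldl (fun w i => refl i w) v (enum 'I_n).
Definition coxz (k : int) (v : vec) : vec :=
  match k with Posz m => iter m cox v | Negz m => iter m.+1 coxinv v end.

Definition delta : vec := \row_i (cdl D i)%:R.

Inductive real_root : vec -> Prop :=
| rr_simple i : real_root (sr i)
| rr_refl i v : real_root v -> real_root (refl i v).

(* Phi = real roots and nonzero multiples of delta (Kac, Thm 5.6) *)
Definition root (v : vec) : Prop :=
  real_root v \/ exists m : int, m != 0 /\ v = m%:~R *: delta.

Definition positive (v : vec) : Prop := v != 0 /\ forall i, 0 <= v ord0 i.

Definition pos_root (v : vec) : Prop := root v /\ positive v.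

Definition fin_root (v : vec) : Prop := root v /\ v ord0 (caff D) = 0.

Definition negsimple (v : vec) : Prop := exists i, v = - sr i.

Section WithGamma.
Variable gamma : vec.

Definition inU (v : vec) : Prop := K gamma v = 0.

Definition Upsre (v : vec) : Prop :=
  real_root v /\ positive v /\ inU v /\ exists k : int, fin_root (coxz k v).

Definition Phic (v : vec) : Prop :=
  negsimple v \/ (pos_root v /\ ~ inU v) \/ Upsre v \/ v = delta.

Definition Upspos (v : vec) : Prop := pos_root v /\ inU v.

Definition in_cone (P : vec -> Prop) (v : vec) : Prop :=
  exists (s : seq vec) (f : vec -> rat),
    (forall x, x \in s -> P x) /\ (forall x, 0 <= f x) /\ v = \sum_(x <- s) f x *: x.

Definition is_Pic (P : vec -> Prop) : Prop :=
  (forall v, P v -> Upspos v) /\ (forall v, Upspos v -> in_cone P v) /\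
  (forall Q : vec -> Prop, (forall v, Q v -> P v) ->
     (forall v, Upspos v -> in_cone Q v) -> forall v, P v -> Q v).

Section WithPi.
Variable P : vec -> Prop.

(* Irreducible components of Pi_c: connected components of its Dynkin diagram *)
Inductive conn : vec -> vec -> Prop :=
| conn_refl x : P x -> conn x x
| conn_step x y z : conn x y -> P z -> K y z != 0 -> conn x z.

Definition Supp (beta p : vec) : Prop :=
  P p /\ exists (s : seq vec) (f : vec -> rat),
    uniq s /\ (forall x, x \in s -> conn p x) /\
    beta = \sum_(x <- s) f x *: x /\ p \in s /\ f p != 0.

Definition comp_full (al be : vec) : Prop :=
  exists p0, P p0 /\ forall q, conn p0 q -> Supp al q \/ Supp be q.

Definition adj_is (al be : vec) (m : nat) : Prop :=
  exists t : seq vec, uniq t /\ size t = m /\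
    forall x, x \in t <->
      (Supp be x /\ (Supp (cox al) x \/ Supp (coxinv al) x) /\ ~ Supp al x).

(* [alpha^vee : alpha_i^vee] for alpha in Phi_c (delta is the only imaginary
   root of Phi_c, and delta^vee is given by cdvl) *)
Definition corc (al : vec) (i : 'I_n) : rat :=
  if al == delta then (cdvl D i)%:R
  else 2 * al ord0 i * cd D i / K al al.

Definition ppart (x : rat) : rat := Num.max x 0.

Definition deg_right (al be : vec) : rat :=
  - (\sum_i corc al i * be ord0 i)
  - \sum_(i : 'I_n) \sum_(j : 'I_n | (j < i)%N) a i j * ppart (corc al i) * ppart (be ord0 j).

Definition deg_left (al be : vec) : rat :=
  - (\sum_i corc al i * be ord0 i)
  - \sum_(i : 'I_n) \sum_(j : 'I_n | (i < j)%N) a i j * ppart (corc al i) * ppart (be ord0 j).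

Definition tube_case (al be : vec) : Prop :=
  Upsre al /\ Upsre be /\ comp_full al be.

Definition cdeg (al be : vec) (k : rat) : Prop :=
  (tube_case al be /\ exists m : nat, adj_is al be m /\ k = m%:R) \/
  (~ tube_case al be /\ k = Num.max (deg_right al be) (deg_left al be)).

Definition compatible (al be : vec) : Prop := cdeg al be 0.

Definition pairwise_compat (C : vec -> Prop) : Prop :=
  forall x y, C x -> C y -> x <> y -> compatible x y.

Definition is_cluster (C : vec -> Prop) : Prop :=
  (forall x, C x -> Phic x) /\ pairwise_compat C /\
  (forall C' : vec -> Prop, (forall x, C x -> C' x) -> (forall x, C' x -> Phic x) ->
     pairwise_compat C' -> forall x, C' x -> C x).

Definition exch_delta (al be : vec) : Prop :=
  exists C C' : vec -> Prop, is_cluster C /\ is_cluster C' /\ C delta /\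
    C' al /\ C' be /\
    forall x, (C x /\ x <> delta) <-> (C' x /\ x <> al /\ x <> be).

End WithPi.
End WithGamma.

Definition sigma (i : 'I_n) (v : vec) : vec :=
  if [exists j, (j != i) && (v == - sr j)] then v else refl i v.

Definition tau (v : vec) : vec := foldr (fun i w => sigma i w) v (enum 'I_n).

(* y lies in the tau_c-orbit of x (tau_c is a bijection of Phi_c) *)
Definition in_tau_orbit (x y : vec) : Prop :=
  exists k : nat, iter k tau x = y \/ iter k tau y = x.

Definition diagram_aut (p : {perm 'I_n}) : Prop :=
  forall i j, cA D (p i) (p j) = cA D i j.

End RootDefs.

(* Main.v *)
(* Let E be the Euler form of c, so that K(x,y) = E(x,y) + E(y,x) and
   E(cx,y) = -E(y,x).  For positive roots x, y the two numbers whose maximum is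
   (x||y)_c are -E(x,y) and -E(y,x), divided by K(x,x)/2.  A positive root outside
   U_c has E(x,delta) <> 0 and is c^k P_i or c^-k I_i according to the sign, where
   P_i = s_1..s_(i-1) alpha_i, I_i = s_n..s_(i+1) alpha_i and c I_i = -P_i; hence
   it lies in the tau_c-orbit of -alpha_i, since tau_c sends I_i to -alpha_i and
   -alpha_i to P_i and acts by c elsewhere.  The simple roots of each component
   of Upsilon_c form one c-orbit, arranged in a cycle, and Upsilon_c^re consists of
   the sums over proper arcs of these cycles.

   (2) => (1): a cluster containing delta contains in each tube an arc missing a
   single simple root, so E(alpha,-) is concentrated on one simple root per tube,
   as is E(P_aff,-).  Comparing K(x,x) / E(x,delta)^2 for the two roots gives a
   positive integer whose inverse is an integer.
   (1) => (2): tau_c preserves compatibility and fixes delta, and both degrees of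
   -alpha_j with delta are 1 exactly when the coordinates of delta and delta^vee at j
   are 1.  For such j each tube has one simple root b with nonzero j-coordinate; the arcs
   c^-1 b + ... + c^-l b complete both {delta} and {-alpha_j, beta} to clusters, where
   beta = delta - P_j, or delta - I_j if j = n.

   For such j, the functional vanishing on delta and equal to 1 on alpha_i for
   i <> j is made dominant by the Weyl group of V_fin; the element achieving this
   carries the simple roots to the simple roots modulo delta, with alpha_j to
   alpha_aff. *)
Require Import Defs.
From HB Require Import structures.
From mathcomp Require Import all_boot all_order all_fingroup all_algebra.
From mathcomp Require Import ring lra zify.
From Stdlib Require Import Classical.
Set Implicit Arguments. Unset Strict Implicit. Unset Printing Implicit Defensive.
Import Order.TTheory GRing.Theory Num.Theory.
Local Open Scope ring_scope.

(** * The Euler form *)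

Section Bilinear.
Variable n : nat.
Implicit Types (M : 'I_n -> 'I_n -> rat) (u v w : 'rV[rat]_n).

(** No list of affine diagrams and no finiteness theorem for the finite Weyl group enters. Real
    roots are handled through [lroot]: integral vectors with [0 < q x] and integral coroot. This
    condition can be checked on reflections, on sums over arcs and on shifts by delta, and at a node
    [e] with both marks 1 the vector x - x_e delta is again a root. Roots of given norm vanishing at
    [e] are bounded by a multiple of delta, so their orbits repeat by the pigeonhole principle; sums
    over a repeated stretch are invariant and fall into the radical of [K]. The delicate point is
    the cyclic shape of a tube. Nonpositive products K(p, c^-i p) adding up to -K(p, p) along an
    orbit do not determine it; the missing inequality K(p, c^-1 p) <= -q p comes from the absence of
    oriented cycles among roots of finite type. In (2) => (1) the comparison with P_aff gives q x =
    E(x, delta)^2 / d_aff. Then |E(x, delta)| / d_aff is an integer because delta^vee is integral,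
    and so is its inverse because the coroot of x is integral. *)

Definition bil M u v : rat := \sum_i \sum_j u ord0 i * v ord0 j * M i j.

Lemma bilDl M u v w : bil M (u + v) w = bil M u w + bil M v w.
Proof.
rewrite /bil -big_split; apply: eq_bigr => i _; rewrite -big_split.
by apply: eq_bigr => j _; rewrite mxE !mulrDl.
Qed.

Lemma bilZl M k u w : bil M (k *: u) w = k * bil M u w.
Proof.
rewrite /bil mulr_sumr; apply: eq_bigr => i _; rewrite mulr_sumr.
by apply: eq_bigr => j _; rewrite mxE !mulrA.
Qed.

Lemma bilC M u v : bil M u v = bil (fun i j => M j i) v u.
Proof.
rewrite /bil exchange_big; apply: eq_bigr => i _; apply: eq_bigr => j _.
by rewrite [u _ _ * _]mulrC.
Qed.

Lemma bilDr M u v w : bil M u (v + w) = bil M u v + bil M u w.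
Proof. by rewrite ![bil M u _]bilC bilDl. Qed.

Lemma bilZr M k u w : bil M u (k *: w) = k * bil M u w.
Proof. by rewrite ![bil M u _]bilC bilZl. Qed.

Lemma bil_delta M i j : bil M (delta_mx ord0 i) (delta_mx ord0 j) = M i j.
Proof.
rewrite /bil (bigD1 i) //= [X in _ + X]big1 ?addr0 => [|k ki]; last first.
  by apply: big1 => l _; rewrite mxE (negbTE ki) andbF !mul0r.
rewrite (bigD1 j) //= big1 ?addr0 => [|l lj]; last first.
  by rewrite [X in _ * X * _]mxE (negbTE lj) andbF mulr0 mul0r.
by rewrite !mxE !eqxx !mul1r.
Qed.

Lemma bil_deltar M u j : bil M u (delta_mx ord0 j) = \sum_i u ord0 i * M i j.
Proof.
rewrite /bil; apply: eq_bigr => i _; rewrite (bigD1 j) //= big1 ?addr0.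
  by rewrite [X in _ * X * _]mxE !eqxx mulr1.
by move=> k kj; rewrite [X in _ * X * _]mxE (negbTE kj) andbF mulr0 mul0r.
Qed.
End Bilinear.

Section Coxeter.
Variables (n : nat) (D : cdata n).
Local Notation V := 'rV[rat]_n.
Local Notation d := (cd D).
Local Notation ca := (a D).
Implicit Types (u v w x y : V) (s : seq 'I_n) (i j : 'I_n).

Definition kcoef i j : rat := d i * ca i j.
(** The part of the Gram matrix of [K] below the diagonal, with [d i] instead of [2 * d i] on it.
    Keeping the pairs with [j < i] fits the order of the letters in c = s_1 ... s_n. *)
Definition ecoef i j : rat :=
  d i * (if i == j then 1 else if (j < i)%N then ca i j else 0).

Definition eul := bil ecoef.

Lemma KE u v : K D u v = bil kcoef u v.
Proof. by apply: eq_bigr => i _; apply: eq_bigr => j _; rewrite /kcoef !mulrA. Qed.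

Lemma KDl u v w : K D (u + v) w = K D u w + K D v w.
Proof. by rewrite !KE bilDl. Qed.
Lemma KZl k u w : K D (k *: u) w = k * K D u w.
Proof. by rewrite !KE bilZl. Qed.
Lemma KNl u w : K D (- u) w = - K D u w.
Proof. by rewrite -scaleN1r KZl mulN1r. Qed.
Lemma KDr u v w : K D u (v + w) = K D u v + K D u w.
Proof. by rewrite !KE bilDr. Qed.
Lemma KZr k u w : K D u (k *: w) = k * K D u w.
Proof. by rewrite !KE bilZr. Qed.
Lemma KNr u w : K D u (- w) = - K D u w.
Proof. by rewrite -scaleN1r KZr mulN1r. Qed.
Lemma K0r u : K D u 0 = 0.
Proof. by rewrite -(scale0r 0) KZr mul0r. Qed.
Lemma K0l u : K D 0 u = 0.
Proof. by rewrite -(scale0r 0) KZl mul0r. Qed.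
Lemma KBl u v w : K D (u - v) w = K D u w - K D v w.
Proof. by rewrite KDl KNl. Qed.
Lemma KBr u v w : K D u (v - w) = K D u v - K D u w.
Proof. by rewrite KDr KNr. Qed.

Lemma K_sumr (I : Type) (r : seq I) (Q : pred I) (F : I -> V) u :
  K D u (\sum_(i <- r | Q i) F i) = \sum_(i <- r | Q i) K D u (F i).
Proof.
elim: r => [|i r IH]; first by rewrite !big_nil K0r.
by rewrite !big_cons; case: (Q i); rewrite ?KDr IH.
Qed.

Lemma eulDl u v w : eul (u + v) w = eul u w + eul v w. Proof. exact: bilDl. Qed.
Lemma eulZl k u w : eul (k *: u) w = k * eul u w. Proof. exact: bilZl. Qed.
Lemma eulNl u w : eul (- u) w = - eul u w.
Proof. by rewrite -scaleN1r eulZl mulN1r. Qed.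
Lemma eulDr u v w : eul u (v + w) = eul u v + eul u w. Proof. exact: bilDr. Qed.
Lemma eulZr k u w : eul u (k *: w) = k * eul u w. Proof. exact: bilZr. Qed.
Lemma eulNr u w : eul u (- w) = - eul u w.
Proof. by rewrite -scaleN1r eulZr mulN1r. Qed.
Lemma eul0r u : eul u 0 = 0.
Proof. by rewrite -(scale0r 0) eulZr mul0r. Qed.
Lemma eul0l u : eul 0 u = 0.
Proof. by rewrite -(scale0r 0) eulZl mul0r. Qed.
Lemma eulBl u v w : eul (u - v) w = eul u w - eul v w.
Proof. by rewrite eulDl eulNl. Qed.
Lemma eulBr u v w : eul u (v - w) = eul u v - eul u w.
Proof. by rewrite eulDr eulNr. Qed.

Lemma eul_sumr (I : Type) (r : seq I) (Q : pred I) (F : I -> V) u :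
  eul u (\sum_(i <- r | Q i) F i) = \sum_(i <- r | Q i) eul u (F i).
Proof.
elim: r => [|i r IH]; first by rewrite !big_nil eul0r.
by rewrite !big_cons; case: (Q i); rewrite ?eulDr IH.
Qed.
Lemma eul_suml (I : Type) (r : seq I) (Q : pred I) (F : I -> V) u :
  eul (\sum_(i <- r | Q i) F i) u = \sum_(i <- r | Q i) eul (F i) u.
Proof.
elim: r => [|i r IH]; first by rewrite !big_nil eul0l.
by rewrite !big_cons; case: (Q i); rewrite ?eulDl IH.
Qed.

Lemma vecE u : u = \sum_i u ord0 i *: sr i.
Proof. exact: row_sum_delta. Qed.

Lemma srE i j : (sr i : V) ord0 j = (j == i)%:R.
Proof. by rewrite mxE eqxx. Qed.

Lemma refl_linear i : linear (refl D i).
Proof.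
move=> k u v; rewrite /refl /Kcv.
rewrite (_ : \sum_j _ = k * Kcv D i u + Kcv D i v); last first.
  rewrite /Kcv mulr_sumr -big_split; apply: eq_bigr => j _ /=.
  by rewrite !mxE mulrDr; congr (_ + _); rewrite mulrCA.
by rewrite scalerDl -scalerA scalerBr opprD addrACA.
Qed.
HB.instance Definition _ i :=
  GRing.isLinear.Build rat V V *:%R (refl D i) (refl_linear i).

Definition word s v : V := foldr (fun i w => refl D i w) v s.

Lemma word_linear s : linear (word s).
Proof. by move=> k u v; elim: s => //= i s ->; rewrite linearP. Qed.
HB.instance Definition _ s :=
  GRing.isLinear.Build rat V V *:%R (word s) (word_linear s).

Lemma word_cat s1 s2 v : word (s1 ++ s2) v = word s1 (word s2 v).
Proof. by rewrite /word foldr_cat. Qed.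

Lemma coxE v : cox D v = word (enum 'I_n) v. Proof. by []. Qed.
Lemma coxinvE v : coxinv D v = word (rev (enum 'I_n)) v.
Proof. by rewrite /coxinv /word -{1}(revK (enum 'I_n)) foldl_rev. Qed.

Lemma cox_linear : linear (cox D). Proof. exact: word_linear. Qed.
HB.instance Definition _ := GRing.isLinear.Build rat V V *:%R (cox D) cox_linear.
Lemma coxinv_linear : linear (coxinv D).
Proof. by move=> k u v; rewrite !coxinvE linearP. Qed.
HB.instance Definition _ := GRing.isLinear.Build rat V V *:%R (coxinv D) coxinv_linear.

Lemma refl_coord i v j : (refl D i v) ord0 j = v ord0 j - Kcv D i v * (j == i)%:R.
Proof. by rewrite !mxE eqxx. Qed.

Lemma word_notin s v j : j \notin s -> (word s v) ord0 j = v ord0 j.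
Proof.
elim: s => //= i s IH; rewrite inE negb_or => /andP[ji js].
by rewrite refl_coord (negbTE ji) mulr0 subr0 IH.
Qed.

Section Symm.
Hypothesis dsym : forall i j, d i * ca i j = d j * ca j i.
Hypothesis dpos : forall i, 0 < d i.
Hypothesis a2 : forall i, ca i i = 2.

Lemma dneq0 i : d i != 0. Proof. by rewrite gt_eqF. Qed.

Lemma K_sym u v : K D u v = K D v u.
Proof.
rewrite !KE bilC; apply: eq_bigr => i _; apply: eq_bigr => j _.
by rewrite /kcoef dsym.
Qed.

Lemma K_eul u v : K D u v = eul u v + eul v u.
Proof.
rewrite [eul v u]bilC KE /eul /bil -big_split; apply: eq_bigr => i _.
rewrite -big_split; apply: eq_bigr => j _ /=; rewrite -mulrDr; congr (_ * _).
rewrite /kcoef /ecoef [j == i]eq_sym; case: eqP => [->|/eqP ij]; first by rewrite a2; ring.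
case: (ltngtP j i) => [ji|ji|/val_inj ji]; first by ring.
  by rewrite mulr0 add0r dsym.
by rewrite ji eqxx in ij.
Qed.

Lemma K_eul2 u : K D u u = 2 * eul u u. Proof. by rewrite K_eul; ring. Qed.

Lemma K_srl i v : K D (sr i) v = d i * Kcv D i v.
Proof.
rewrite K_sym KE bil_deltar /Kcv mulr_sumr; apply: eq_bigr => j _.
by rewrite /kcoef dsym; ring.
Qed.
Lemma K_srr i v : K D v (sr i) = d i * Kcv D i v.
Proof. by rewrite K_sym K_srl. Qed.
Lemma KcvE i v : Kcv D i v = K D (sr i) v / d i.
Proof. by rewrite K_srl mulrAC mulfV ?mul1r ?dneq0. Qed.

Lemma K_sr2 i : K D (sr i) (sr i) = 2 * d i.
Proof. by rewrite KE bil_delta /kcoef a2 mulrC. Qed.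
Lemma K_srsr i j : K D (sr i) (sr j) = d i * ca i j.
Proof. by rewrite KE bil_delta. Qed.
Lemma eul_srsr i j : eul (sr i) (sr j) = ecoef i j.
Proof. exact: bil_delta. Qed.

Lemma reflE i v : refl D i v = v - (K D (sr i) v / d i) *: sr i.
Proof. by rewrite /refl KcvE. Qed.

Lemma K_refl i u v : K D (refl D i u) (refl D i v) = K D u v.
Proof.
rewrite !reflE !KBl !KBr !KZl !KZr K_sr2 ![K D u (sr i)]K_sym.
by field; apply: dneq0.
Qed.

Lemma refl_inv i v : refl D i (refl D i v) = v.
Proof.
rewrite reflE [refl D i v]reflE KBr KZr K_sr2 -addrA -opprD -scalerDl.
set k := (X in X *: _); have -> : k = 0 by rewrite /k; field; apply: dneq0.
by rewrite scale0r subr0.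
Qed.

Lemma refl_sr i : refl D i (sr i) = - sr i.
Proof.
rewrite reflE K_sr2 (_ : 2 * d i / d i = 2); last by field; apply: dneq0.
by rewrite scaler_nat mulr2n opprD addrA subrr sub0r.
Qed.

Lemma K_word s u v : K D (word s u) (word s v) = K D u v.
Proof. by elim: s => //= i s IH; rewrite K_refl. Qed.

Lemma word_revK s v : word (rev s) (word s v) = v.
Proof.
elim: s v => //= i s IH v.
by rewrite rev_cons -cats1 word_cat /= refl_inv IH.
Qed.
Lemma wordK_rev s v : word s (word (rev s) v) = v.
Proof. by rewrite -{1}(revK s) word_revK. Qed.

Lemma coxK v : coxinv D (cox D v) = v.
Proof. by rewrite coxinvE coxE word_revK. Qed.
Lemma coxinvK v : cox D (coxinv D v) = v.
Proof. by rewrite coxinvE coxE wordK_rev. Qed.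

(* Reading the product from the right, the coordinate [i] is changed exactly
   once, when the coordinates in [s] beyond [i] have already been changed. *)
Lemma word_step s (ss : sorted ltn (map val s)) v i : i \in s ->
  (word s v) ord0 i = v ord0 i -
    \sum_j ca i j * (if (j \in s) && (i < j)%N then (word s v) ord0 j else v ord0 j).
Proof.
elim: s ss => //= k s IH ss; have pk : path ltn k (map val s) by [].
have lts j : j \in s -> (k < j)%N.
  move=> js; move: pk; rewrite (path_sortedE ltn_trans) => /andP[/allP h _].
  by apply: h; rewrite map_f.
have ks : k \notin s by apply/negP => /lts; rewrite ltnn.
rewrite inE; case: eqP => [-> _|/eqP ik /= i_s].
  rewrite refl_coord eqxx mulr1 word_notin //; congr (_ - _).
  apply: eq_bigr => j _; congr (_ * _); rewrite inE.
  case: (boolP (j \in s)) => js.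
    rewrite orbT lts //= refl_coord.
    by rewrite (_ : j == k = false) ?mulr0 ?subr0 //; apply/negP => /eqP jk; rewrite -jk js in ks.
  rewrite orbF; case: eqP => [->|_] /=; first by rewrite ltnn word_notin.
  by rewrite word_notin.
rewrite refl_coord (negbTE ik) mulr0 subr0 IH ?(path_sorted pk) //; congr (_ - _).
apply: eq_bigr => j _; congr (_ * _); rewrite inE refl_coord.
case: (eqVneq j k) => [->|jk] /=; last by rewrite mulr0 subr0.
by rewrite (negbTE ks) ltnNge (ltnW (lts _ i_s)).
Qed.

(** Carrying the support along lets one computation serve both c, with [s] the list of all nodes,
    and the Coxeter element of V_fin. *)
Definition supported s x := forall i, i \notin s -> x ord0 i = 0.

Lemma supported_word s x : supported s x -> supported s (word s x).
Proof. by move=> sx i si; rewrite word_notin // sx. Qed.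
Lemma supported_sr s i : i \in s -> supported s (sr i).
Proof. by move=> si j sj; rewrite srE; case: eqP => // ji; rewrite ji si in sj. Qed.
Lemma supported_rev s x : supported (rev s) x <-> supported s x.
Proof. by split => h i si; apply: h; rewrite ?mem_rev // -?mem_rev in si *. Qed.

(** Multiply [word_step] at [i] by [d i]: the terms with already changed coordinates (j > i), moved
    to the left, complete E(word s x, alpha_i), and the unchanged ones (j < i) form -E(alpha_i,
    x). *)
Lemma eul_word_sr s (ss : sorted ltn (map val s)) x i :
  supported s x -> i \in s -> eul (word s x) (sr i) = - eul (sr i) x.
Proof.
move=> sx si; rewrite /eul bil_deltar [bil _ (sr i) x]bilC bil_deltar.
rewrite (bigD1 i) //= [in RHS](bigD1 i) //= (word_step ss) // {1 2}/ecoef eqxx mulr1.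
set T := \sum_(j < n) _; have -> : T = 2 * x ord0 i +
  \sum_(j | j != i) ca i j *
    (if (j \in s) && (i < j)%N then (word s x) ord0 j else x ord0 j).
  by rewrite /T (bigD1 i) //= ltnn andbF a2.
rewrite mulrBl mulrDl mulr_suml opprD -sumrN -addrA -addrA -big_split /=.
rewrite addrA [in RHS]opprD -sumrN.
congr (_ + _); first by rewrite /ecoef eqxx; ring.
apply: eq_bigr => j ji; rewrite /ecoef (negbTE ji) eq_sym (negbTE ji).
case: (boolP (j \in s)) => js /=; last by rewrite word_notin // sx //; ring.
case: (ltngtP i j) => [ij|ij|/val_inj ij]; last by rewrite ij eqxx in ji.
  by rewrite (dsym j i); ring.
by ring.
Qed.

Lemma eul_expr x y : eul x y = \sum_i y ord0 i * eul x (sr i).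
Proof. by rewrite {1}(vecE y) eul_sumr; apply: eq_bigr => i _; rewrite eulZr. Qed.
Lemma eul_expl x y : eul x y = \sum_i x ord0 i * eul (sr i) y.
Proof. by rewrite {1}(vecE x) eul_suml; apply: eq_bigr => i _; rewrite eulZl. Qed.

Lemma eul_word s (ss : sorted ltn (map val s)) x y :
  supported s x -> supported s y -> eul (word s x) y = - eul y x.
Proof.
move=> sx sy; rewrite eul_expr eul_expl -sumrN; apply: eq_bigr => i _.
case: (boolP (i \in s)) => si; first by rewrite (eul_word_sr ss) ?mulrN.
by rewrite sy // !mul0r oppr0.
Qed.

Lemma eul_word2 s (ss : sorted ltn (map val s)) x y :
  supported s x -> supported s y -> eul (word s x) (word s y) = eul x y.
Proof.
move=> sx sy; rewrite (eul_word ss) //; last exact: supported_word.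
by rewrite (eul_word ss) ?opprK.
Qed.

Lemma sorted_enum : sorted ltn (map val (enum 'I_n)).
Proof. by rewrite val_enum_ord iota_ltn_sorted. Qed.
Lemma supported_enum x : supported (enum 'I_n) x.
Proof. by move=> i; rewrite mem_enum. Qed.

Lemma eul_cox x y : eul (cox D x) y = - eul y x.
Proof. exact: (eul_word sorted_enum (supported_enum x) (supported_enum y)). Qed.
Lemma eul_cox2 x y : eul (cox D x) (cox D y) = eul x y.
Proof. by rewrite eul_cox eul_cox opprK. Qed.
Lemma eul_coxinv x y : eul y (coxinv D x) = - eul x y.
Proof. by rewrite -{2}(coxinvK x) eul_cox opprK. Qed.
Lemma eul_coxinv2 x y : eul (coxinv D x) (coxinv D y) = eul x y.
Proof. by rewrite -eul_cox2 !coxinvK. Qed.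
Lemma K_cox x y : K D (cox D x) (cox D y) = K D x y.
Proof. exact: K_word. Qed.
Lemma K_coxinv x y : K D (coxinv D x) (coxinv D y) = K D x y.
Proof. by rewrite !coxinvE K_word. Qed.
Lemma K_eul_coxinv x y : K D x y = eul x (y - coxinv D y).
Proof. by rewrite eulBr eul_coxinv opprK K_eul. Qed.

(* The dimension vectors [P_i], [I_i] of the indecomposable projective and
   injective representations, for the Coxeter element of the parabolic [s]. *)
Definition proj s i : V := word (take (index i s) s) (sr i).
Definition inj s i : V := word (rev (drop (index i s).+1 s)) (sr i).

Lemma word_inj s i : i \in s -> word s (inj s i) = - proj s i.
Proof.
move=> si; have e w : word s w = word (take (index i s) s) (word (drop (index i s) s) w).
  by rewrite -word_cat cat_take_drop.
rewrite e /inj /proj -linearN /=; congr (word _ _).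
rewrite (drop_nth i) ?index_mem // nth_index //=.
by rewrite wordK_rev refl_sr.
Qed.

Lemma sortedP_cat s1 i s2 : sorted ltn (map val (s1 ++ i :: s2)) ->
  (forall j, j \in s1 -> (j < i)%N) /\ (forall j, j \in s2 -> (i < j)%N).
Proof.
rewrite (sorted_pairwise ltn_trans) map_cat pairwise_cat /= => /and3P[h1 h2 /andP[h3 h4]].
split => j js; last by move/allP: h3; apply; rewrite map_f.
by move/allrelP: h1; apply; rewrite ?map_f ?inE ?eqxx.
Qed.

Lemma split_index s i : i \in s ->
  s = take (index i s) s ++ i :: drop (index i s).+1 s.
Proof.
move=> si; rewrite -{1}(cat_take_drop (index i s) s) (drop_nth i) ?index_mem //.
by rewrite nth_index.
Qed.

Lemma proj_gt s (ss : sorted ltn (map val s)) i j : i \in s ->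
  (i < j)%N -> (proj s i) ord0 j = 0.
Proof.
move=> si ij; rewrite /proj word_notin.
  by rewrite srE; case: eqP => // ji; rewrite ji ltnn in ij.
rewrite {1}(split_index si) in ss; case/sortedP_cat: ss => h _.
by apply/negP => /h; rewrite ltnNge (ltnW ij).
Qed.

Lemma proj_diag s (ss : sorted ltn (map val s)) i : i \in s -> (proj s i) ord0 i = 1.
Proof.
move=> si; rewrite /proj word_notin ?srE ?eqxx //.
rewrite {1}(split_index si) in ss; case/sortedP_cat: ss => h _.
by apply/negP => /h; rewrite ltnn.
Qed.

Lemma inj_lt s (ss : sorted ltn (map val s)) i j : i \in s ->
  (j < i)%N -> (inj s i) ord0 j = 0.
Proof.
move=> si ij; rewrite /inj word_notin.
  by rewrite srE; case: eqP => // ji; rewrite ji ltnn in ij.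
rewrite {1}(split_index si) in ss; case/sortedP_cat: ss => _ h.
by rewrite mem_rev; apply/negP => /h; rewrite ltnNge (ltnW ij).
Qed.

Lemma inj_diag s (ss : sorted ltn (map val s)) i : i \in s -> (inj s i) ord0 i = 1.
Proof.
move=> si; rewrite /inj word_notin ?srE ?eqxx //.
rewrite {1}(split_index si) in ss; case/sortedP_cat: ss => _ h.
by rewrite mem_rev; apply/negP => /h; rewrite ltnn.
Qed.

(** P_i represents the i-th coordinate. By triangularity only the letters j <= i matter; for j < i
    the letter belongs to the prefix [t] that builds P_i, and [word_step] at j says exactly that
    E(P_i, alpha_j) = 0. *)
Lemma eul_proj s (ss : sorted ltn (map val s)) i x : i \in s -> supported s x ->
  eul (proj s i) x = d i * x ord0 i.
Proof.
move=> si sx; rewrite eul_expr (bigD1 i) //= big1 => [|j ji].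
  rewrite addr0 /eul bil_deltar (bigD1 i) //= big1 => [|k ki].
    by rewrite (proj_diag ss) // /ecoef eqxx; ring.
  rewrite /ecoef (negbTE ki); case: ifP => ik; last by rewrite !mulr0.
  by rewrite (proj_gt ss) // mul0r.
case: (boolP (j \in s)) => sj; last by rewrite sx // mul0r.
case: (ltngtP i j) => [ij|ij|/val_inj ij]; last by rewrite ij eqxx in ji.
  rewrite /eul bil_deltar big1 ?mulr0 // => k _.
  rewrite /ecoef; case: eqP => [->|_]; first by rewrite (proj_gt ss) ?mul0r.
  case: ifP => jk; last by rewrite !mulr0.
  by rewrite (proj_gt ss) ?mul0r // (ltn_trans ij jk).
set t := take (index i s) s.
have it : i \notin t.
  have := ss; rewrite {1}(split_index si) => /sortedP_cat[h _].
  by apply/negP => /h; rewrite ltnn.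
have st : sorted ltn (map val t) by rewrite map_take take_sorted.
have jt : j \in t.
  have := ss; rewrite {1}(split_index si) => /sortedP_cat[_ h].
  have := sj; rewrite {1}(split_index si) mem_cat inE (negbTE ji) => /orP[//|/h].
  by rewrite ltnNge (ltnW ij).
suff -> : eul (proj s i) (sr j) = 0 by rewrite mulr0.
rewrite /eul bil_deltar (bigD1 j) //= (word_step st) // -/t {1}/ecoef eqxx mulr1.
have sij : (sr i : V) ord0 j = 0 by rewrite srE (negbTE ji).
rewrite sij sub0r (bigD1 j) //= ltnn andbF sij mulr0 add0r mulNr mulr_suml.
rewrite -sumrN -big_split big1 //= => k kj.
rewrite /ecoef (negbTE kj) (_ : word t _ = proj s i) //.
case: (ltngtP j k) => [jk|jk|/val_inj jk]; last by rewrite jk eqxx in kj.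
  case: (boolP (k \in t)) => kt /=.
    by rewrite [proj s i _ _ * _]mulrC -mulrA [_ * d j]mulrC mulrA dsym; ring.
  by rewrite /proj word_notin // [(sr i) _ _ * _]mulrC -mulrA [_ * d j]mulrC mulrA dsym; ring.
rewrite !mulr0 addr0 andbF srE; case: eqP => [ki|]; last by rewrite !mulr0 mul0r oppr0.
by rewrite ki ltnNge (ltnW ij) in jk.
Qed.

(** Transported from [eul_proj] by E(cx, y) = -E(y, x), since the Coxeter element of [s] maps I_i to
    -P_i. *)
Lemma eul_inj s (ss : sorted ltn (map val s)) i x : i \in s -> supported s x ->
  eul x (inj s i) = d i * x ord0 i.
Proof.
move=> si sx; rewrite -(eul_proj ss si sx).
have sI : supported s (inj s i).
  move=> j sj; rewrite /inj word_notin; first exact: supported_sr sj.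
  by apply: contra sj; rewrite mem_rev => /mem_drop.
by rewrite -[LHS]opprK -(eul_word ss) // word_inj // eulNl opprK.
Qed.

End Symm.
End Coxeter.

Lemma int_ge1 (x : rat) : x \is a Num.int -> 0 < x -> 1 <= x.
Proof. by move=> /intrP[m ->]; rewrite ltr0z ler1z. Qed.

Lemma int_lt1 (x : rat) : x \is a Num.int -> 0 <= x -> x < 1 -> x = 0.
Proof.
move=> xi x0 x1; apply/eqP; rewrite eq_le x0 andbT leNgt.
by apply/negP => /(int_ge1 xi); rewrite leNgt x1.
Qed.

Lemma int_unit (t : rat) : 0 < t -> t \is a Num.int -> t^-1 \is a Num.int -> t = 1.
Proof.
move=> t0 ti vi; apply/eqP; rewrite eq_le int_ge1 // andbT.
by rewrite -(mulfV (lt0r_neq0 t0)) ler_peMr ?int_ge1 ?invr_gt0 // ltW.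
Qed.

(** * Real roots *)

Section Affine.
Variables (n : nat) (D : cdata n).
Local Notation V := 'rV[rat]_n.
Local Notation d := (cd D).
Local Notation ca := (a D).
Local Notation K := (K D).
Local Notation E := (eul D).
Local Notation dl := (delta D).
Implicit Types (u v w x y : V) (s : seq 'I_n) (i j : 'I_n).

Hypothesis good : good_data D.

Lemma dpos i : 0 < d i.
Proof. by case: good => _ [_ [[h _] _]]; apply: h. Qed.
Lemma dsym i j : d i * ca i j = d j * ca j i.
Proof. by case: good => _ [_ [[_ h] _]]; apply: h. Qed.
Lemma a_diag i : ca i i = 2.
Proof. by rewrite /a; case: good => -[[-> _] _] _. Qed.
Lemma a_le0 i j : i != j -> ca i j <= 0.
Proof. by rewrite /a lerz0; case: good => -[[_ [h _]] _] _; apply: h. Qed.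
Lemma a_int i j : ca i j \is a Num.int.
Proof. exact: intr_int. Qed.
Lemma dl_gt0 i : 0 < dl ord0 i.
Proof. by rewrite mxE ltr0n; case: good => _ [_ [_ [[h _] _]]]; apply: h. Qed.
Lemma dl_int i : dl ord0 i \is a Num.int.
Proof. by rewrite mxE natr_int. Qed.
Hint Resolve dpos dsym a_diag dl_gt0 dl_int : core.

Lemma Kcv_dl i : Kcv D i dl = 0.
Proof.
case: good => _ [_ [_ [[_ [h _]] _]]]; have /(congr1 (fun z : int => z%:~R : rat)) := h i.
rewrite rmorph_sum /= => h'; rewrite -[RHS]h'; apply: eq_bigr => j _.
by rewrite mxE intrM.
Qed.

Lemma K_dlr v : K v dl = 0.
Proof.
rewrite {1}(vecE v) (K_sym dsym) K_sumr big1 // => i _.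
by rewrite KZr (K_srr dsym) Kcv_dl !mulr0.
Qed.
Lemma K_dll v : K dl v = 0. Proof. by rewrite (K_sym dsym) K_dlr. Qed.

Lemma refl_dl i : refl D i dl = dl.
Proof. by rewrite /refl Kcv_dl scale0r subr0. Qed.
Lemma word_dl s : word D s dl = dl.
Proof. by elim: s => //= i s ->; exact: refl_dl. Qed.
Lemma cox_dl : cox D dl = dl. Proof. exact: word_dl. Qed.
Lemma coxinv_dl : coxinv D dl = dl. Proof. by rewrite coxinvE word_dl. Qed.

(** Writing v_i = X_i delta_i and using that each row of the Gram matrix annihilates delta turns [K]
    into a weighted graph Laplacian. Off the diagonal the weights are nonnegative, whence
    semidefiniteness. *)
Lemma K_squares v : K v v = \sum_i \sum_j - kcoef D i j * dl ord0 i * dl ord0 j *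
   (v ord0 i / dl ord0 i - v ord0 j / dl ord0 j) ^+ 2 / 2.
Proof.
pose X i := v ord0 i / dl ord0 i.
have vX i : v ord0 i = X i * dl ord0 i by rewrite /X divfK // gt_eqF.
have k0 i : \sum_j kcoef D i j * dl ord0 j = 0.
  have := Kcv_dl i; rewrite /Kcv => /(congr1 ( *%R (d i))); rewrite mulr0 mulr_sumr => h.
  by rewrite -[RHS]h; apply: eq_bigr => j _; rewrite /kcoef mulrA.
transitivity (\sum_i \sum_j (kcoef D i j * dl ord0 i * dl ord0 j * (X i * X j)
   - (kcoef D i j * dl ord0 j) * (X i ^+ 2 * dl ord0 i / 2)
   - (kcoef D j i * dl ord0 i) * (X j ^+ 2 * dl ord0 j / 2))).
  under eq_bigr do rewrite sumrB sumrB -mulr_suml k0 mul0r subr0.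
  rewrite sumrB [X in _ - X]exchange_big /= [X in _ - X]big1 ?subr0 => [|j _].
    rewrite KE; apply: eq_bigr => i _; apply: eq_bigr => j _.
    by rewrite !vX; ring.
  by rewrite -mulr_suml k0 mul0r.
apply: eq_bigr => i _; apply: eq_bigr => j _; rewrite -/(X i) -/(X j).
have -> : kcoef D j i = kcoef D i j by rewrite /kcoef dsym.
by field.
Qed.

Lemma K_term_ge0 v i j : 0 <= - kcoef D i j * dl ord0 i * dl ord0 j *
   (v ord0 i / dl ord0 i - v ord0 j / dl ord0 j) ^+ 2 / 2.
Proof.
case: (eqVneq i j) => [->|ij]; first by rewrite subrr expr0n mulr0 mul0r.
have k0 : 0 <= - kcoef D i j.
  by rewrite oppr_ge0 /kcoef mulr_ge0_le0 ?a_le0 // ltW.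
by rewrite divr_ge0 // mulr_ge0 ?sqr_ge0 // !mulr_ge0 // ltW.
Qed.

Lemma K_ge0 v : 0 <= K v v.
Proof. by rewrite K_squares; do 2!apply: sumr_ge0 => ? _; apply: K_term_ge0. Qed.

(** All squares in [K_squares] vanish, so v_i / delta_i is constant along edges; its level set
    through [e] is closed under adjacency and indecomposability makes it everything. *)
Lemma K_eq0 v e : K v v = 0 -> v = (v ord0 e / dl ord0 e) *: dl.
Proof.
rewrite K_squares => /eqP; rewrite psumr_eq0 => [/allP h|]; last first.
  by move=> i _; apply: sumr_ge0 => ? _; apply: K_term_ge0.
pose X i := v ord0 i / dl ord0 i.
have hX i j : ca i j != 0 -> X i = X j.
  move=> aij; have := h i (mem_index_enum _); rewrite implyTb psumr_eq0 => [/allP h'|]; last first.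
    by move=> k _; apply: K_term_ge0.
  have := h' j (mem_index_enum _); rewrite implyTb !mulf_eq0 oppr_eq0 /kcoef mulf_eq0.
  rewrite (negbTE aij) (gt_eqF (dpos i)) !(gt_eqF (dl_gt0 _)) !orbF orbb subr_eq0.
  by move/eqP.
pose S := [set i | X i == X e].
have ST : S = setT.
  apply/eqP/negPn/negP => SnT; have S0 : S != set0.
    by apply/set0Pn; exists e; rewrite inE.
  case: good => -[_ [ind _]] _; have [i [j [iS jS aij]]] := ind S S0 SnT.
  have iE : X i = X e by apply/eqP; rewrite inE in iS.
  case/negP: jS; rewrite inE -iE eq_sym; apply/eqP; apply: hX.
  by rewrite /a intr_eq0.
apply/rowP => i; rewrite mxE -/(X e); have iS : i \in S by rewrite ST inE.
have -> : X e = X i by symmetry; apply/eqP; rewrite inE in iS.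
by rewrite /X divfK // gt_eqF.
Qed.

Definition q v := E v v.

Lemma K_q v : K v v = 2 * q v. Proof. exact: K_eul2. Qed.
Lemma q_ge0 v : 0 <= q v. Proof. by have := K_ge0 v; rewrite K_q; lra. Qed.
Lemma q_eq0 v e : q v = 0 -> v = (v ord0 e / dl ord0 e) *: dl.
Proof. by move=> h; apply: K_eq0; rewrite K_q h mulr0. Qed.
Lemma q_isom (f : V -> V) v : K (f v) (f v) = K v v -> q (f v) = q v.
Proof. by rewrite !K_q; lra. Qed.
Lemma q_dl v t : q (v + t *: dl) = q v.
Proof.
have : K (v + t *: dl) (v + t *: dl) = K v v by rewrite KDl KDr !KZl !KZr K_dll !K_dlr; ring.
by rewrite !K_q; lra.
Qed.
Lemma q_N v : q (- v) = q v. Proof. by rewrite /q eulNl eulNr opprK. Qed.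
Lemma q_Z t v : q (t *: v) = t ^+ 2 * q v.
Proof. by rewrite /q eulZl eulZr mulrA. Qed.
Lemma q_sr i : q (sr i) = d i.
Proof. by rewrite /q eul_srsr /ecoef eqxx mulr1. Qed.
Lemma q_cox v : q (cox D v) = q v. Proof. by apply: q_isom; rewrite (K_cox dsym). Qed.
Lemma q_coxinv v : q (coxinv D v) = q v. Proof. by apply: q_isom; rewrite (K_coxinv dsym). Qed.

Definition intvec v := forall i, v ord0 i \is a Num.int.
(** An arithmetic description of real roots: the last clause says that the coroot of [v] has
    integral coordinates. [real_lroot] and [lroot_real] show the equivalence with [real_root]. *)
Definition lroot v := [/\ intvec v, 0 < q v & forall i, v ord0 i * d i / q v \is a Num.int].

Lemma lroot_K v x : lroot v -> intvec x -> K v x / q v \is a Num.int.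
Proof.
case=> _ _ cv ix; rewrite /Defs.K mulr_suml rpred_sum // => i _.
rewrite mulr_suml rpred_sum // => j _.
rewrite (_ : _ / _ = v ord0 i * d i / q v * (x ord0 j * ca i j)); last by ring.
by apply: rpredM; [exact: cv | apply: rpredM; [exact: ix | exact: a_int]].
Qed.

Lemma ecase_int i j :
  (if i == j then 1 else if (j < i)%N then ca i j else 0) \is a Num.int.
Proof. by case: ifP => _; [exact: rpred1 | case: ifP => _; rewrite ?a_int ?rpred0]. Qed.

Lemma lroot_Er v x : lroot v -> intvec x -> E v x / q v \is a Num.int.
Proof.
case=> _ _ cv ix; rewrite /eul /bil mulr_suml rpred_sum // => i _.
rewrite mulr_suml rpred_sum // => j _; rewrite /ecoef.
set e := (if _ then _ else _).
rewrite (_ : _ / _ = v ord0 i * d i / q v * (x ord0 j * e)); last by ring.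
by apply: rpredM; [exact: cv | apply: rpredM; [exact: ix | exact: ecase_int]].
Qed.

Lemma coord_sum_K v x : K v x = \sum_i x ord0 i * K v (sr i).
Proof. by rewrite {1}(vecE x) K_sumr; apply: eq_bigr => i _; rewrite KZr. Qed.

(** Split v = p - m into positive and negative parts. Their supports are disjoint, so K(p, m) <= 0
    and q p + q m <= q v. Both q p / q v and q m / q v are nonnegative integers, so one of them is
    0. A part with q = 0 is a multiple of delta; if nonzero it has full support, which kills the
    other part and gives q v = 0. *)
Lemma lroot_sign v : lroot v -> (forall i, 0 <= v ord0 i) \/ (forall i, v ord0 i <= 0).
Proof.
move=> [iv qv cv].
pose p : V := \row_i Num.max (v ord0 i) 0; pose m := p - v.
have mE i : m ord0 i = Num.max (- v ord0 i) 0.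
  by rewrite !mxE; case: (lerP (v ord0 i) 0) => h; case: (lerP (- v ord0 i) 0) => h'; lra.
have pE i : p ord0 i = Num.max (v ord0 i) 0 by rewrite mxE.
have pm i : p ord0 i * m ord0 i = 0.
  by rewrite mE pE; case: (lerP (v ord0 i) 0) => h; case: (lerP (- v ord0 i) 0) => h';
    rewrite ?(mul0r, mulr0) //; lra.
have p0 i : 0 <= p ord0 i by rewrite pE le_max lexx orbT.
have m0 i : 0 <= m ord0 i by rewrite mE le_max lexx orbT.
have Kpm : K p m <= 0.
  rewrite /Defs.K sumr_le0 // => i _; rewrite sumr_le0 // => j _.
  case: (eqVneq i j) => [->|ij]; first by rewrite pm !mul0r.
  by rewrite mulr_ge0_le0 ?a_le0 // !mulr_ge0 // ltW.
(* Each coordinate of p and m is 0 or, up to sign, a coordinate of v, so both inherit the two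
   integrality conditions relative to q v. *)
have intq x : (forall i, x ord0 i \is a Num.int) ->
    (forall i, x ord0 i * d i / q v \is a Num.int) -> q x / q v \is a Num.int.
  move=> ix cx; rewrite /q /eul /bil mulr_suml rpred_sum // => i _.
  rewrite mulr_suml rpred_sum // => j _; rewrite /ecoef.
  set e := (if _ then _ else _).
  rewrite (_ : _ / _ = x ord0 i * d i / q v * (x ord0 j * e)); last by ring.
  apply: rpredM; [exact: cx | apply: rpredM; [exact: ix | exact: ecase_int]].
have ip : q p / q v \is a Num.int.
  by apply: intq => i; rewrite pE; case: (lerP (v ord0 i) 0) => _; rewrite ?mul0r ?rpred0.
have im : q m / q v \is a Num.int.
  apply: intq => i; rewrite mE; case: (lerP (- v ord0 i) 0) => _;
    by rewrite ?mul0r ?rpred0 ?mulNr ?rpredN.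
have vE : v = p - m by rewrite /m opprB addrCA subrr addr0.
clearbody m; clearbody p.
have qE : q p + q m <= q v.
  have : K v v = K p p + K m m - 2 * K p m.
    by rewrite {1 2}vE KBl !KBr (K_sym dsym m p); ring.
  by rewrite !K_q; lra.
have r0 x : 0 <= q x / q v by rewrite divr_ge0 ?q_ge0.
have r1 : q p / q v + q m / q v <= 1 by rewrite -mulrDl ler_pdivrMr // mul1r.
have [e|e] : q p = 0 \/ q m = 0.
  case: (ltrP (q p / q v) 1) => h.
    by left; have /eqP := int_lt1 ip (r0 p) h; rewrite mulf_eq0 invr_eq0 (gt_eqF qv) orbF => /eqP.
  right; have /eqP := int_lt1 im (r0 m) ltac:(lra).
  by rewrite mulf_eq0 invr_eq0 (gt_eqF qv) orbF => /eqP.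
  right => i; have := pE i; rewrite (q_eq0 i e) mxE divfK ?gt_eqF // pE.
  case: (lerP (v ord0 i) 0) => // vi _.
  have pi : 0 < p ord0 i by rewrite pE; case: (lerP (v ord0 i) 0) => //; lra.
  have pj j : 0 < p ord0 j.
    by have := q_eq0 i e => /rowP/(_ j) ->; rewrite mxE mulr_gt0 ?divr_gt0.
  have : m = 0.
    apply/rowP => j; rewrite [RHS]mxE; apply/eqP; have /eqP := pm j.
    by rewrite mulf_eq0 (gt_eqF (pj j)).
  move=> m00; have qp : q v = 0 by rewrite vE m00 subr0.
  by rewrite qp ltxx in qv.
left => i; rewrite leNgt; apply/negP => vi.
have mi : 0 < m ord0 i by rewrite mE; case: (lerP (- v ord0 i) 0) => //; lra.
have mj j : 0 < m ord0 j.
  by have := q_eq0 i e => /rowP/(_ j) ->; rewrite mxE mulr_gt0 ?divr_gt0.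
have : p = 0.
  apply/rowP => j; rewrite [RHS]mxE; apply/eqP; have /eqP := pm j.
  by rewrite mulf_eq0 (gt_eqF (mj j)) orbF.
move=> p00; have qp : q v = 0 by rewrite vE p00 sub0r q_N.
by rewrite qp ltxx in qv.
Qed.

Lemma lroot_N v : lroot v -> lroot (- v).
Proof.
case=> iv qv cv; split=> [i||i]; rewrite ?q_N ?mxE ?rpredN //.
by rewrite !mulNr rpredN.
Qed.

Lemma lroot_sr i : lroot (sr i).
Proof.
split=> [j||j]; rewrite ?q_sr ?srE //.
case: eqP => [->|_]; last by rewrite !mul0r rpred0.
by rewrite mul1r divff ?rpred1 // gt_eqF.
Qed.

Lemma intvec_refl i v : intvec v -> intvec (refl D i v).
Proof.
move=> iv j; rewrite refl_coord rpredB // rpredM ?natr_int //.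
by rewrite /Kcv rpred_sum // => k _; rewrite rpredM ?a_int.
Qed.

Lemma lroot_refl i v : lroot v -> lroot (refl D i v).
Proof.
move=> rv; have [iv qv cv] := rv.
have qe : q (refl D i v) = q v by apply: q_isom; rewrite K_refl.
split; rewrite ?qe //; first exact: intvec_refl.
move=> j; rewrite refl_coord mulrBl mulrBl rpredB //.
case: eqP => [->|_]; last by rewrite mulr0 !mul0r rpred0.
have [isr _ _] := lroot_sr i; have := lroot_K rv isr.
by rewrite (K_srr dsym) mulr1 [d i * _]mulrC.
Qed.

Lemma real_lroot v : real_root D v -> lroot v.
Proof. by elim=> [i|i u _]; [apply: lroot_sr | apply: lroot_refl]. Qed.

Lemma real_N v : real_root D v -> real_root D (- v).
Proof.
elim=> [i|i u _ h]; last by rewrite -linearN; constructor.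
by rewrite -(refl_sr dsym dpos a_diag); do 2!constructor.
Qed.

Definition nonneg v := forall i, 0 <= v ord0 i.

Lemma lroot_neq0 v : lroot v -> v != 0.
Proof. by case=> _ qv _; apply/eqP => v0; rewrite v0 /q eul0l ltxx in qv. Qed.

Lemma pos_nonneg v : positive v -> nonneg v. Proof. by case. Qed.
Lemma nonneg_pos v : lroot v -> nonneg v -> positive v.
Proof. by move=> /lroot_neq0. Qed.

Lemma lroot_posneg v : lroot v -> nonneg v \/ nonneg (- v).
Proof.
by move=> /lroot_sign[h|h]; [left|right] => i; rewrite ?mxE ?oppr_ge0.
Qed.

Lemma nonneg_opp v : nonneg v -> nonneg (- v) -> v = 0.
Proof.
move=> h h'; apply/rowP => i; have := h i; have := h' i; rewrite !mxE oppr_ge0 => a b.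
by apply/eqP; rewrite eq_le a b.
Qed.

(** s_i alters only the i-th coordinate, so all others must vanish; integrality of the root and of
    its coroot then makes both v_i and its inverse integers. *)
Lemma nonneg_refl v i : lroot v -> nonneg v -> nonneg (- refl D i v) -> v = sr i.
Proof.
move=> rv pv nv; have vE : v = v ord0 i *: sr i.
  apply/rowP => j; rewrite mxE srE; case: eqP => [->|/eqP ji]; first by rewrite mulr1.
  rewrite mulr0; have := nv j; rewrite mxE refl_coord (negbTE ji) mulr0 subr0 oppr_ge0.
  by move=> a; apply/eqP; rewrite eq_le a pv.
have [iv qv cv] := rv.
have vi : 0 < v ord0 i.
  by rewrite lt_def pv andbT; apply/eqP => h; have := lroot_neq0 rv; rewrite vE h scale0r eqxx.
suff e : v ord0 i = 1 by rewrite vE e scale1r.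
apply: int_unit => //; have := cv i.
have qE : q v = v ord0 i ^+ 2 * d i by rewrite {1}vE q_Z q_sr.
rewrite qE (_ : _ / _ = (v ord0 i)^-1) //; field.
by rewrite !gt_eqF.
Qed.

Definition ht v := \sum_i v ord0 i.

Lemma ht_int v : intvec v -> ht v \is a Num.int.
Proof. by move=> iv; rewrite rpred_sum. Qed.
Lemma ht_ge0 v : nonneg v -> 0 <= ht v.
Proof. by move=> h; rewrite sumr_ge0. Qed.
Lemma htD u v : ht (u + v) = ht u + ht v.
Proof. by rewrite /ht -big_split; apply: eq_bigr => i _; rewrite mxE. Qed.
Lemma htZ t v : ht (t *: v) = t * ht v.
Proof. by rewrite /ht mulr_sumr; apply: eq_bigr => i _; rewrite mxE. Qed.
Lemma htN v : ht (- v) = - ht v.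
Proof. by rewrite -scaleN1r htZ mulN1r. Qed.
Lemma ht_sr i : ht (sr i) = 1.
Proof.
rewrite /ht (bigD1 i) //= big1 ?addr0 => [|j ji]; first by rewrite srE eqxx.
by rewrite srE (negbTE ji).
Qed.
Lemma ht_eq0 v : nonneg v -> ht v = 0 -> v = 0.
Proof.
move=> h /eqP; rewrite psumr_eq0 => [/allP h'|i _]; last exact: h.
by apply/rowP => i; rewrite mxE; apply/eqP; apply: h'; rewrite mem_index_enum.
Qed.

(** Descent on the height: K(w, w) > 0 yields a simple root with K(w, alpha_i) > 0, and s_i then
    lowers the height by at least 1 unless w is alpha_i. *)
Lemma lroot_real v : lroot v -> real_root D v.
Proof.
suff pos w : lroot w -> nonneg w -> real_root D w.
  move=> rv; case: (lroot_posneg rv) => h; first exact: pos.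
  by rewrite -[v]opprK; apply: real_N; apply: pos h; apply: lroot_N.
move=> rw pw; have [m] : exists m : nat, ht w < m%:R.
  by exists (Num.truncn (ht w)).+1; rewrite truncnS_gt.
elim: m w rw pw => [|m IH] w rw pw hw.
  by have := ht_ge0 pw; rewrite leNgt hw.
have [iw qw _] := rw.
have [i wi Ki] : exists2 i, 0 < w ord0 i & 0 < K w (sr i).
  apply: NNPP => nex; have : K w w <= 0.
    rewrite {2}(vecE w) K_sumr sumr_le0 // => i _; rewrite KZr.
    have := pw i; rewrite le_eqVlt => /orP[/eqP<-|wi]; first by rewrite mul0r.
    rewrite pmulr_rle0 // leNgt; apply/negP => Ki; apply: nex; by exists i.
  by rewrite K_q; lra.
have rr := lroot_refl i rw.
have : real_root D (refl D i w).
  case: (lroot_posneg rr) => h; last first.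
    by rewrite (nonneg_refl rw pw h); do 2!constructor.
  apply: IH => //; have k1 : 1 <= Kcv D i w.
    apply: int_ge1; first by rewrite /Kcv rpred_sum // => k _; rewrite rpredM ?a_int.
    by rewrite -(pmulr_rgt0 _ (dpos i)) -(K_srr dsym).
  by move: hw; rewrite /refl htD htN htZ ht_sr -natr1; lra.
by move=> h; rewrite -(refl_inv dsym dpos a_diag i w); constructor.
Qed.

Lemma lroot_word s v : lroot v -> lroot (word D s v).
Proof. by move=> rv; elim: s => //= i s; apply: lroot_refl. Qed.
Lemma lroot_cox v : lroot v -> lroot (cox D v). Proof. exact: lroot_word. Qed.
Lemma lroot_coxinv v : lroot v -> lroot (coxinv D v).
Proof. by rewrite coxinvE; apply: lroot_word. Qed.

(** Reflections preserve integrality in both directions, so primitivity passes from the simple roots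
    to all roots. *)
Lemma lroot_prim v t : lroot v -> intvec (t *: v) -> t \is a Num.int.
Proof.
move=> /lroot_real; elim=> [i h|i u _ IH h].
  by have := h i; rewrite mxE srE eqxx mulr1.
by apply: IH; rewrite -(refl_inv dsym dpos a_diag i (t *: u)) linearZ; apply: intvec_refl.
Qed.

Lemma lroot_prop v t : 0 < t -> lroot v -> lroot (t *: v) -> t = 1.
Proof.
move=> t0 rv rtv; apply: int_unit => //.
  by apply: (lroot_prim rv); case: rtv.
apply: (lroot_prim rtv); rewrite scalerA mulVf ?scale1r ?gt_eqF //.
by case: rv.
Qed.

(* A node where both marks are 1 : the affine node up to a diagram automorphism. *)
Definition special e := cdl D e = 1%N /\ cdvl D e = 1%N.

Lemma special_aff : special (caff D).
Proof. by case: good => _ [_ [_ [_ [_ h]]]]. Qed.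

Lemma dl_special e : special e -> dl ord0 e = 1.
Proof. by case=> h _; rewrite mxE h. Qed.

(** The vector with coordinates [delta^vee : alpha_i^vee] / d_i lies in the radical of [K], so it is
    a multiple of delta; the two marks 1 at [e] fix the factor. *)
Lemma cdvlE e i : special e -> (cdvl D i)%:R = d i * dl ord0 i / d e.
Proof.
case=> e1 e2; pose v : V := \row_i ((cdvl D i)%:R / d i).
have v0 k : Kcv D k v = 0.
  case: good => _ [_ [_ [_ [[_ [h _]] _]]]].
  have /(congr1 (fun z : int => z%:~R : rat)) := h k.
  rewrite rmorph_sum /= => h'; apply: (mulfI (lt0r_neq0 (dpos k))); rewrite mulr0 -[RHS]h'.
  rewrite /Kcv mulr_sumr; apply: eq_bigr => j _.
  rewrite !mxE intrM mulrA dsym /a; field.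
  by rewrite gt_eqF.
have /(K_eq0 e) : K v v = 0.
  by rewrite coord_sum_K big1 // => k _; rewrite (K_srr dsym) v0 !mulr0.
move/rowP/(_ i); rewrite !mxE e1 e2 => h.
rewrite -[LHS](divfK (lt0r_neq0 (dpos i))) h; field.
by rewrite gt_eqF.
Qed.

(** The shift adds m d_e / q x times the coordinates of delta^vee to the coordinates of the coroot,
    hence the integrality condition. *)
Lemma lroot_shift e x m : special e -> lroot x -> m \is a Num.int ->
  m * d e / q x \is a Num.int -> lroot (x + m *: dl).
Proof.
move=> se [ix qx cx] im cm; split=> [i||i]; rewrite ?q_dl //.
  by rewrite 2!mxE rpredD // rpredM.
rewrite 2!mxE mulrDl mulrDl rpredD //.
rewrite (_ : _ / _ = m * d e / q x * (cdvl D i)%:R).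
  by rewrite rpredM ?natr_int.
by rewrite (cdvlE i se); field; rewrite !gt_eqF.
Qed.

(** The shift by m = -x_e always satisfies the criterion: integrality of the coroot of x at [e] is
    precisely what is required. It is the projection along delta to the vectors vanishing at [e]. *)
Lemma lroot_proj e x : special e -> lroot x -> lroot (x - x ord0 e *: dl).
Proof.
move=> se rx; rewrite -scaleNr; have [ix qx cx] := rx.
by apply: (lroot_shift se) => //; rewrite ?rpredN // !mulNr rpredN.
Qed.

Lemma lroot_dl t : ~ lroot (t *: dl).
Proof.
case=> _; have -> : t *: dl = 0 + t *: dl by rewrite add0r.
by rewrite q_dl /q eul0l ltxx.
Qed.

End Affine.

(** * Termination and repetition of iterated maps *)

Lemma first_failure (Q : nat -> Prop) : Q 0%N -> (exists k, ~ Q k) ->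
  exists k, (forall m, (m <= k)%N -> Q m) /\ ~ Q k.+1.
Proof.
move=> Q0 [k0 nQ]; apply: NNPP => nex; apply: nQ.
suff h k m : (m <= k)%N -> Q m by exact: (h k0 k0).
elim: k m => [|k IH] m; first by rewrite leqn0 => /eqP ->.
rewrite leq_eqVlt => /orP[/eqP ->|]; last exact: IH.
by apply: NNPP => nQ; apply: nex; exists k.
Qed.

Section Finiteness.
Variable n : nat.
Local Notation V := 'rV[rat]_n.

Lemma pigeonhole (f : nat -> V) (b : nat) :
  (forall k, intvec (f k)) -> (forall k, nonneg (f k)) ->
  (forall k i, (f k) ord0 i <= b%:R) -> exists k l, (k < l)%N /\ f k = f l.
Proof.
move=> fi f0 fb; pose g k : {ffun 'I_n -> 'I_b.+1} := [ffun i => inord (Num.truncn ((f k) ord0 i))].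
have fg k l : g k = g l -> f k = f l.
  move=> /ffunP e; apply/rowP => i; have := e i; rewrite !ffunE => /(congr1 val) /=.
  have lt m : (Num.truncn ((f m) ord0 i) < b.+1)%N.
    by rewrite ltnS -(ler_nat rat) truncnK ?fb // natrEint fi f0.
  rewrite !inordK ?lt // => h.
  have tk m : (f m) ord0 i = (Num.truncn ((f m) ord0 i))%:R.
    by rewrite truncnK // natrEint fi f0.
  by rewrite tk h -tk.
pose N := #|{ffun 'I_n -> 'I_b.+1}|.
have ninj : ~ injective (fun k : 'I_N.+1 => g k).
  by move=> /leq_card; rewrite card_ord ltnn.
apply: NNPP => nex; apply: ninj => k l e; apply: val_inj.
case: (ltngtP k l) => // kl; case: nex; first by exists k, l; rewrite (fg _ _ e).
by exists l, k; rewrite (fg _ _ e).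
Qed.
End Finiteness.

(** * Sign changes under Coxeter elements *)

Section Signs.
Variables (n : nat) (D : cdata n).
Local Notation V := 'rV[rat]_n.
Local Notation d := (cd D).
Local Notation K := (K D).
Local Notation E := (eul D).
Local Notation dl := (delta D).
Local Notation q := (q D).
Local Notation lroot := (lroot D).
Implicit Types (u v w x y : V) (s : seq 'I_n) (i j : 'I_n).

Hypothesis good : good_data D.
Local Notation dsym := (dsym good).
Local Notation dpos := (dpos good).
Local Notation a2 := (a_diag good).

Definition fin : seq 'I_n := [seq i <- enum 'I_n | i != caff D].

Lemma sorted_fin : sorted ltn (map val fin).
Proof.
apply: (subseq_sorted ltn_trans _ (sorted_enum n)).
by apply: map_subseq; apply: filter_subseq.
Qed.

Lemma mem_fin i : (i \in fin) = (i != caff D).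
Proof. by rewrite mem_filter mem_enum andbT. Qed.

Lemma supported_fin x : supported fin x <-> x ord0 (caff D) = 0.
Proof.
split=> [h|h i]; first by apply: h; rewrite mem_fin eqxx.
by rewrite mem_fin negbK => /eqP ->.
Qed.

Lemma sorted_uniq_val s : sorted ltn (map val s) -> uniq s.
Proof. by move=> h; rewrite -(map_inj_uniq val_inj); apply: sorted_uniq h => //; [apply: ltn_trans|apply: ltnn]. Qed.

(** Reading the word from the right, the last nonnegative partial image is made negative by one
    simple reflection, hence is that simple root. *)
Lemma sign_change s x : lroot x -> nonneg x -> ~ nonneg (word D s x) ->
  exists s1 i s2, s = s1 ++ i :: s2 /\ word D s2 x = sr i.
Proof.
move=> rx px; elim: s => [//|i s IH] /= nn.
case: (classic (nonneg (word D s x))) => h.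
  exists [::], i, s; split => //; apply: (nonneg_refl good) => //.
    exact: lroot_word.
  by have := lroot_posneg good (lroot_refl good i (lroot_word good s rx)); case.
by have [s1 [j [s2 [-> e]]]] := IH h; exists (i :: s1), j, s2.
Qed.

(** The inversion set of a word with distinct letters: undoing the letters read before the sign
    change expresses x through the simple root reached there. *)
Lemma neg_inj s x : uniq s -> lroot x -> nonneg x -> ~ nonneg (word D s x) ->
  exists2 i, i \in s & x = inj D s i.
Proof.
move=> us rx px /(sign_change rx px)[s1 [i [s2 [e h]]]].
exists i; first by rewrite e mem_cat inE eqxx orbT.
have is1 : i \notin s1.
  by move: us; rewrite e cat_uniq /= negb_or => /and3P[_ /andP[]].
rewrite /inj e index_cat (negbTE is1) /= eqxx addn0 drop_cat ltnNge leqnSn /=.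
by rewrite subSnn drop1 /= -h (word_revK dsym dpos a2).
Qed.

Lemma neg_proj s x : uniq s -> lroot x -> nonneg x -> ~ nonneg (word D (rev s) x) ->
  exists2 i, i \in s & x = proj D s i.
Proof.
move=> us rx px /(sign_change rx px)[s1 [i [s2 [e h]]]].
have {}e : s = rev s2 ++ i :: rev s1 by rewrite -[s]revK e rev_cat rev_cons cat_rcons.
exists i; first by rewrite e mem_cat inE eqxx orbT.
have is1 : i \notin rev s2.
  by move: us; rewrite e cat_uniq /= negb_or => /and3P[_ /andP[]].
rewrite /proj e index_cat (negbTE is1) /= eqxx addn0 take_size_cat //.
by rewrite -h (word_revK dsym dpos a2).
Qed.

(** When no letter repeats, coordinate i is changed by the letter i alone, so a vector fixed by the
    product is fixed by every factor. *)
Lemma word_fixed s u : uniq s -> word D s u = u -> forall l, l \in s -> Kcv D l u = 0.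
Proof.
elim: s => //= i s IH /andP[is_ us] e.
have k0 : Kcv D i (word D s u) = 0.
  have := congr1 (fun v : V => v ord0 i) e; rewrite refl_coord word_notin // eqxx mulr1.
  by move=> h; lra.
have {}e : word D s u = u by rewrite -[RHS]e /refl k0 scale0r subr0.
move=> l; rewrite inE => /orP[/eqP->|]; first by rewrite -e.
exact: IH.
Qed.

Lemma K_supported0 s u x : (forall l, l \in s -> Kcv D l u = 0) -> supported s x -> K u x = 0.
Proof.
move=> h sx; rewrite coord_sum_K big1 // => i _.
case: (boolP (i \in s)) => si; first by rewrite (K_srr dsym) h // !mulr0.
by rewrite sx // mul0r.
Qed.

Section SpecialNode.
Variable e : 'I_n.
Hypothesis se : special D e.

(** The least positive integer m such that m d_e / q x is integral, so that shifts by m delta meet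
    the criterion of [lroot_shift]. It depends on x only through q x and is therefore constant along
    orbits. *)
Definition bnd x : rat := (denq (d e / q x))%:~R.

Lemma bnd_gt0 x : 0 < bnd x.
Proof. by rewrite /bnd ltr0z denq_gt0. Qed.

Lemma bnd_int x : bnd x * d e / q x \is a Num.int.
Proof.
rewrite -mulrA /bnd; set r := d e / q x.
rewrite -{2}(divq_num_den r) mulrC divfK ?intr_int //.
by rewrite intr_eq0 denq_neq0.
Qed.

Lemma lroot_shift_bnd x : lroot x -> lroot (x - bnd x *: dl).
Proof.
move=> rx; rewrite -scaleNr; apply: (lroot_shift good se) => //.
  by rewrite rpredN intr_int.
by rewrite 2!mulNr rpredN bnd_int.
Qed.

(** Shifting x by -bnd delta gives a root whose coordinate at [e] is negative, hence a negative
    root. *)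
Lemma fin_bounded x : lroot x -> x ord0 e = 0 -> nonneg (bnd x *: dl - x).
Proof.
move=> rx xe; case: (lroot_posneg good (lroot_shift_bnd rx)) => [/(_ e)|]; last by rewrite opprB.
rewrite !mxE xe add0r (proj1 se) mulr1 => h.
by have := bnd_gt0 x; lra.
Qed.

Lemma fin_bounded2 x : lroot x -> x ord0 e = 0 -> nonneg (x + bnd x *: dl).
Proof.
move=> rx xe i; have := fin_bounded (lroot_N rx) _ i.
by rewrite !mxE xe oppr0 /bnd q_N opprK addrC => /(_ erefl).
Qed.
End SpecialNode.

Lemma nat_bound (M : V) : exists b : nat, forall i, M ord0 i <= b%:R.
Proof.
exists (\max_i (Num.truncn (M ord0 i)).+1)%N => i.
apply: (le_trans (ltW (truncnS_gt _))); rewrite ler_nat.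
exact: (leq_bigmax_cond i).
Qed.

Definition cf := word D fin.
Definition cfinv := word D (rev fin).
HB.instance Definition _ := GRing.isLinear.Build rat V V *:%R cf (@word_linear n D fin).
HB.instance Definition _ := GRing.isLinear.Build rat V V *:%R cfinv (@word_linear n D (rev fin)).

Lemma cfK : cancel cf cfinv. Proof. by move=> v; apply: word_revK dsym dpos a2 _ _. Qed.
Lemma cfinvK : cancel cfinv cf. Proof. by move=> v; apply: wordK_rev dsym dpos a2 _ _. Qed.

Lemma iter_can (f g : V -> V) k : cancel f g -> cancel (iter k f) (iter k g).
Proof.
move=> fg; elim: k => [//|k IH] v.
by rewrite [iter k.+1 f v]iterS iterSr fg IH.
Qed.

Lemma supported_cfinv x : supported fin x -> supported fin (cfinv x).
Proof. by move=> sx i si; rewrite /cfinv word_notin ?mem_rev // sx. Qed.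
Lemma supported_cf x : supported fin x -> supported fin (cf x).
Proof. exact: supported_word. Qed.

Lemma iter_ind_pred (Q : V -> Prop) (f : V -> V) k v :
  (forall u, Q u -> Q (f u)) -> Q v -> Q (iter k f v).
Proof. by move=> h qv; elim: k => //= k; apply: h. Qed.

Lemma iter_inv (T : Type) (F : V -> T) (f : V -> V) k v :
  (forall u, F (f u) = F u) -> F (iter k f v) = F v.
Proof. by move=> h; elim: k => //= k <-. Qed.

Lemma eul_cfinv x y : supported fin x -> supported fin y -> E (cfinv x) (cfinv y) = E x y.
Proof.
move=> sx sy; rewrite -{2}(cfinvK x) -{2}(cfinvK y) (eul_word2 dsym a2 sorted_fin) //;
  exact: supported_cfinv.
Qed.

Lemma eul_iter_cfinv k x y : supported fin x -> supported fin y ->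
  E (iter k cfinv x) (iter k cfinv y) = E x y.
Proof.
move=> sx sy; elim: k => //= k IH; rewrite eul_cfinv //;
  apply: (iter_ind_pred (Q := supported fin)) => //; exact: supported_cfinv.
Qed.

Lemma nonneg_sum (I : Type) (r : seq I) (F : I -> V) :
  (forall k, nonneg (F k)) -> nonneg (\sum_(k <- r) F k).
Proof. by move=> h i; rewrite summxE sumr_ge0 // => j _; apply: h. Qed.

Lemma shift_sum (f : nat -> V) k r :
  \sum_(i < r) f (k + i).+1 = \sum_(i < r) f (k + i)%N + (f (k + r)%N - f k).
Proof.
elim: r => [|r IH]; first by rewrite !big_ord0 addn0 subrr addr0.
rewrite !big_ord_recr /= IH addnS -!addrA; congr (_ + (_ + _)).
exact: addrC.
Qed.

(** If all iterates stayed nonnegative, boundedness would force a repetition. The sum over the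
    repeated stretch is invariant, hence isotropic, hence a multiple of delta; as it vanishes at the
    affine node it is 0, which is impossible for a sum of positive roots. *)
Lemma fin_leaves x : lroot x -> nonneg x -> supported fin x ->
  exists k, ~ nonneg (iter k cfinv x).
Proof.
move=> rx px sx; apply: NNPP => nex.
have nn k : nonneg (iter k cfinv x) by apply: NNPP => h; apply: nex; exists k.
pose f k := iter k cfinv x.
have rf k : lroot (f k) by apply: (iter_ind_pred (Q := lroot)) => // u; apply: lroot_word.
have sf k : supported fin (f k) by apply: (iter_ind_pred (Q := supported fin)) => // u; apply: supported_cfinv.
have qf k : q (f k) = q x.
  by apply: (iter_inv (F := q)) => u; apply: (q_isom good); rewrite (K_word dsym dpos a2).
have sa := special_aff good.
have [b hb] := nat_bound (bnd (caff D) x *: dl).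
have [k [l [kl e]]] : exists k l, (k < l)%N /\ f k = f l.
  apply: (@pigeonhole _ f b) => // k; first by case: (rf k).
  move=> i; have := fin_bounded sa (rf k) (proj1 (supported_fin _) (sf k)) i.
  by rewrite /bnd qf; rewrite !mxE => h; have := hb i; rewrite !mxE; lra.
pose S := \sum_(i < (l - k)%N) f (k + i)%N.
have cS : cfinv S = S.
  rewrite /S linear_sum /=; have := shift_sum f k (l - k).
  by rewrite subnKC ?(ltnW kl) // e subrr addr0.
have Sf : supported fin S.
  by move=> i hi; rewrite summxE big1 // => m _; apply: sf.
have KS : K S S = 0.
  apply: (K_supported0 (s := fin)) => // i.
  apply: word_fixed; first exact: sorted_uniq_val sorted_fin.
  by rewrite -{1}cS -/(cf _) cfinvK.
have SE : S = 0.
  rewrite (K_eq0 good (caff D) KS) (proj1 (supported_fin _) Sf) mul0r scale0r //.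
have : f k = 0.
  apply/rowP => i; rewrite [RHS]mxE; apply/eqP; rewrite eq_le nn andbT.
  have := congr1 (fun v : V => v ord0 i) SE; rewrite /S.
  have -> : (l - k)%N = (l - k).-1.+1 by rewrite prednK // subn_gt0.
  rewrite big_ord_recl addn0 !mxE => h.
  have : nonneg (\sum_(i0 < (l - k).-1) f (k + lift ord0 i0)%N) by apply: nonneg_sum => m; apply: nn.
  by move/(_ i) => h2; rewrite -/(f k) in h *; lra.
by move/eqP; apply/negP; exact: (lroot_neq0 (rf k)).
Qed.

(* The relation [E x y < 0] is acyclic on the positive roots of finite type. *)
Lemma fin_source (Y : seq V) : Y <> [::] ->
  (forall y, y \in Y -> [/\ lroot y, nonneg y & y ord0 (caff D) = 0]) ->
  exists2 x, x \in Y & forall y, y \in Y -> 0 <= E x y.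
Proof.
move=> Yn hY; have sY y : y \in Y -> supported fin y.
  by move=> /hY[_ _ h]; apply/supported_fin.
(* Apply the inverse of c_fin until some x of [Y] is about to turn negative. At that moment x has
   become a projective root, and E(P_i, -) is a positive multiple of a coordinate, nonnegative on
   all the others, which are still nonnegative. *)
pose Q k := forall y, y \in Y -> nonneg (iter k cfinv y).
have [||k [hk nk]] := @first_failure Q.
- by move=> y /hY[].
- case: Y Yn hY sY @Q => // y Y _ hY sY Q.
  have [ry py _] := hY y (mem_head _ _); have [k hk] := fin_leaves ry py (sY _ (mem_head _ _)).
  by exists k => h; apply: hk; apply: h; rewrite mem_head.
have [x xY nx] : exists2 x, x \in Y & ~ nonneg (iter k.+1 cfinv x).
  by apply: NNPP => h; apply: nk => y yY; apply: NNPP => h'; apply: h; exists y.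
exists x => // y yY; have [rx _ _] := hY _ xY.
have rk : lroot (iter k cfinv x) by apply: (iter_ind_pred (Q := lroot)) => // u; apply: lroot_word.
have pk := hk k (leqnn k) x xY.
have [i fi e] := neg_proj (sorted_uniq_val sorted_fin) rk pk nx.
rewrite -(eul_iter_cfinv k (sY _ xY) (sY _ yY)) e (eul_proj dsym sorted_fin) //.
  rewrite mulr_ge0 ?(ltW (dpos _)) //; exact: (hk k (leqnn k)).
by apply: (iter_ind_pred (Q := supported fin)); [exact: supported_cfinv | exact: sY].
Qed.

End Signs.

(** * Preprojective and preinjective roots; factorization of c modulo delta *)

Section Gamma.
Variables (n : nat) (D : cdata n) (gamma : 'rV[rat]_n).
Local Notation V := 'rV[rat]_n.
Local Notation d := (cd D).
Local Notation K := (K D).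
Local Notation E := (eul D).
Local Notation dl := (delta D).
Local Notation q := (q D).
Local Notation lroot := (lroot D).
Local Notation cox := (cox D).
Local Notation coxinv := (coxinv D).
Local Notation fin := (fin D).
Local Notation cf := (cf D).
Local Notation cfinv := (cfinv D).
Local Notation Pr := (proj D (enum 'I_n)).
Local Notation In := (inj D (enum 'I_n)).
Implicit Types (u v w x y : V) (s : seq 'I_n) (i j : 'I_n).

Hypothesis good : good_data D.
Hypothesis gaff : gamma ord0 (caff D) = 0.
Hypothesis gcox : cox gamma = gamma + dl.
Local Notation dsym := (dsym good).
Local Notation dpos := (dpos good).
Local Notation a2 := (a_diag good).

Lemma coxK' : cancel cox coxinv. Proof. exact: coxK dsym dpos a2. Qed.
Lemma coxinvK' : cancel coxinv cox. Proof. exact: coxinvK dsym dpos a2. Qed.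
Lemma K_symm u v : K u v = K v u. Proof. exact: (K_sym dsym). Qed.
Lemma K_coxi u v : K u v = E u (v - coxinv v). Proof. exact: (K_eul_coxinv dsym dpos a2). Qed.
Lemma E_cox u v : E (cox u) v = - E v u. Proof. exact: (eul_cox dsym a2). Qed.
Lemma E_coxinv u v : E v (coxinv u) = - E u v. Proof. exact: (eul_coxinv dsym dpos a2). Qed.
Lemma E_cox2 u v : E (cox u) (cox v) = E u v. Proof. exact: (eul_cox2 dsym a2). Qed.
Lemma E_coxinv2 u v : E (coxinv u) (coxinv v) = E u v. Proof. exact: (eul_coxinv2 dsym dpos a2). Qed.

Lemma E_Pr i x : E (Pr i) x = d i * x ord0 i.
Proof.
by apply: (eul_proj dsym (sorted_enum n)); [rewrite mem_enum | apply: supported_enum].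
Qed.
Lemma E_In i x : E x (In i) = d i * x ord0 i.
Proof.
by apply: (eul_inj dsym dpos a2 (sorted_enum n)); [rewrite mem_enum | apply: supported_enum].
Qed.
Lemma cox_In i : cox (In i) = - Pr i.
Proof. by apply: (word_inj dsym dpos a2); rewrite mem_enum. Qed.
Lemma coxinv_Pr i : coxinv (Pr i) = - In i.
Proof. by rewrite -[Pr i]opprK -cox_In linearN /= coxK'. Qed.
Lemma lroot_Pr i : lroot (Pr i).
Proof. by apply: lroot_word => //; apply: lroot_sr. Qed.
Lemma lroot_In i : lroot (In i).
Proof. by apply: lroot_word => //; apply: lroot_sr. Qed.
Lemma Pr_diag i : (Pr i) ord0 i = 1.
Proof. by rewrite (proj_diag D (sorted_enum n)) ?mem_enum. Qed.
Lemma In_diag i : (In i) ord0 i = 1.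
Proof. by rewrite (inj_diag D (sorted_enum n)) ?mem_enum. Qed.
Lemma Pr_gt i j : (i < j)%N -> (Pr i) ord0 j = 0.
Proof. by move=> ij; rewrite (proj_gt D (sorted_enum n)) ?mem_enum. Qed.
Lemma In_lt i j : (j < i)%N -> (In i) ord0 j = 0.
Proof. by move=> ij; rewrite (inj_lt D (sorted_enum n)) ?mem_enum. Qed.
Lemma nonneg_diag v i : lroot v -> 0 < v ord0 i -> nonneg v.
Proof.
by move=> rv vi; case: (lroot_posneg good rv) => // /(_ i); rewrite mxE oppr_ge0 leNgt vi.
Qed.
Lemma nonneg_Pr i : nonneg (Pr i).
Proof. by apply: (nonneg_diag (i := i)); rewrite ?Pr_diag //; apply: lroot_Pr. Qed.
Lemma nonneg_In i : nonneg (In i).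
Proof. by apply: (nonneg_diag (i := i)); rewrite ?In_diag //; apply: lroot_In. Qed.
Lemma q_Pr i : q (Pr i) = d i.
Proof. by rewrite /q E_Pr Pr_diag mulr1. Qed.
Lemma q_In i : q (In i) = d i.
Proof. by rewrite /q E_In In_diag mulr1. Qed.

Lemma E_dll x : E dl x = - E x dl.
Proof. by rewrite -{1}(cox_dl good) E_cox. Qed.
Lemma E_dldl : E dl dl = 0.
Proof. by have := E_dll dl; lra. Qed.
Lemma E_cox_dl x : E (cox x) dl = E x dl.
Proof. by rewrite -{1}(cox_dl good) E_cox2. Qed.
Lemma E_coxinv_dl x : E (coxinv x) dl = E x dl.
Proof. by rewrite -{1}(coxinv_dl good) E_coxinv2. Qed.
(** Evaluate K(x, y) = E(x, y - c^-1 y) at y = c gamma, for which y - c^-1 y = delta. Thus U_c is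
    the kernel of E(-, delta). *)
Lemma E_K x : E x dl = K gamma x.
Proof.
have := K_coxi x (cox gamma).
rewrite coxK' {2}gcox [gamma + dl - gamma]addrC addKr => <-.
by rewrite gcox KDr (K_dlr good) addr0 K_symm.
Qed.
Lemma E_Pr_dl i : 0 < E (Pr i) dl.
Proof. by rewrite E_Pr mulr_gt0 ?dpos ?(dl_gt0 good). Qed.
Lemma E_In_dl i : E (In i) dl < 0.
Proof. by rewrite -oppr_gt0 -E_dll E_In mulr_gt0 ?dpos ?(dl_gt0 good). Qed.

Lemma inUE x : inU D gamma x <-> E x dl = 0.
Proof. by rewrite /inU E_K. Qed.

Lemma inU_cox x : inU D gamma (cox x) <-> inU D gamma x.
Proof. by rewrite !inUE E_cox_dl. Qed.
Lemma inU_coxinv x : inU D gamma (coxinv x) <-> inU D gamma x.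
Proof. by rewrite !inUE E_coxinv_dl. Qed.
Lemma inU_dl : inU D gamma dl.
Proof. by rewrite inUE E_dldl. Qed.
Lemma inUD x y : inU D gamma x -> inU D gamma y -> inU D gamma (x + y).
Proof. by rewrite /inU KDr => -> ->; rewrite addr0. Qed.
Lemma inUZ t x : inU D gamma x -> inU D gamma (t *: x).
Proof. by rewrite /inU KZr => ->; rewrite mulr0. Qed.

(** The only positive roots made negative by c are the I_i, and E(I_i, delta) < 0 keeps them outside
    U_c. *)
Lemma nonneg_cox x : lroot x -> nonneg x -> inU D gamma x -> nonneg (cox x).
Proof.
move=> rx px ux; apply: NNPP => h.
have [i _ xE] := neg_inj good (enum_uniq _) rx px h.
by have := E_In_dl i; rewrite -xE (proj1 (inUE x) ux) ltxx.
Qed.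

Lemma nonneg_coxinv x : lroot x -> nonneg x -> inU D gamma x -> nonneg (coxinv x).
Proof.
move=> rx px ux; apply: NNPP; rewrite coxinvE => h.
have [i _ xE] := neg_proj good (enum_uniq _) rx px h.
by have := E_Pr_dl i; rewrite -xE (proj1 (inUE x) ux) ltxx.
Qed.

(** Common argument for F = c^-1 ([sg] = 1) and F = c ([sg] = -1). Modulo delta the orbit of x is
    finite, so it repeats up to a shift by a multiple of delta. The sign of E(x, delta) makes this
    shift negative, and repeating it drives the affine coordinate below 0. *)
Lemma leaves_positive (F : {linear V -> V}) (sg : rat) x :
  (forall u, lroot u -> lroot (F u)) -> (forall u, q (F u) = q u) -> F dl = dl ->
  (forall u, E (F u) dl = E u dl) ->
  (forall S t, S - F S = t *: dl -> E S dl * sg = t * K gamma gamma) ->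
  lroot x -> 0 < E x dl * sg -> exists k, ~ nonneg (iter k F x).
Proof.
move=> Fr Fq Fd FE hS rx sx; apply: NNPP => nex.
pose f k := iter k F x; have nn k : nonneg (f k) by apply: NNPP => h; apply: nex; exists k.
have rf k : lroot (f k) by apply: (iter_ind_pred (Q := lroot)).
have qf k : q (f k) = q x by apply: (iter_inv (F := q)).
have Ef k : E (f k) dl = E x dl by apply: (iter_inv (F := fun u => E u dl)).
have sa := special_aff good; pose e := caff D.
pose y k := f k - (f k) ord0 e *: dl.
have ry k : lroot (y k) by apply: lroot_proj.
have ye k : (y k) ord0 e = 0 by rewrite !mxE (proj1 sa) mulr1 subrr.
have qy k : q (y k) = q x by rewrite /y -scaleNr (q_dl good).
(* [y k + bnd delta] lies between 0 and 2 bnd delta, so the pigeonhole principle for bounded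
   nonnegative integral vectors applies. *)
have [b hb] := nat_bound (2 * bnd D e x *: dl).
have [k [l [kl ekl]]] : exists k l, (k < l)%N /\ y k + bnd D e x *: dl = y l + bnd D e x *: dl.
  apply: (@pigeonhole _ (fun k => y k + bnd D e x *: dl) b) => k.
  - move=> i; have [h _ _] := ry k; rewrite mxE rpredD // mxE rpredM ?(dl_int D i) //.
    by rewrite intr_int.
  - move=> i; have := fin_bounded2 good sa (ry k) (ye k) i.
    by rewrite /bnd qy.
  - move=> i; have := fin_bounded good sa (ry k) (ye k) i.
    rewrite /bnd qy -/(bnd D e x) !mxE => h; have := hb i; rewrite !mxE -/(bnd D e x); lra.
have [t fkl] : exists t, f k - f l = t *: dl.
  exists ((f k) ord0 e - (f l) ord0 e); apply/rowP => i.
  by have := congr1 (fun v : V => v ord0 i) (addIr _ ekl); rewrite !mxE mulrBl; lra.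
pose r := (l - k)%N; have r0 : (0 < r)%N by rewrite subn_gt0.
pose S := \sum_(i < r) f (k + i)%N.
have SF : S - F S = t *: dl.
  rewrite /S linear_sum /=; have := shift_sum f k r.
  by rewrite subnKC ?(ltnW kl) // => ->; rewrite opprD addrA subrr add0r opprB.
have ES : E S dl = r%:R * E x dl.
  by rewrite /S eul_suml; under eq_bigr do rewrite Ef; rewrite sumr_const card_ord mulr_natl.
(* By [hS], t K(gamma, gamma) equals r E(x, delta) sg, which is positive; semidefiniteness gives the
   sign of t. *)
have t0 : 0 < t.
  have := hS S t SF; rewrite ES -mulrA => h.
  have : 0 < t * K gamma gamma by rewrite -h mulr_gt0 ?ltr0n.
  by rewrite pmulr_lgt0 // lt_def K_ge0 // andbT; apply: contraTneq sx => h0; move: h;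
    rewrite h0 mulr0 => /eqP; rewrite mulf_eq0 pnatr_eq0 -leqn0 leqNgt r0 /= => /eqP ->; rewrite ltxx.
have fm m : f (k + m * r)%N = f k - (t *+ m) *: dl.
  elim: m => [|m IH]; first by rewrite mul0n addn0 mulr0n scale0r subr0.
  have -> : (k + m.+1 * r = m * r + l)%N.
    by rewrite mulSn addnA [(k + r)%N](subnKC (ltnW kl)) addnC.
  have iterDl : forall a u (z : rat), iter a F (u - z *: dl) = iter a F u - z *: dl.
    by elim=> // a IHa u z; rewrite !iterS IHa linearB linearZ /= Fd.
  rewrite /f iterD -/(f l).
  have -> : f l = f k - t *: dl by rewrite -fkl opprB addrCA subrr addr0.
  rewrite iterDl /f -iterD addnC -/(f _) IH mulrSr scalerDl opprD addrA //.
have [m hm] : exists m : nat, (f k) ord0 e < t *+ m.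
  exists (Num.truncn ((f k) ord0 e / t)).+1.
  by rewrite -mulr_natl -ltr_pdivrMr // truncnS_gt.
have := nn (k + m * r)%N e; rewrite fm !mxE (proj1 sa) mulr1.
by rewrite leNgt => /negP; apply; lra.
Qed.

(** Going back by c^-1, the last nonnegative iterate is some P_i. Nonnegativity of the intermediate
    roots is recorded because it is what makes tau_c act as c along this stretch. *)
Lemma preprojective x : lroot x -> nonneg x -> 0 < E x dl ->
  exists k i, x = iter k cox (Pr i) /\ forall m, (m <= k)%N -> nonneg (iter m cox (Pr i)).
Proof.
move=> rx px ex; have hl : exists k, ~ nonneg (iter k coxinv x).
  apply: (@leaves_positive coxinv 1) => //.
  - by move=> u; apply: lroot_coxinv.
  - by move=> u; apply: q_coxinv.
  - exact: coxinv_dl.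
  - exact: E_coxinv_dl.
  - move=> S t h; rewrite mulr1 E_K K_coxi h eulZr; congr (_ * _).
    by rewrite E_K.
  - by rewrite mulr1.
have [k [hk nk]] := first_failure (Q := fun k => nonneg (iter k coxinv x)) px hl.
have rk : lroot (iter k coxinv x).
  by apply: (iter_ind_pred (Q := lroot)) => // u; apply: lroot_coxinv.
have nk' : ~ nonneg (word D (rev (enum 'I_n)) (iter k coxinv x)) by rewrite -coxinvE.
have [i _ e] := neg_proj good (enum_uniq _) rk (hk k (leqnn k)) nk'.
have back m : (m <= k)%N -> iter m cox (Pr i) = iter (k - m) coxinv x.
  by move=> mk; rewrite -e -{1}(subnKC mk) iterD (iter_can m coxinvK').
exists k, i; split; first by rewrite back // subnn.
by move=> m mk; rewrite back //; apply: hk; rewrite leq_subr.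
Qed.

Lemma preinjective x : lroot x -> nonneg x -> E x dl < 0 ->
  exists k i, x = iter k coxinv (In i) /\ forall m, (m <= k)%N -> nonneg (iter m coxinv (In i)).
Proof.
move=> rx px ex; have hl : exists k, ~ nonneg (iter k cox x).
  apply: (@leaves_positive cox (-1)) => //.
  - by move=> u; apply: lroot_cox.
  - by move=> u; apply: q_cox.
  - exact: cox_dl.
  - exact: E_cox_dl.
  - move=> S t h; have h' : S - coxinv S = - t *: dl.
      have := congr1 coxinv h; rewrite linearB linearZ /= coxK' coxinv_dl // => h'.
      by rewrite scaleNr -h' opprB.
    by rewrite E_K K_coxi h' eulZr E_K; ring.
  - by lra.
have [k [hk nk]] := first_failure (Q := fun k => nonneg (iter k cox x)) px hl.
have rk : lroot (iter k cox x).
  by apply: (iter_ind_pred (Q := lroot)) => // u; apply: lroot_cox.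
have [i _ e] := neg_inj good (enum_uniq _) rk (hk k (leqnn k)) nk.
have back m : (m <= k)%N -> iter m coxinv (In i) = iter (k - m) cox x.
  by move=> mk; rewrite -e -{1}(subnKC mk) iterD (iter_can m coxK').
exists k, i; split; first by rewrite back // subnn.
by move=> m mk; rewrite back //; apply: hk; rewrite leq_subr.
Qed.

(** The reflection in an arbitrary root, [q x] being half of [K x x]. *)
Definition trefl x w := w - (K x w / q x) *: x.

Lemma trefl_N x w : trefl (- x) w = trefl x w.
Proof. by rewrite /trefl KNl q_N mulNr scalerN scaleNr opprK. Qed.

Lemma trefl_sr i w : trefl (sr i) w = refl D i w.
Proof. by rewrite (reflE dsym dpos) /trefl q_sr. Qed.

Lemma trefl_conj (g : {linear V -> V}) x w : (forall u v, K (g u) (g v) = K u v) ->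
  trefl (g x) (g w) = g (trefl x w).
Proof.
move=> h; have qg : q (g x) = q x by exact: (q_isom good (h x x)).
by rewrite /trefl [RHS](_ : _ = g w - (K x w / q x) *: g x) ?h ?qg // linearB linearZ.
Qed.

Lemma lroot_trefl x w : lroot x -> lroot w -> lroot (trefl x w).
Proof.
move=> rx rw; have [ix qx cx] := rx; have [iw qw cw] := rw.
have qt : q (trefl x w) = q w.
  apply: (q_isom good); rewrite /trefl KBl !KBr !KZl !KZr (K_q good x) (K_symm w x).
  by field; rewrite gt_eqF.
split; rewrite ?qt // => i; rewrite !mxE.
  by rewrite rpredB // rpredM // (lroot_K).
rewrite !mulrBl rpredB //.
rewrite (_ : _ / _ = K w x / q w * (x ord0 i * d i / q x)); last by rewrite K_symm; ring.
by rewrite rpredM // (lroot_K).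
Qed.

Lemma cf_Kiso k u v : K (iter k cf u) (iter k cf v) = K u v.
Proof. by elim: k => //= k IH; rewrite (K_word dsym dpos a2). Qed.

Lemma iter_linear_proof (f : {linear V -> V}) k : linear (iter k f).
Proof. by move=> t u v; elim: k => //= k ->; rewrite linearP. Qed.
HB.instance Definition _ (f : {linear V -> V}) k :=
  GRing.isLinear.Build rat V V *:%R (iter k f) (iter_linear_proof f k).

Lemma iter_cf_dl k : iter k cf dl = dl.
Proof. by elim: k => //= k ->; apply: word_dl. Qed.
Lemma supported_iter_cf k x : supported fin x -> supported fin (iter k cf x).
Proof. by apply: (iter_ind_pred (Q := supported fin)); apply: supported_cf. Qed.
Lemma supported_iter_cfinv k x : supported fin x -> supported fin (iter k cfinv x).
Proof. by apply: (iter_ind_pred (Q := supported fin)); apply: supported_cfinv. Qed.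

(* A factorization of [c] modulo [delta] into reflections in roots of [U]:
   writing [rho = delta - P_aff], [c = t_rho c_fin] modulo [delta], and the
   [c_fin]-orbit of [rho] contains a projective root, which removes one letter
   of a conjugate of [c_fin]. *)
Lemma cox_factor : exists (k : nat) (t : seq 'I_n) (i : 'I_n),
  [/\ uniq (i :: t), i :: t =i fin &
    forall v, exists m, cox v = iter k cf (word D t (iter k cfinv v)) + m *: dl].
Proof.
pose e := caff D; have sa := special_aff good.
pose rho := dl - Pr e.
have rr : lroot rho.
  rewrite /rho -opprB; apply: lroot_N.
  by have := lroot_proj good sa (lroot_Pr e); rewrite Pr_diag scale1r.
have qr : q rho = d e by rewrite /rho addrC -[dl]scale1r (q_dl good) q_N q_Pr.
have rf : supported fin rho by apply/supported_fin; rewrite !mxE (proj1 sa) Pr_diag subrr.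
(* One of rho and -rho is a positive root of finite type; going back by c_fin, its last nonnegative
   iterate is a projective root of the parabolic. *)
have [k [i [fi [sg ri]]]] : exists k i, i \in fin /\
    exists sg : bool, rho = (-1) ^+ sg *: iter k cf (proj D fin i).
  have pos x : lroot x -> nonneg x -> supported fin x ->
      exists k i, i \in fin /\ x = iter k cf (proj D fin i).
    move=> rx px sx; have [k [hk nk]] := first_failure (Q := fun k => nonneg (iter k cfinv x)) px
       (fin_leaves good rx px sx).
    have rk : lroot (iter k cfinv x).
      by apply: (iter_ind_pred (Q := lroot)) => // u; apply: lroot_word.
    have [i fi ei] := neg_proj good (sorted_uniq_val (sorted_fin D)) rk (hk k (leqnn k)) nk.
    by exists k, i; split => //; rewrite -ei (iter_can k (cfinvK good)).
  case: (lroot_posneg good rr) => h.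
    have [k [i [fi ei]]] := pos _ rr h rf.
    by exists k, i; split => //; exists false; rewrite expr0 scale1r.
  have rf' : supported fin (- rho) by move=> j sj; rewrite mxE rf ?oppr0.
  have [k [i [fi ei]]] := pos _ (lroot_N rr) h rf'.
  by exists k, i; split => //; exists true; rewrite expr1 scaleN1r -ei opprK.
have fiE := split_index fi; set s1 := take _ _ in fiE; set s2 := drop _ _ in fiE.
exists k, (s1 ++ s2), i; split.
- have := sorted_uniq_val (sorted_fin D); rewrite {1}fiE cat_uniq /= => /and3P[u1].
  rewrite negb_or => /andP[i1 hh] /andP[i2 u2].
  by rewrite mem_cat negb_or i1 i2 /= cat_uniq u1 hh u2.
- by move=> j; rewrite [in RHS]fiE mem_cat !inE mem_cat orbCA.
move=> v.
have rhoE w : trefl rho w = trefl (iter k cf (proj D fin i)) w.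
  by rewrite ri; case: sg {ri}; rewrite ?expr1 ?expr0 ?scaleN1r ?scale1r ?trefl_N.
have [m cm] : exists m, cox v = trefl rho (cf v) + m *: dl.
  have ee : e \in enum 'I_n by rewrite mem_enum.
  have := split_index ee; set e1 := take _ _; set e2 := drop _ _ => eE.
  have fE : fin = e1 ++ e2.
    have := enum_uniq 'I_n; rewrite {1}eE cat_uniq /= negb_or => /and3P[_ /andP[h1 _] /andP[h2 _]].
    rewrite /fin {1}eE filter_cat /= eqxx /=; congr (_ ++ _); apply/all_filterP/allP => j hj.
      by apply: contraNneq h1 => je; rewrite /e -je.
    by apply: contraNneq h2 => je; rewrite /e -je.
  (* c is c_fin with the letter [e] inserted between [e1] and [e2]; the insertion subtracts kk P_e,
     and kk is -K(rho, c_fin v) / q rho. *)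
  pose w2 := word D e2 v; pose kk := Kcv D e w2.
  exists (- kk); have cE : cox v = cf v - kk *: Pr e.
    rewrite coxE {1}eE word_cat /= -/w2 {1}/refl -/kk linearB linearZ /=.
    by rewrite /cf /word fE foldr_cat.
  have Kr : K rho (cf v) = - (d e * kk).
    rewrite KBl (K_dll good) sub0r; congr (- _).
    have -> : cf v = word D e1 w2 by rewrite /cf fE word_cat.
    by rewrite /proj -/e1 (K_word dsym dpos a2) (K_srl dsym).
  have Kq : K rho (cf v) / q rho = - kk by rewrite Kr qr; field; rewrite gt_eqF ?dpos.
  rewrite /trefl Kq scaleNr opprK cE /rho.
  by rewrite scalerBr scaleNr -!addrA; congr (_ + _); rewrite addrC subrK.
exists m; rewrite cm rhoE; congr (_ + _).
have cfE : cf v = iter k cf (cf (iter k cfinv v)).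
  by rewrite -iterSr iterS (iter_can k (cfinvK good)).
rewrite cfE trefl_conj; last exact: cf_Kiso.
congr (iter k cf _); set u := iter k cfinv v.
have -> : cf u = word D s1 (refl D i (word D s2 u)) by rewrite /cf {1}fiE word_cat.
(* The projective root is s1 alpha_i, so the reflection in it cancels the letter [i] of c_fin = s1
   s_i s2. *)
rewrite /proj -/s1 (trefl_conj (g := word D s1)); last first.
  by move=> ? ?; rewrite (K_word dsym dpos a2).
by rewrite trefl_sr (refl_inv dsym dpos a2) word_cat.
Qed.

End Gamma.

(** * Linear spans and convex cones *)

Section Spans.
Variable n : nat.
Local Notation V := 'rV[rat]_n.
Implicit Types (Q S P : V -> Prop) (u v w x y z : V) (t : rat).

Definition subspace Q := Q 0 /\ forall t u v, Q u -> Q v -> Q (t *: u + v).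
(** The span as the intersection of all subspaces containing [S]: generating sets occur here only as
    predicates, and membership in a subspace is then proved by checking generators. *)
Definition lspan S v := forall Q, subspace Q -> (forall y, S y -> Q y) -> Q v.

Lemma subspaceZ Q t u : subspace Q -> Q u -> Q (t *: u).
Proof. by move=> [h0 h] qu; rewrite -[_ *: _]addr0; apply: h. Qed.
Lemma subspaceD Q u v : subspace Q -> Q u -> Q v -> Q (u + v).
Proof. by move=> [h0 h] qu qv; rewrite -[u]scale1r; apply: h. Qed.
Lemma subspaceN Q u : subspace Q -> Q u -> Q (- u).
Proof. by move=> h qu; rewrite -scaleN1r; apply: subspaceZ. Qed.
Lemma subspaceB Q u v : subspace Q -> Q u -> Q v -> Q (u - v).
Proof. by move=> h qu qv; apply: subspaceD => //; apply: subspaceN. Qed.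
Lemma subspace_sum Q (I : eqType) (r : seq I) (F : I -> V) : subspace Q ->
  (forall i, i \in r -> Q (F i)) -> Q (\sum_(i <- r) F i).
Proof.
move=> sQ h; rewrite big_seq; elim/big_ind: _ => //; first by case: sQ.
by move=> u v; apply: subspaceD.
Qed.

Lemma lspan_subspace S : subspace (lspan S).
Proof.
split=> [Q [] //|t u v hu hv Q sQ hS].
by case: (sQ) => _; apply; [apply: hu|apply: hv].
Qed.
Lemma lspan_in S v : S v -> lspan S v. Proof. by move=> sv Q _; apply. Qed.

(** The inductive counterpart of [in_cone], suited to induction on the number of terms; [cone_inE]
    proves them equivalent. *)
Inductive cone P : V -> Prop :=
| cone0 : cone P 0
| cone_add t x v : P x -> 0 <= t -> cone P v -> cone P (t *: x + v).

Lemma coneD P u v : cone P u -> cone P v -> cone P (u + v).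
Proof.
elim=> [|t x w px t0 _ IH] cv; first by rewrite add0r.
by rewrite -addrA; apply: cone_add => //; apply: IH.
Qed.
Lemma coneZ P t v : 0 <= t -> cone P v -> cone P (t *: v).
Proof.
move=> t0; elim=> [|s x w px s0 _ IH]; first by rewrite scaler0; constructor.
by rewrite scalerDr scalerA; apply: cone_add => //; rewrite mulr_ge0.
Qed.
Lemma cone_in P x : P x -> cone P x.
Proof. by move=> px; rewrite -[x]scale1r -[_ *: _]addr0; apply: cone_add => //; constructor. Qed.
Lemma cone_trans P Q v : (forall x, P x -> cone Q x) -> cone P v -> cone Q v.
Proof.
move=> h; elim=> [|t x w px t0 _ IH]; first by constructor.
by apply: coneD => //; apply: coneZ => //; apply: h.
Qed.
Lemma cone_nonneg P v : (forall x, P x -> nonneg x) -> cone P v -> nonneg v.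
Proof.
move=> h; elim=> [|t x w px t0 _ IH] i; rewrite !mxE // addr_ge0 // mulr_ge0 //.
exact: h.
Qed.

Lemma cone_remove P x v : cone P v ->
  exists b w, [/\ 0 <= b, cone (fun y => P y /\ y <> x) w & v = b *: x + w].
Proof.
elim=> [|t y w py t0 _ [b [w' [b0 cw ->]]]].
  by exists 0, 0; split; [|constructor|rewrite scale0r addr0].
case: (classic (y = x)) => [->|yx].
  by exists (t + b), w'; split; rewrite ?addr_ge0 // scalerDl addrA.
exists b, (t *: y + w'); split => //; first by apply: cone_add.
by rewrite addrCA.
Qed.

(** A linear functional that is positive on v is positive on some generator occurring in v with a
    positive coefficient. *)
Lemma cone_pick P (phi : V -> rat) v : (forall t x y, phi (t *: x + y) = t * phi x + phi y) ->
  phi 0 = 0 -> 0 < phi v -> cone P v ->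
  exists t x w, [/\ P x, 0 < t, cone P w, v = t *: x + w & 0 < phi x].
Proof.
move=> hphi phi0 pv cv; elim: cv pv => [|t x w px t0 cw IH]; first by rewrite phi0 ltxx.
rewrite hphi => pv; case: (ltrP 0 (t * phi x)) => h.
  have [tp xp] : 0 < t /\ 0 < phi x.
    move: t0; rewrite le_eqVlt => /orP[/eqP t0|t0]; first by rewrite -t0 mul0r ltxx in h.
    by rewrite pmulr_rgt0 in h.
  by exists t, x, w.
have [s [y [w' [py s0 cw' -> yp]]]] := IH ltac:(lra).
exists s, y, (t *: x + w'); split => //; first by apply: cone_add.
by rewrite addrCA.
Qed.

Lemma cone_inE P v : in_cone P v <-> cone P v.
Proof.
split=> [[s [f [hs [hf ->]]]]|].
  elim: s hs => [|x s IH] hs; first by rewrite big_nil; constructor.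
  rewrite big_cons; apply: cone_add => //; first by apply: hs; rewrite mem_head.
  by apply: IH => y ys; apply: hs; rewrite inE ys orbT.
elim=> [|t x w px t0 _ [s [f [hs [hf ->]]]]].
  by exists [::], (fun=> 0); split=> [//|]; split=> [//|]; rewrite big_nil.
(* [in_cone] weights a list by a function of the vector, so all c + 1 copies of x must share one
   weight g, determined by g (c + 1) = f x c + t. *)
pose c : rat := (count_mem x s)%:R; pose g := (f x * c + t) / (c + 1).
have c0 : 0 <= c by rewrite ler0n.
exists (x :: s), (fun y => if y == x then g else f y); split=> [y|].
  by rewrite inE => /orP[/eqP ->|/hs].
split=> [y|].
  by case: ifP => // _; rewrite divr_ge0 ?addr_ge0 ?mulr_ge0.
rewrite big_cons eqxx.
have -> : \sum_(y <- s) (if y == x then g else f y) *: y =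
    \sum_(y <- s) f y *: y + (c * (g - f x)) *: x.
  rewrite /c; elim: (s) => [|y s' IH]; first by rewrite !big_nil mul0r scale0r addr0.
  rewrite !big_cons IH /= natrD mulrDl scalerDl !addrA; congr (_ + _).
  case: (eqVneq y x) => [->|_]; last by rewrite mul0r scale0r addr0.
  by rewrite mul1r scalerBl addrAC addrCA subrr addr0 addrC.
rewrite [RHS]addrCA -scalerDl [LHS]addrC; congr (_ + _ *: _).
by rewrite /g; field; rewrite gt_eqF // ltr_wpDl.
Qed.
End Spans.

(** * Tubes *)

Section Tubes.
Variables (n : nat) (D : cdata n) (gamma : 'rV[rat]_n).
Local Notation V := 'rV[rat]_n.
Local Notation K := (K D).
Local Notation E := (eul D).
Local Notation dl := (delta D).
Local Notation lroot := (lroot D).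
Local Notation cox := (cox D).
Local Notation fin := (fin D).
Local Notation cf := (cf D).
Local Notation cfinv := (cfinv D).
Local Notation U := (inU D gamma).
Local Notation trefl := (trefl D).
Implicit Types (u v w x y z b p : V) (s : seq 'I_n) (i j : 'I_n).

Hypothesis good : good_data D.
Hypothesis gaff : gamma ord0 (caff D) = 0.
Hypothesis gcox : cox gamma = gamma + dl.
Local Notation dsym := (dsym good).
Local Notation sa := (special_aff good).

Lemma subspace_U : subspace U.
Proof. by split=> [|t u v hu hv]; rewrite /inU ?K0r // KDr KZr hu hv mulr0 addr0. Qed.
Lemma subspace_Kl x : subspace (fun v => K v x = 0).
Proof. by split=> [|t u v hu hv]; rewrite ?K0l // KDl KZl hu hv mulr0 addr0. Qed.
Lemma subspace_Kr x : subspace (fun v => K x v = 0).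
Proof. by split=> [|t u v hu hv]; rewrite ?K0r // KDr KZr hu hv mulr0 addr0. Qed.
Lemma subspace_Er x : subspace (fun v => E x v = 0).
Proof. by split=> [|t u v hu hv]; rewrite ?eul0r // eulDr eulZr hu hv mulr0 addr0. Qed.
(** The roots are the images under [g] of the simple roots in the shortened word of [cox_factor].
    Together with delta they span U_c, and c is the product of their reflections modulo delta, so a
    subspace that contains delta and is stable under these reflections is stable under c. *)
Lemma tube_roots : exists xs : seq V,
  [/\ forall x, x \in xs -> [/\ lroot x, x ord0 (caff D) = 0 & U x],
      forall Q, subspace Q -> Q dl -> (forall x, x \in xs -> Q x) -> forall v, U v -> Q v &
      forall Q, subspace Q -> Q dl -> (forall x w, x \in xs -> Q w -> Q (trefl x w)) ->
        forall w, Q w -> Q (cox w)].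
Proof.
have [k [t [i [uit mit hc]]]] := cox_factor good.
have [it ut] := andP uit.
pose g := iter k cf; pose ginv := iter k cfinv.
have gK v : g (ginv v) = v by apply: (iter_can k (cfinvK good)).
have gVK v : ginv (g v) = v by apply: (iter_can k (cfK good)).
have gd : g dl = dl by apply: iter_cf_dl.
have gD m v : g (m *: dl + v) = m *: dl + g v.
  by rewrite /g linearP /= -/g gd.
have Kg u v : K (g u) (g v) = K u v by apply: cf_Kiso.
have lt l : l \in t -> l \in fin by move=> h; rewrite -mit inE h orbT.
(* gamma is fixed by c modulo delta, so [ginv gamma] is fixed by the word [t] up to a multiple of
   delta; the coordinate [i], which [t] does not touch, shows that this multiple is 0. *)
have fixg : forall l, l \in t -> Kcv D l (ginv gamma) = 0.
  apply: word_fixed => //; set u := ginv gamma.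
  have [m] := hc gamma; rewrite gcox -/(g _) -/ginv -/u => h.
  have {}h : g (word D t u - u - (1 - m) *: dl) = 0.
    rewrite /g !linearB linearZ /= -/g gd /u gK; apply/eqP.
    by rewrite subr_eq0 subr_eq scalerBl scale1r addrAC -subr_eq eq_sym opprK addrC eq_sym -h.
  have {}h : word D t u - u = (1 - m) *: dl.
    apply/eqP; rewrite -subr_eq0; apply/eqP.
    by rewrite -[LHS]gVK h /ginv linear0.
  have e := congr1 (fun v : V => v ord0 i) h.
  rewrite mxE word_notin // !mxE subrr in e.
  have m1 : 1 - m = 0.
    apply/eqP; move/esym/eqP: e; rewrite mulf_eq0 pnatr_eq0 => /orP[//|].
    by move=> /eqP h0; have := dl_gt0 good i; rewrite mxE h0 ltxx.
  by apply/eqP; rewrite -subr_eq0 h m1 scale0r.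
pose xs := [seq g (sr l) | l <- t].
have xsP x : x \in xs -> [/\ lroot x, x ord0 (caff D) = 0 & U x].
  move=> /mapP[l l_t ->]; split.
  - apply: (iter_ind_pred (Q := lroot)); last exact: lroot_sr.
    by move=> ?; apply: lroot_word.
  - apply/supported_fin; apply: supported_iter_cf; apply: supported_sr; exact: lt.
  - by rewrite /inU -{1}(gK gamma) Kg (K_srr dsym) fixg // mulr0.
have expand v : v ord0 (caff D) = 0 ->
    v = (ginv v) ord0 i *: g (sr i) + \sum_(l <- t) (ginv v) ord0 l *: g (sr l).
  move=> v0; have sv : supported fin (ginv v).
    by apply: supported_iter_cfinv; apply/supported_fin.
  transitivity (\sum_(l <- i :: t) (ginv v) ord0 l *: g (sr l)); last by rewrite big_cons.
  rewrite -{1}(gK v) {1}(vecE (ginv v)) /g linear_sum /=.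
  rewrite (eq_bigr (fun l => (ginv v) ord0 l *: iter k cf (sr l))); last first.
    by move=> l _; rewrite linearZ.
  rewrite (bigID (mem (i :: t))) /= [X in _ + X]big1 ?addr0; last first.
    by move=> l; rewrite mit => hl; rewrite sv // scale0r.
  by rewrite -big_uniq.
exists xs; split => //.
- move=> Q sQ Qd Qx v Uv.
  pose v' := v - v ord0 (caff D) *: dl.
  have -> : v = v' + v ord0 (caff D) *: dl by rewrite /v' subrK.
  apply: subspaceD => //; last exact: subspaceZ.
  have v'0 : v' ord0 (caff D) = 0 by rewrite !mxE (proj1 sa) mulr1 subrr.
  have Uv' : U v' by apply: (subspaceB subspace_U) => //; apply: (subspaceZ _ subspace_U); apply: inU_dl.
  have Kl y : y ord0 (caff D) = 0 -> K gamma y = (ginv y) ord0 i * K gamma (g (sr i)).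
    move=> y0; rewrite {1}(expand y y0) KDr KZr K_sumr big_seq big1 ?addr0 // => l l_t.
    have [_ _] : [/\ lroot (g (sr l)), (g (sr l)) ord0 (caff D) = 0 & U (g (sr l))].
      by apply: xsP; apply: map_f.
    by rewrite /inU KZr => ->; rewrite mulr0.
  (* Otherwise gamma would be isotropic, hence a multiple of delta with zero affine coordinate,
     hence 0, against c gamma = gamma + delta. *)
  have gn0 : K gamma (g (sr i)) != 0.
    apply/eqP => h; have Kgg : K gamma gamma = 0 by rewrite Kl // h mulr0.
    have := gcox; rewrite (K_eq0 good (caff D) Kgg) gaff mul0r scale0r linear0 add0r => /rowP/(_ i)/esym/eqP.
    by rewrite [X in _ == X]mxE gt_eqF // dl_gt0.
  have := Kl v' v'0; rewrite (_ : K gamma v' = 0) // => /esym/eqP.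
  rewrite mulf_eq0 (negbTE gn0) orbF => /eqP ci.
  rewrite (expand v' v'0) ci scale0r add0r; apply: subspace_sum => // l l_t.
  by apply: subspaceZ => //; apply: Qx; apply: map_f.
- move=> Q sQ Qd Qt w Qw; have [m ->] := hc w.
  apply: subspaceD => //; last exact: subspaceZ.
  rewrite -/g -/ginv.
  have gw s u : g (word D s u) = foldr trefl (g u) [seq g (sr l) | l <- s].
    elim: s => //= l s <-; rewrite -(trefl_sr good l) /g (trefl_conj good) //.
  rewrite gw gK -/xs; suff h ys : {subset ys <= xs} -> Q (foldr trefl w ys) by apply: h.
  elim: ys => //= x ys IH hs; apply: Qt; first by apply: hs; rewrite mem_head.
  by apply: IH => y hy; apply: hs; rewrite inE hy orbT.
Qed.

End Tubes.

(** * Simple roots of Upsilon_c and their c-orbits *)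

Section Simples.
Variables (n : nat) (D : cdata n) (gamma : 'rV[rat]_n) (P : 'rV[rat]_n -> Prop).
Local Notation V := 'rV[rat]_n.
Local Notation K := (K D).
Local Notation dl := (delta D).
Local Notation q := (q D).
Local Notation lroot := (lroot D).
Local Notation cox := (cox D).
Local Notation coxinv := (coxinv D).
Local Notation U := (inU D gamma).
Local Notation trefl := (trefl D).
Local Notation conn := (conn D P).
Implicit Types (u v w x y z b p : V) (s t : rat).

Hypothesis good : good_data D.
Hypothesis gaff : gamma ord0 (caff D) = 0.
Hypothesis gcox : cox gamma = gamma + dl.
Hypothesis HP : is_Pic D gamma P.
Local Notation Ksym := (K_symm good).
Local Notation coxK := (coxK' good).
Local Notation coxinvK := (coxinvK' good).
Local Notation sa := (special_aff good).
Local Notation sU := (@subspace_U n D gamma).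

Lemma P_Upspos x : P x -> Upspos D gamma x. Proof. by case: HP => h _; apply: h. Qed.
Lemma P_nonneg x : P x -> nonneg x. Proof. by move=> /P_Upspos[[_ [_ h]] _]. Qed.
Lemma P_U x : P x -> U x. Proof. by move=> /P_Upspos[]. Qed.
Lemma P_neq0 x : P x -> x != 0. Proof. by move=> /P_Upspos[[_ []]]. Qed.
Lemma conep_nonneg v : cone P v -> nonneg v. Proof. exact: cone_nonneg P_nonneg. Qed.

Lemma root_cone v : lroot v -> nonneg v -> U v -> cone P v.
Proof.
case: HP => _ [h _] rv pv uv; apply/cone_inE; apply: h; split => //.
by split; [left; apply: lroot_real|apply: (nonneg_pos rv)].
Qed.

Lemma dl_cone t : 0 <= t -> cone P (t *: dl).
Proof.
move=> t0; apply: coneZ => //; case: HP => _ [h _]; apply/cone_inE; apply: h.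
split; last exact: (inU_dl good gcox).
split; first by right; exists 1; split => //; rewrite scale1r.
split=> [|i]; last exact: ltW (dl_gt0 good i).
by apply/eqP => h0; have := dl_gt0 good (caff D); rewrite h0 mxE ltxx.
Qed.

(** If x were generated by the other elements, removing it would leave a smaller generating set,
    against minimality of [P]. *)
Lemma P_irredundant x : P x -> ~ cone (fun y => P y /\ y <> x) x.
Proof.
move=> px cx; case: HP => _ [hg hm].
have [] : P x /\ x <> x; last by [].
apply: (hm (fun y => P y /\ y <> x)) => // [v []//|v hv].
apply/cone_inE; have /cone_inE := hg v hv; apply: cone_trans => y py.
by case: (classic (y = x)) => [->//|yx]; apply: cone_in.
Qed.

Lemma nonneg_add_eq0 u v : nonneg u -> nonneg v -> u + v = 0 -> u = 0.
Proof.
move=> hu hv /eqP; rewrite addr_eq0 => /eqP e; apply: (nonneg_opp hu).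
by rewrite e opprK.
Qed.

(** x spans an extreme ray of the cone generated by [P]. *)
Definition extremal x := forall y z, cone P y -> cone P z -> x = y + z -> exists t, y = t *: x.

(** Separate the multiples of x inside y and z, leaving (1 - b - b') x = y' + z'. A positive factor
    contradicts irredundancy, a negative one contradicts nonnegativity, and factor 0 forces y' =
    0. *)
Lemma P_extremal x : P x -> extremal x.
Proof.
move=> px y z /(cone_remove x)[b [y' [b0 cy ->]]] /(cone_remove x)[b' [z' [b0' cz ->]]] e.
have sub w : cone (fun y => P y /\ y <> x) w -> nonneg w.
  by apply: cone_nonneg => ? [/P_nonneg].
have {}e : (1 - b - b') *: x = y' + z'.
  by apply/rowP => i; have := congr1 (fun v : V => v ord0 i) e; rewrite !mxE; lra.
case: (ltrgtP 0 (1 - b - b')) => [h|h|h].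
- have cc : cone (fun y => P y /\ y <> x) ((1 - b - b')^-1 *: (y' + z')).
    by apply: coneZ; rewrite ?invr_ge0 ?(ltW h) //; apply: coneD.
  by case: (P_irredundant px); rewrite -e scalerA mulVf ?scale1r ?gt_eqF in cc.
- have c0 : 0 < - (1 - b - b') by rewrite oppr_gt0.
  have x0 : (- (1 - b - b')) *: x + (y' + z') = 0 by rewrite -e scaleNr addNr.
  have /eqP : (- (1 - b - b')) *: x = 0.
    apply: nonneg_add_eq0 x0 => i; rewrite mxE; last by rewrite addr_ge0 ?sub.
    by rewrite mulr_ge0 ?(ltW c0) ?(P_nonneg px).
  by rewrite scaler_eq0 (negbTE (P_neq0 px)) (gt_eqF c0).
- move: e; rewrite -h scale0r => /esym e.
  by exists b; rewrite (nonneg_add_eq0 (sub _ cy) (sub _ cz) e) addr0.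
Qed.

Lemma prop_eq x y t : lroot x -> lroot y -> nonneg x -> nonneg y -> y = t *: x -> x = y.
Proof.
move=> rx ry px py e; case: (lerP t 0) => t0.
  have /eqP := lroot_neq0 ry; case; apply: (nonneg_opp py).
  by move=> i; rewrite e !mxE -mulNr mulr_ge0 ?oppr_ge0.
have t1 : t = 1 by apply: (lroot_prop good t0 rx); rewrite -e.
by rewrite e t1 scale1r.
Qed.

Lemma dl_not_prop x (t s : rat) : lroot x -> s != 0 -> s *: x <> t *: dl.
Proof.
move=> rx s0 h; apply: (@lroot_dl n D good (s^-1 * t)).
by rewrite -scalerA -h scalerA mulVf // scale1r.
Qed.

(** A real root b of U_c makes delta a non-extreme direction: 2M delta is the sum of M delta - b'
    and M delta + b', both positive roots of U_c for suitable M, where b' is b projected along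
    delta. *)
Lemma P_lroot b x : lroot b -> U b -> P x -> lroot x.
Proof.
move=> rb ub px; have [[[/(real_lroot good)//|[m [m0 xE]]] [_ _]] ux] := P_Upspos px.
exfalso; pose e := caff D; pose b' := b - b ord0 e *: dl.
have rb' : lroot b' := lroot_proj good sa rb.
have b'e : b' ord0 e = 0 by rewrite !mxE (proj1 sa) mulr1 subrr.
have ub' : U b' by apply: (subspaceB sU) => //; apply: inUZ; exact: (inU_dl good gcox).
pose M := bnd D e b'; have M0 : 0 < M := bnd_gt0 _ _ _.
have c1 : cone P (M *: dl - b').
  apply: root_cone; last 1 first.
  - by apply: (subspaceB sU) => //; apply: inUZ; exact: (inU_dl good gcox).
  - by rewrite -opprB; apply: lroot_N; exact: (lroot_shift_bnd good sa).
  - exact: (fin_bounded good sa).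
have c2 : cone P (M *: dl + b').
  rewrite -[b']opprK; apply: root_cone; last 1 first.
  - apply: (subspaceB sU); first by apply: inUZ; exact: (inU_dl good gcox).
    exact: (subspaceN sU).
  - rewrite -opprB; apply: lroot_N; have := lroot_shift_bnd good sa (lroot_N rb').
    by rewrite /bnd q_N.
  - by rewrite opprK addrC; exact: (fin_bounded2 good sa).
have m0' : 0 < m.
  have := P_nonneg px e; rewrite xE !mxE (proj1 sa) mulr1 ler0z le_eqVlt => /orP[/eqP h|//].
  by rewrite h eqxx in m0.
(* With r = m / (2M) the two scaled roots add up to x = m delta. *)
pose r : rat := m%:~R / (2 * M); have r0 : 0 < r by rewrite divr_gt0 ?ltr0z // mulr_gt0.
have [t] : exists t, r *: (M *: dl - b') = t *: x.
  apply: (P_extremal px (z := r *: (M *: dl + b'))); try exact: coneZ (ltW r0) _.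
  rewrite -scalerDr addrACA [- b' + b']addrC subrr addr0 -scalerDl scalerA xE.
  by congr (_ *: _); rewrite /r; field; rewrite gt_eqF.
rewrite xE scalerA scalerBr scalerA => /eqP; rewrite subr_eq addrC -subr_eq -scalerBl eq_sym => /eqP.
by apply: dl_not_prop => //; rewrite gt_eqF.
Qed.

(* This is all of [P] unless [U] contains no real root. *)
Definition B x := P x /\ lroot x.

Lemma B_P b x : B b -> P x -> B x.
Proof. by move=> [pb rb] px; split => //; apply: (P_lroot rb (P_U pb)). Qed.
Lemma B_nonneg b : B b -> nonneg b. Proof. by case=> /P_nonneg. Qed.
Lemma B_U b : B b -> U b. Proof. by case=> /P_U. Qed.
Lemma B_q b : B b -> 0 < q b. Proof. by case=> _ []. Qed.

(** Some simple root occurs in x with a positive coefficient; extremality makes it proportional to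
    x, and proportional positive roots are equal. *)
Lemma extremal_B x : lroot x -> nonneg x -> U x -> extremal x -> B x.
Proof.
move=> rx px ux ex; have cx := root_cone rx px ux.
have [|||t [p [w [pp t0 cw xE _]]]] := cone_pick (phi := @ht n) _ _ _ cx.
- by move=> t y z; rewrite htD htZ.
- by rewrite /ht big1 // => i _; rewrite mxE.
- rewrite lt_def ht_ge0 // andbT; apply/eqP => h0.
  by have := lroot_neq0 rx; rewrite (ht_eq0 px h0) eqxx.
have [s e] : exists s, t *: p = s *: x.
  by apply: (ex _ w) => //; apply: coneZ; [exact: ltW|exact: cone_in].
have rp := P_lroot rx ux pp.
have pE : p = (t^-1 * s) *: x by rewrite -scalerA -e scalerA mulVf ?scale1r // gt_eqF.
by rewrite (prop_eq rx rp px (P_nonneg pp) pE).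
Qed.

Lemma cone_cox b v : B b -> cone P v -> cone P (cox v).
Proof.
move=> hb; elim=> [|t x w px t0 _ IH]; first by rewrite linear0; constructor.
rewrite linearP; apply: coneD => //; apply: coneZ => //.
have [_ rx] := B_P hb px; apply: root_cone; first exact: lroot_cox.
  exact: nonneg_cox (P_nonneg px) (P_U px).
by rewrite inU_cox //; apply: P_U.
Qed.
Lemma cone_coxinv b v : B b -> cone P v -> cone P (coxinv v).
Proof.
move=> hb; elim=> [|t x w px t0 _ IH]; first by rewrite linear0; constructor.
rewrite linearP; apply: coneD => //; apply: coneZ => //.
have [_ rx] := B_P hb px; apply: root_cone; first exact: lroot_coxinv.
  exact: nonneg_coxinv (P_nonneg px) (P_U px).
by rewrite inU_coxinv //; apply: P_U.
Qed.

(** c and c^-1 preserve the positive roots of U_c, hence the cone they generate, hence its extreme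
    rays. *)
Lemma B_cox b : B b -> B (cox b).
Proof.
move=> hb; have [pb rb] := hb; apply: extremal_B; first exact: lroot_cox.
- exact: nonneg_cox (P_nonneg pb) (P_U pb).
- by rewrite inU_cox //; apply: P_U.
move=> y z cy cz e; have {}e : b = coxinv y + coxinv z by rewrite -linearD -e /= coxK.
have [t h] := P_extremal pb (cone_coxinv hb cy) (cone_coxinv hb cz) e.
by exists t; rewrite -[y]coxinvK h linearZ.
Qed.
Lemma B_coxinv b : B b -> B (coxinv b).
Proof.
move=> hb; have [pb rb] := hb; apply: extremal_B; first exact: lroot_coxinv.
- exact: nonneg_coxinv (P_nonneg pb) (P_U pb).
- by rewrite inU_coxinv //; apply: P_U.
move=> y z cy cz e; have {}e : b = cox y + cox z by rewrite -linearD -e /= coxinvK.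
have [t h] := P_extremal pb (cone_cox hb cy) (cone_cox hb cz) e.
by exists t; rewrite -[y]coxK h linearZ.
Qed.
Lemma B_iter k b : B b -> B (iter k coxinv b).
Proof. by apply: iter_ind_pred; exact: B_coxinv. Qed.

(* If [x - k p] is negative for some [k > 0], extremality of [p] forces [x = p]. *)
Lemma B_only p x k : B p -> lroot x -> nonneg x -> U x -> 0 < k ->
  cone P (k *: p - x) -> x = p.
Proof.
move=> [pp rp] rx px ux k0 cx.
have [t h] : exists t, k^-1 *: x = t *: p.
  apply: (P_extremal pp (z := k^-1 *: (k *: p - x))).
  - by apply: coneZ; rewrite ?invr_ge0 ?(ltW k0) //; apply: root_cone.
  - by apply: coneZ; rewrite ?invr_ge0 ?(ltW k0).
  - by rewrite -scalerDr addrCA subrr addr0 scalerA mulVf ?scale1r // gt_eqF.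
symmetry; apply: (@prop_eq _ _ (k * t)) => //; first exact: P_nonneg.
by rewrite -scalerA -h scalerA mulfV ?scale1r // gt_eqF.
Qed.

Lemma trefl_U x w : U x -> U w -> U (trefl x w).
Proof. by move=> ux uw; apply: (subspaceB sU) => //; apply: inUZ. Qed.

(** If K(x, y) > 0 the reflection y - k x is a root of U_c of a definite sign, and either sign
    contradicts extremality of x or of y through [B_only]. *)
Lemma B_K x y : B x -> B y -> x <> y -> K x y <= 0.
Proof.
move=> hx hy xy; have [px rx] := hx; have [py ry] := hy.
rewrite leNgt; apply/negP => k0; have rw := lroot_trefl good rx ry.
have uw := trefl_U (P_U px) (P_U py).
pose k := K x y / q x; have kp : 0 < k by rewrite divr_gt0 ?B_q.
case: (lroot_posneg good rw) => h.
  apply: xy; apply: (B_only (k := k^-1) hy rx (P_nonneg px) (P_U px)); first by rewrite invr_gt0.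
  rewrite -[x in _ - x]scale1r -(mulVf (lt0r_neq0 kp)) -scalerA -scalerBr.
  by apply: coneZ; [rewrite invr_ge0 ltW|exact: root_cone].
apply: xy; symmetry; apply: (B_only (k := k) hx ry (P_nonneg py) (P_U py) kp).
rewrite -opprB; apply: root_cone => //; first exact: lroot_N.
exact: (subspaceN sU).
Qed.

Lemma K_pos x : lroot x -> 0 < K x x.
Proof. by case=> _ h _; rewrite (K_q good); lra. Qed.

(** Height induction inside U_c: a positive root x has a simple constituent p with K(x, p) > 0. The
    affine coordinate of p vanishes because p lies below x, so the reflection in p stays among roots
    of finite type. *)
Lemma finU_ind (Q : V -> Prop) :
  (forall p, B p -> p ord0 (caff D) = 0 -> Q p) ->
  (forall p y, B p -> p ord0 (caff D) = 0 -> lroot y -> nonneg y -> U y ->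
     y ord0 (caff D) = 0 -> Q y -> K p y < 0 -> Q (trefl p y)) ->
  forall x, lroot x -> nonneg x -> U x -> x ord0 (caff D) = 0 -> Q x.
Proof.
move=> Qs Qt x; have [m] : exists m : nat, ht x < m%:R.
  by exists (Num.truncn (ht x)).+1; rewrite truncnS_gt.
elim: m x => [|m IH] x hx rx px ux xa; first by have := ht_ge0 px; rewrite leNgt hx.
have cx := root_cone rx px ux.
have [|| |t [p [w [pp t0 cw xE Kp]]]] := cone_pick (phi := K x) _ _ _ cx.
- by move=> s u v; rewrite KDr KZr.
- exact: K0r.
- exact: K_pos.
have hp : B p by split => //; exact: (P_lroot rx ux).
have rp := proj2 hp.
have pa : p ord0 (caff D) = 0.
  have := congr1 (fun v : V => v ord0 (caff D)) xE; rewrite xa !mxE => h.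
  have wa := conep_nonneg cw (caff D); have pp0 := P_nonneg pp (caff D).
  apply/eqP; rewrite eq_le pp0 andbT -(pmulr_rle0 _ t0); lra.
pose k := K p x / q p; have k0 : 0 < k by rewrite divr_gt0 ?B_q // Ksym.
have ry := lroot_trefl good rp rx; have uy := trefl_U (P_U pp) ux.
case: (lroot_posneg good ry) => h; last first.
  suff -> : x = p by apply: Qs.
  apply: (B_only hp rx px ux k0); rewrite -opprB; apply: root_cone => //.
    exact: lroot_N.
  exact: (subspaceN sU).
have ya : (trefl p x) ord0 (caff D) = 0 by rewrite !mxE xa pa mulr0 subr0.
have Kpy : K p (trefl p x) = - K p x.
  by rewrite KBr KZr (K_q good p); field; rewrite gt_eqF ?B_q.
have -> : x = trefl p (trefl p x).
  have tE v : trefl p v = v - (K p v / q p) *: p by [].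
  by rewrite [RHS]tE Kpy mulNr scaleNr opprK tE subrK.
apply: Qt => //; last by rewrite Kpy oppr_lt0 Ksym.
apply: IH => //; have k1 : 1 <= k.
  by apply: int_ge1 k0; apply: lroot_K; case: rx.
have hp1 : 1 <= ht p.
  apply: int_ge1; first by apply: ht_int; case: rp.
  rewrite lt_def ht_ge0 ?andbT ?P_nonneg //; last exact: P_nonneg.
  by apply/eqP => /(ht_eq0 (P_nonneg pp)) p0; have := P_neq0 pp; rewrite p0 eqxx.
have : 1 <= k * ht p by rewrite -[1]mulr1 ler_pM.
by move: hx; rewrite htD htN htZ -/k -natr1; lra.
Qed.

Lemma conn_P x y : conn x y -> P x /\ P y.
Proof. by elim=> [z pz|z u v _ [h1 h2] pv _]; split. Qed.
Lemma conn_trans x y z : conn x y -> conn y z -> conn x z.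
Proof.
move=> xy yz; elim: yz xy => [//|u v w _ IH pw k xu].
exact: conn_step (IH xu) pw k.
Qed.
Lemma conn_sym x y : conn x y -> conn y x.
Proof.
elim=> [z pz|u v w uv IH pw k]; first by constructor.
apply: conn_trans IH; apply: (conn_step (y := w)); first by constructor.
  by case: (conn_P uv).
by rewrite Ksym.
Qed.

Lemma K_not_conn p p' u v : ~ conn p p' ->
  lspan (fun y => conn p y \/ y = dl) u -> lspan (fun y => conn p' y \/ y = dl) v -> K u v = 0.
Proof.
move=> np hu hv; apply: (hu (fun u => K u v = 0)); first exact: subspace_Kl.
move=> y [py|->]; last by rewrite (K_dll good).
apply: (hv (fun v => K y v = 0)); first exact: subspace_Kr.
move=> z [pz|->]; last by rewrite (K_dlr good).
apply/eqP/negPn/negP => k0; apply: np; apply: conn_trans (conn_sym pz).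
by apply: (conn_step py) => //; case: (conn_P pz).
Qed.

Lemma finU_conn x : lroot x -> nonneg x -> U x -> x ord0 (caff D) = 0 ->
  exists2 p, B p & lspan (fun y => conn p y \/ y = dl) x.
Proof.
move: x; apply: finU_ind => [p hp _|p y hp pa ry py uy ya [p' hp' sy] k0].
  by exists p => //; apply: lspan_in; left; constructor; case: hp.
exists p' => //; apply: (subspaceB (lspan_subspace _)) => //.
apply: (subspaceZ _ (lspan_subspace _)); apply: lspan_in; left.
apply: NNPP => nc; suff : K p y = 0 by move=> h; rewrite h ltxx in k0.
apply: (@K_not_conn p p') => //; first by move=> /conn_sym.
by apply: lspan_in; left; constructor; case: hp.
Qed.

(** Every root of [tube_roots] lies in the span of one component and delta, so its reflection
    preserves the span of the component of p and delta. Thus c p lies in that span; in another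
    component it would be orthogonal to itself. *)
Lemma conn_cox p : B p -> conn p (cox p).
Proof.
move=> hp; have [xs [hx _ hst]] := tube_roots good gaff gcox.
pose Q := lspan (fun y => conn p y \/ y = dl).
have : Q (cox p).
  apply: (hst Q); first exact: lspan_subspace.
  - by apply: lspan_in; right.
  - move=> x w /hx[rx xa ux] Qw.
    have [p' hp' [sg hs]] : exists2 p', B p' & exists sg : bool,
        lspan (fun y => conn p' y \/ y = dl) x.
      case: (lroot_posneg good rx) => h.
        by have [p' ? ?] := finU_conn rx h ux xa; exists p' => //; exists true.
      have [|p' ? h'] := finU_conn (lroot_N rx) h (subspaceN sU ux).
        by rewrite mxE xa oppr0.
      by exists p' => //; exists true; rewrite -[x]opprK; apply: (subspaceN (lspan_subspace _)).
    case: (classic (conn p p')) => c; last first.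
      by rewrite /trefl Ksym (K_not_conn c Qw hs) mul0r scale0r subr0.
    apply: (subspaceB (lspan_subspace _)) => //; apply: (subspaceZ _ (lspan_subspace _)).
    move=> Q' sQ' h; apply: hs => // y [py|yd]; apply: h; last by right.
    by left; apply: conn_trans c py.
  - by apply: lspan_in; left; constructor; case: hp.
move=> Qc; apply: NNPP => nc; have hc := B_cox hp.
have := K_pos (proj2 hc); rewrite (K_not_conn nc Qc) ?ltxx //.
by apply: lspan_in; left; constructor; case: hc.
Qed.

(** The shift p - bnd delta is a root of U_c. If it were positive, extremality of p would make delta
    proportional to a real root. *)
Lemma B_bounded p : B p -> nonneg (bnd D (caff D) p *: dl - p).
Proof.
move=> hp; have [pp rp] := hp; have rs := lroot_shift_bnd good sa rp.
case: (lroot_posneg good rs) => h; last by rewrite opprB in h.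
have M0 := bnd_gt0 D (caff D) p.
have [t e] : exists t, bnd D (caff D) p *: dl = t *: p.
  apply: (P_extremal pp (z := p - bnd D (caff D) p *: dl)).
  - by apply: dl_cone; apply: ltW.
  - by apply: root_cone => //; apply: (subspaceB sU); [exact: P_U|apply: inUZ; exact: (inU_dl good gcox)].
  - by rewrite addrCA subrr addr0.
exfalso; have t0 : t != 0.
  apply/eqP => t0; move/rowP/(_ (caff D)): e; rewrite t0 !mxE (proj1 sa) mul0r mulr1.
  by move/eqP; rewrite gt_eqF.
exact: (dl_not_prop rp t0 (esym e)).
Qed.

Lemma q_iter k p : q (iter k coxinv p) = q p.
Proof. by apply: (iter_inv (F := q)) => u; apply: q_coxinv. Qed.

Definition period p r := [/\ (0 < r)%N, iter r coxinv p = p &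
  forall k, (0 < k < r)%N -> iter k coxinv p <> p].

Lemma iter_coxinv_inj k : injective (iter k coxinv).
Proof. exact: can_inj (iter_can k coxinvK). Qed.

Lemma period_exists p : B p -> exists r, period p r.
Proof.
move=> hp; pose M := bnd D (caff D) p.
have [b hb] := nat_bound (M *: dl).
have [k [l [kl e]]] : exists k l, (k < l)%N /\ iter k coxinv p = iter l coxinv p.
  apply: (@pigeonhole _ (fun k => iter k coxinv p) b) => k.
  - by have [_ []] := B_iter k hp.
  - exact: B_nonneg (B_iter k hp).
  - move=> i; have := B_bounded (B_iter k hp) i; rewrite /bnd q_iter -/(bnd _ _ p) -/M.
    by have := hb i; rewrite !mxE; lra.
have ex : exists r, (0 < r)%N && (iter r coxinv p == p).
  exists (l - k)%N; rewrite subn_gt0 kl /=; apply/eqP; apply: (@iter_coxinv_inj k).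
  by rewrite -iterD subnKC ?(ltnW kl).
case: (ex_minnP ex) => r /andP[r0 /eqP er] hm.
exists r; split => // m /andP[m0 mr] em.
by have := hm m; rewrite m0 em eqxx leqNgt mr => /(_ isT).
Qed.

Lemma fixed_dl S : coxinv S = S -> forall e, S = (S ord0 e / dl ord0 e) *: dl.
Proof.
rewrite coxinvE => h e; apply: (K_eq0 good).
apply: (@K_supported0 _ _ good (rev (enum 'I_n))).
  by apply: word_fixed => //; rewrite rev_uniq enum_uniq.
by apply/supported_rev; apply: supported_enum.
Qed.

Lemma period_ge2 p r : B p -> period p r -> (1 < r)%N.
Proof.
move=> hp [r0 h _]; rewrite ltn_neqAle r0 andbT; apply/eqP => r1.
rewrite -r1 /= in h; have [_ rp] := hp.
have := fixed_dl h (caff D); rewrite -[LHS]scale1r.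
by apply: dl_not_prop => //; exact: oner_neq0.
Qed.

(** The sum is fixed by c^-1, hence lies in the radical of [K]. *)
Lemma orbit_sum p r : B p -> period p r ->
  exists2 k, 0 < k & \sum_(i < r) iter i coxinv p = k *: dl.
Proof.
move=> hp [r0 er _]; set S := \sum_(i < r) _.
have cS : coxinv S = S.
  rewrite /S linear_sum /=; have := shift_sum (fun i => iter i coxinv p) 0 r.
  by rewrite !add0n er subrr addr0 => h.
have SE := fixed_dl cS (caff D).
exists (S ord0 (caff D) / dl ord0 (caff D)) => //.
have S0 : nonneg S by apply: nonneg_sum => i; apply: B_nonneg; apply: B_iter.
rewrite lt_def divr_ge0 ?S0 ?ltW ?dl_gt0 // andbT; apply/eqP => h.
move: SE; rewrite h scale0r => Sz.
have [_ rp] := hp; have /eqP := lroot_neq0 rp; apply; apply/rowP => i; rewrite [RHS]mxE.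
have := congr1 (fun v : V => v ord0 i) Sz; rewrite /S -(prednK r0) big_ord_recl /= !mxE.
have := B_nonneg hp i; have : nonneg (\sum_(i0 < r.-1) coxinv (iter i0 coxinv p)).
  by apply: nonneg_sum => k; exact: B_nonneg (B_iter k.+1 hp).
by move/(_ i); lra.
Qed.

Lemma conn_orbit p k : B p -> conn p (iter k coxinv p).
Proof.
move=> hp; elim: k => [|k IH]; first by constructor; case: hp.
apply: conn_trans IH _; apply: conn_sym; rewrite iterS.
by have := conn_cox (B_coxinv (B_iter k hp)); rewrite coxinvK.
Qed.

Lemma iter_mod p r k : period p r -> iter k coxinv p = iter (k %% r) coxinv p.
Proof.
move=> [_ er _]; rewrite {1}(divn_eq k r) addnC iterD; congr (iter _ _ _).
elim: (k %/ r)%N => [|m IH]; first by rewrite mul0n.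
by rewrite mulSn iterD IH.
Qed.

Lemma iter_period_inj p r i j : period p r -> (i < r)%N -> (j < r)%N ->
  iter i coxinv p = iter j coxinv p -> i = j.
Proof.
move=> [r0 er hm]; wlog ij : i j / (i <= j)%N.
  by move=> h ir jr e; case: (leqP i j) => c; [apply: h|symmetry; apply: h => //; apply: ltnW].
move=> ir jr e; apply/eqP; rewrite eqn_leq ij leqNgt; apply/negP => lt.
apply: (hm (j - i)%N); first by rewrite subn_gt0 lt /= (leq_ltn_trans (leq_subr _ _)).
by apply: (@iter_coxinv_inj i); rewrite -iterD subnKC.
Qed.

(** The sum of the orbit is a multiple of delta, hence orthogonal to z, while each product is
    nonpositive. All products vanish, so a component of the diagram is a single c-orbit. *)
Lemma K_conn_out p z r : B p -> period p r -> P z -> (forall k, iter k coxinv p <> z) ->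
  forall k, K (iter k coxinv p) z = 0.
Proof.
move=> hp op pz nz; have hz := B_P hp pz; have [c c0 hS] := orbit_sum hp op.
have h0 : forall i : 'I_r, K (iter i coxinv p) z = 0.
  have /eqP : \sum_(i < r) K z (iter i coxinv p) = 0.
    by rewrite -K_sumr hS KZr (K_dlr good) mulr0.
  rewrite -oppr_eq0 -sumrN psumr_eq0 => [/allP h i|i _].
    have := h i (mem_index_enum _); rewrite oppr_eq0 Ksym => /eqP //.
  by rewrite oppr_ge0 B_K //; [exact: B_iter|move=> h; apply: (nz i)].
move=> k; rewrite (iter_mod k op); have [r0 _ _] := op.
exact: (h0 (Ordinal (ltn_pmod k r0))).
Qed.

Lemma conn_in_orbit p z : conn p z -> B p -> exists k, iter k coxinv p = z.
Proof.
elim=> [y _ _|x y w xy IH pw k0 hx]; first by exists 0%N.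
have [k ek] := IH hx; have [r ox] := period_exists hx.
apply: NNPP => nex; move/eqP: k0; apply; rewrite -ek.
by apply: (K_conn_out hx ox pw) => m hm; apply: nex; exists m.
Qed.

End Simples.

(** * Arcs *)

Section Arcs.
Variables (n : nat) (D : cdata n) (gamma : 'rV[rat]_n) (P : 'rV[rat]_n -> Prop).
Local Notation V := 'rV[rat]_n.
Local Notation K := (K D).
Local Notation E := (eul D).
Local Notation dl := (delta D).
Local Notation q := (q D).
Local Notation lroot := (lroot D).
Local Notation cox := (cox D).
Local Notation coxinv := (coxinv D).
Local Notation U := (inU D gamma).
Local Notation conn := (conn D P).
Implicit Types (u v w x y z b p : V) (s t : rat).

Hypothesis good : good_data D.
Hypothesis gaff : gamma ord0 (caff D) = 0.
Hypothesis gcox : cox gamma = gamma + dl.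
Hypothesis HP : is_Pic D gamma P.
Local Notation dsym := (dsym good).
Local Notation a2 := (a_diag good).
Local Notation Ksym := (K_symm good).
Local Notation sa := (special_aff good).
Local Notation inUE := (inUE good gcox).
Local Notation sU := (@subspace_U n D gamma).
Local Notation B := (B D P).
Local Notation period := (period D).
Local Notation BK := (B_K good HP).
Local Notation Bit := (B_iter good gcox HP).
Local Notation Bnn := (B_nonneg HP).
Local Notation BU := (B_U HP).

(** With m = b_e, the root w = m delta - b vanishes at [e], so its expansion uses only simple roots
    vanishing at [e]. The set formed by b and these roots is closed under adjacency, hence is the
    whole component. *)
Lemma special_unique e b b' : special D e -> B b -> conn b b' ->
  b ord0 e != 0 -> b' ord0 e != 0 -> b = b'.
Proof.
move=> se hb cbb' be be'; have [pb rb] := hb.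
apply: NNPP => bb'; pose m := b ord0 e; pose w := m *: dl - b.
have m0 : 0 < m by rewrite lt_def be (Bnn hb).
have rw : lroot w by rewrite /w -opprB; apply: lroot_N; apply: lroot_proj.
have uw : U w by apply: (subspaceB sU) => //; [apply: inUZ; exact: (inU_dl good gcox)|exact: BU].
have pw : nonneg w.
  case: (lroot_posneg good rw) => // h; rewrite opprB in h.
  have [t et] : exists t, m *: dl = t *: b.
    apply: (P_extremal HP pb (z := b - m *: dl)).
    - exact: (dl_cone good gcox HP (ltW m0)).
    - apply: (root_cone good HP) => //; first by rewrite -opprB; apply: lroot_N.
      by rewrite -opprB; apply: (subspaceN sU).
    - by rewrite addrCA subrr addr0.
  exfalso; have t0 : t != 0.
    apply/eqP => t0; move/rowP/(_ e): et; rewrite t0 !mxE (proj1 se) mul0r mulr1.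
    by move/eqP; rewrite gt_eqF.
  exact: (dl_not_prop good rb t0 (esym et)).
have we : w ord0 e = 0 by rewrite !mxE (proj1 se) mulr1 subrr.
have /cone_inE[s [f [hs [f0 ws]]]] := root_cone good HP rw pw uw.
have fe x : x \in s -> 0 < f x -> x ord0 e = 0.
  move=> xs fx; have px := P_nonneg HP (hs x xs).
  have /eqP : \sum_(y <- s) f y * y ord0 e = 0.
    by rewrite -[RHS]we ws summxE; apply: eq_bigr => y _; rewrite mxE.
  rewrite big_seq psumr_eq0 => [/allP h|y ys]; last first.
    by rewrite mulr_ge0 ?f0 // (P_nonneg HP (hs y ys)).
  by have := h x xs; rewrite xs mulf_eq0 (gt_eqF fx) => /eqP.
pose T z := z = b \/ (z \in s /\ 0 < f z).
(* For z outside [T] all terms of K(z, b) + K(z, w) = K(z, m delta) = 0 are nonpositive, so each of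
   them vanishes and z is adjacent to nothing in [T]. *)
have closed y z : T y -> P z -> K y z != 0 -> T z.
  move=> Ty pz k0; apply: NNPP => nT.
  have hz : B z := B_P good gcox HP hb pz.
  have zb : z <> b by move=> h; apply: nT; left.
  have term x : x \in s -> f x * K z x <= 0.
    move=> xs; have := f0 x; rewrite le_eqVlt => /orP[/eqP <-|fx]; first by rewrite mul0r.
    rewrite pmulr_rle0 // BK //; first exact: (B_P good gcox HP hb (hs x xs)).
    by move=> zx; apply: nT; right; rewrite zx.
  have Kzb : K z b <= 0 by apply: BK.
  have Kzw : K z w = \sum_(x <- s) f x * K z x.
    by rewrite ws K_sumr; apply: eq_bigr => x _; rewrite KZr.
  have Kzw0 : K z w <= 0.
    by rewrite Kzw big_seq sumr_le0 // => x xs; apply: term.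
  have e0 : K z b + K z w = 0.
    by rewrite /w KBr KZr (K_dlr good) mulr0 sub0r subrr.
  case: Ty => [yb|[ys fy]].
    by move/eqP: k0; apply; rewrite yb Ksym; lra.
  have /eqP : K z w = 0 by lra.
  rewrite Kzw -oppr_eq0 -sumrN big_seq psumr_eq0 => [/allP h|x xs]; last first.
    by rewrite oppr_ge0 term.
  have := h y ys; rewrite ys oppr_eq0 mulf_eq0 (gt_eqF fy) /= => /eqP h0.
  by move/eqP: k0; apply; rewrite Ksym.
have Tconn x z : conn x z -> x = b -> T z.
  elim=> [y _ ->|y u v _ IH pv k0 yb]; first by left.
  exact: closed (IH yb) pv k0.
case: (Tconn _ _ cbb' erefl) => [h|[ys fy]]; first by apply: bb'.
by move: be'; rewrite (fe _ ys fy) eqxx.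
Qed.

Lemma special_exists e p r : B p -> period p r ->
  exists k, (k < r)%N /\ (iter k coxinv p) ord0 e != 0.
Proof.
move=> hp op; have [c c0 hS] := orbit_sum good gcox HP hp op.
apply: NNPP => nex; have := congr1 (fun v : V => v ord0 e) hS; rewrite summxE big1 => [|i _].
  by rewrite mxE => /esym/eqP; rewrite gt_eqF // mulr_gt0 // dl_gt0.
by apply/eqP/negPn/negP => h; apply: nex; exists i.
Qed.

Lemma E_orbit_step p k :
  E p (iter k.+1 coxinv p) = E p (iter k coxinv p) - K p (iter k coxinv p).
Proof. by rewrite (K_coxi good) eulBr opprB addrCA subrr addr0. Qed.

Lemma E_orbit1 p : E p (coxinv p) = - q p.
Proof. by rewrite (E_coxinv good). Qed.

Lemma iter_coxinv_E k u v : E (iter k coxinv u) (iter k coxinv v) = E u v.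
Proof. by elim: k => //= k IH; rewrite (E_coxinv2 good). Qed.
Lemma iter_coxinv_K k u v : K (iter k coxinv u) (iter k coxinv v) = K u v.
Proof. by rewrite !(K_eul dsym a2) !iter_coxinv_E. Qed.

(* The Dynkin diagram of an orbit is a cycle on which [c] acts by one step.
   The crucial inequality comes from the acyclicity of [E < 0] on the positive
   roots of finite type: the source of the roots [c^-i p], [0 < i < r], can only
   be [c^-(r-1) p]. *)
Lemma E_orbit0 p r k : B p -> period p r -> p ord0 (caff D) != 0 -> (k < r)%N ->
  E p (iter k coxinv p) = q p * ((k == 0%N)%:R - (k == 1%N)%:R).
Proof.
move=> hp op pa; have [pp rp] := hp; have [r0 er hm] := op.
have r2 := period_ge2 good hp op.
have fa i : (0 < i < r)%N -> (iter i coxinv p) ord0 (caff D) = 0.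
  move=> hi; apply/eqP/negPn/negP => h; apply: (hm i hi); symmetry.
  by apply: (special_unique sa hp) => //; exact: (conn_orbit good gaff gcox HP).
have E2 : E p (iter 2 coxinv p) = - q p - K p (coxinv p).
  by rewrite E_orbit_step /= E_orbit1.
have Kneg i : (0 < i < r)%N -> K p (iter i coxinv p) <= 0.
  move=> hi; apply: BK => //; first exact: Bit.
  by move=> h; apply: (hm i hi).
(* For r = 2 the two neighbours of p coincide, and E(p, c^-1 p) = -q p already suffices. *)
have [r2e|r3] : r = 2%N \/ (2 < r)%N by case: (ltngtP 2 r) r2; auto; lia.
  rewrite r2e; case: k => [_|[_|//]] /=; first by rewrite subr0 mulr1.
  by rewrite E_orbit1 sub0r mulrN1.
have K1 : K p (coxinv p) <= - q p.
  pose Y := [seq iter i coxinv p | i <- iota 1 r.-1].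
  have memY i : (0 < i < r)%N -> iter i coxinv p \in Y.
    by move=> hi; apply: map_f; rewrite mem_iota; lia.
  have [| |x xY hx] := @fin_source _ D good Y.
  - by case: r {op er hm fa Kneg} r3 r0 r2 @Y memY => [|[|[|r]]].
  - move=> y /mapP[i]; rewrite mem_iota => hi ->.
    have hi' : (0 < i < r)%N by lia.
    by split; [exact: (proj2 (Bit i hp))|exact: Bnn (Bit i hp)|exact: fa].
  move: xY hx => /mapP[i]; rewrite mem_iota => hi -> hx.
  (* A root followed by another one of the list is not a source, since E(x, c^-1 x) = -q x < 0. For
     the last one, the source condition against c^-1 p reads E(p, c^-2 p) = -q p - K(p, c^-1 p) >=
     0. *)
  have [lt|eq_i] : (i.+1 < r)%N \/ i = r.-1 by lia.
    have mi : iter i.+1 coxinv p \in Y by apply: memY; lia.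
    by have := hx _ mi; rewrite iterS E_orbit1 (q_iter good); have := B_q hp; lra.
  have m1 : iter 1 coxinv p \in Y by apply: memY; lia.
  have := hx _ m1.
  have -> : iter 1 coxinv p = iter i coxinv (iter 2 coxinv p).
    by rewrite -iterD eq_i (_ : (r.-1 + 2 = 1 + r)%N) ?iterD ?er //; lia.
  by rewrite iter_coxinv_E E2; lra.
have K1' : K p (iter r.-1 coxinv p) = K p (coxinv p).
  rewrite -[LHS](iter_coxinv_K 1) -iterD Ksym (_ : (1 + r.-1 = r)%N) ?er //.
  by rewrite add1n prednK.
have [c c0 hS] := orbit_sum good gcox HP hp op.
have S0 : \sum_(i < r) K p (iter i coxinv p) = 0.
  by rewrite -K_sumr hS KZr (K_dlr good) mulr0.
(* Up to sign, the first row of the Gram matrix of a cycle. Both it and the actual row add up to 0,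
   and the latter is bounded above by the former with sign changed, so equality holds entry by
   entry. *)
pose h (i : 'I_r) := if (i == 0%N :> nat) then - (2 * q p) else if (i == 1%N :> nat) || (i == r.-1 :> nat)
   then q p else 0.
have hle (i : 'I_r) : K p (iter i coxinv p) <= - h i.
  rewrite /h; case: eqP => [->|/eqP i0]; first by rewrite opprK (K_q good).
  case: eqP => [->|/eqP i1] /=; first exact: K1.
  case: eqP => [->|_]; first by rewrite K1'.
  by rewrite oppr0; apply: Kneg; rewrite lt0n i0 ltn_ord.
have sh : \sum_i h i = 0.
  have r1 : (1 < r)%N by []. have rr : (r.-1 < r)%N by rewrite prednK.
  rewrite (bigD1 (Ordinal r0)) //= (bigD1 (Ordinal r1)) //= (bigD1 (Ordinal rr)) /=.
    rewrite big1 => [|i /andP[/andP[i0 i1] ir]].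
      by rewrite /h /= (_ : (r.-1 == 0)%N = false) ?eqxx ?orbT /=; [lra|lia].
    by rewrite /h; move: i0 i1 ir; rewrite -!val_eqE /= => /negbTE-> /negbTE-> /negbTE->.
  by rewrite -!val_eqE /=; apply/andP; split; lia.
have heq (i : 'I_r) : K p (iter i coxinv p) = - h i.
  have /eqP : \sum_i (- h i - K p (iter i coxinv p)) = 0.
    by rewrite sumrB S0 sumrN sh oppr0 subr0.
  rewrite psumr_eq0 => [/allP hh|j _]; last by rewrite subr_ge0.
  by have := hh i (mem_index_enum _); rewrite implyTb subr_eq0 => /eqP.
elim: k => [_|k IH kr]; first by rewrite /= subr0 mulr1.
rewrite E_orbit_step IH ?(ltnW kr) // (heq (Ordinal (ltnW kr))) /h /=.
case: k {IH} kr => [|[|k]] kr /=; [lra|lra|].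
by rewrite (_ : (k.+2 == r.-1)%N = false) /=; [lra|lia].
Qed.

Lemma period_iter p r k : period p r -> period (iter k coxinv p) r.
Proof.
move=> [r0 er hm]; split => //; first by rewrite -iterD addnC iterD er.
move=> m hmr; rewrite -iterD addnC iterD => /(iter_coxinv_inj good); exact: hm.
Qed.

(** Within an orbit, rotate b to the element with nonzero affine coordinate and use [E_orbit0]. For
    distinct orbits orthogonality makes E(b, -) constant along the orbit of b', and its sum over
    that orbit is a multiple of E(b, delta) = 0. *)
Lemma E_B b b' : B b -> B b' -> E b b' = q b * ((b' == b)%:R - (b' == coxinv b)%:R).
Proof.
move=> hb hb'; have [r ob] := period_exists good gcox HP hb; have [r0 er hm] := ob.
have r2 := period_ge2 good hb ob.
case: (classic (exists k, iter k coxinv b = b')) => [[k <-]|nex].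
  have [j [jr ja]] := special_exists (caff D) hb ob.
  have oj := period_iter j ob.
  have eqi m : (m < r)%N -> (iter (k %% r) coxinv b == iter m coxinv b) = ((k %% r)%N == m).
    move=> mr; apply/eqP/eqP => [|->//].
    by apply: (iter_period_inj good ob) => //; rewrite ltn_pmod.
  rewrite (iter_mod k ob) (eqi 0%N r0) (eqi 1%N r2).
  rewrite -(iter_coxinv_E j) -iterD addnC iterD (E_orbit0 (Bit j hb) oj ja) ?ltn_pmod //.
  by rewrite q_iter.
have out := K_conn_out good gcox HP hb ob (proj1 hb') (fun k h => nex (ex_intro _ k h)).
have [r' ob'] := period_exists good gcox HP hb'; have [r0' er' _] := ob'.
have Kb k : K b (iter k coxinv b') = 0.
  rewrite -[LHS](iter_coxinv_K (r' * k - k)) -iterD subnK ?leq_pmull //.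
  rewrite (iter_mod (r' * k) ob') modnMr /=; exact: out.
have Ek k : E b (iter k coxinv b') = E b b'.
  elim: k => [//|k IH]; rewrite iterS.
  by have := Kb k; rewrite (K_coxi good) eulBr IH; lra.
have [c c0 hS] := orbit_sum good gcox HP hb' ob'.
have Ebb : E b b' = 0.
  have /eqP : \sum_(i < r') E b (iter i coxinv b') = 0.
    by rewrite -eul_sumr hS eulZr (proj1 (inUE b) (BU hb)) mulr0.
  under eq_bigr do rewrite Ek.
  by rewrite sumr_const card_ord mulrn_eq0 -leqn0 leqNgt r0' /= => /eqP.
have -> : (b' == b) = false by apply/negP => /eqP h; apply: nex; exists 0%N.
have -> : (b' == coxinv b) = false by apply/negP => /eqP h; apply: nex; exists 1%N.
by rewrite Ebb subrr mulr0.
Qed.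

Definition seg p l : seq V := traject coxinv p l.
Definition asum p l : V := \sum_(b <- seg p l) b.

Lemma arcP p l b : reflect (exists2 i, (i < l)%N & b = iter i coxinv p) (b \in seg p l).
Proof. exact: trajectP. Qed.

Lemma asumE p l : asum p l = \sum_(i < l) iter i coxinv p.
Proof.
rewrite /asum /seg; elim: l => [|l IH]; first by rewrite big_nil big_ord0.
by rewrite trajectSr -cats1 big_cat big_seq1 IH big_ord_recr.
Qed.

(** Telescoping of [E_B]: only the start p and the element c^-l p just past the end survive. *)
Lemma E_asum p l b : B p -> B b ->
  E (asum p l) b = q p * ((b == p)%:R - (b == iter l coxinv p)%:R).
Proof.
move=> hp hb; rewrite asumE; elim: l => [|l IH].
  by rewrite big_ord0 eul0l subrr mulr0.
rewrite big_ord_recr /= eulDl IH E_B //; last exact: Bit.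
rewrite (q_iter good) -mulrDr; congr (_ * _).
by rewrite addrA subrK.
Qed.

Lemma arc_B p l b : B p -> b \in seg p l -> B b.
Proof. by move=> hp /arcP[i _ ->]; apply: Bit. Qed.

End Arcs.

(** * Arcs as the roots of Upsilon_c^re *)

Section ArcRoots.
Variables (n : nat) (D : cdata n) (gamma : 'rV[rat]_n) (P : 'rV[rat]_n -> Prop).
Local Notation V := 'rV[rat]_n.
Local Notation K := (K D).
Local Notation E := (eul D).
Local Notation dl := (delta D).
Local Notation q := (q D).
Local Notation lroot := (lroot D).
Local Notation cox := (cox D).
Local Notation coxinv := (coxinv D).
Local Notation U := (inU D gamma).
Local Notation trefl := (trefl D).
Local Notation conn := (conn D P).
Implicit Types (u v w x y z b p : V) (s t : rat).

Hypothesis good : good_data D.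
Hypothesis gaff : gamma ord0 (caff D) = 0.
Hypothesis gcox : cox gamma = gamma + dl.
Hypothesis HP : is_Pic D gamma P.
Local Notation dsym := (dsym good).
Local Notation a2 := (a_diag good).
Local Notation coxK := (coxK' good).
Local Notation coxinvK := (coxinvK' good).
Local Notation sa := (special_aff good).
Local Notation sU := (@subspace_U n D gamma).
Local Notation B := (B D P).
Local Notation period := (period D).
Local Notation Bci := (B_coxinv good gcox HP).
Local Notation Bc := (B_cox good gcox HP).
Local Notation Bit := (B_iter good gcox HP).
Local Notation Bnn := (B_nonneg HP).
Local Notation BU := (B_U HP).
Local Notation special_unique := (special_unique good gcox HP).
Local Notation special_exists := (special_exists good gcox HP).
Local Notation E_asum := (E_asum good gaff gcox HP).
Local Notation asum := (asum D).
Local Notation seg := (seg D).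
Local Notation conn_orbit := (conn_orbit good gaff gcox HP).
Local Notation Upsre := (Upsre D gamma).
Local Notation arc_B := (arc_B good gcox HP).

Lemma arc_map p l : seg p l = [seq iter i coxinv p | i <- iota 0 l].
Proof.
rewrite /seg; apply: (@eq_from_nth _ 0); rewrite size_traject ?size_map ?size_iota // => i il.
by rewrite (set_nth_default p) ?size_traject // nth_traject // (nth_map 0%N) ?size_iota // nth_iota.
Qed.

Lemma arc_uniq p l r : period p r -> (l <= r)%N -> uniq (seg p l).
Proof.
move=> op lr; rewrite arc_map map_inj_in_uniq ?iota_uniq // => i j.
rewrite !mem_iota !add0n /= => il jl; apply: (iter_period_inj good op);
  exact: leq_trans lr.
Qed.

Lemma mem_arc_iter p l r k : period p r -> (l <= r)%N -> (k < r)%N ->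
  (iter k coxinv p \in seg p l) = (k < l)%N.
Proof.
move=> op lr kr; apply/arcP/idP => [[i il e]|kl]; last by exists k.
by rewrite (iter_period_inj good op kr (leq_trans il lr) e).
Qed.

Lemma asum1 p : asum p 1 = p.
Proof. by rewrite /asum /= big_seq1. Qed.
Lemma asumS p l : asum p l.+1 = p + asum (coxinv p) l.
Proof. by rewrite /asum /= big_cons. Qed.
Lemma asumSr p l : asum p l.+1 = asum p l + iter l coxinv p.
Proof. by rewrite !asumE big_ord_recr. Qed.
Lemma coxinv_asum p l : coxinv (asum p l) = asum (coxinv p) l.
Proof.
by rewrite !asumE linear_sum; apply: eq_bigr => i _; rewrite -iterS iterSr.
Qed.
Lemma cox_asum p l : cox (asum p l) = asum (cox p) l.
Proof. by rewrite -{1}[p]coxK -coxinv_asum coxinvK. Qed.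

Lemma period_coxinv p r : period p r -> period (coxinv p) r.
Proof. exact: (period_iter good 1). Qed.
Lemma period_cox p r : period p r -> period (cox p) r.
Proof.
move=> op; have [r0 er _] := op; have := period_iter good r.-1 op.
suff -> : iter r.-1 coxinv p = cox p by [].
by rewrite -{2}er -{2}(prednK r0) iterS coxinvK.
Qed.

Lemma E_sum_asum p l (s : seq V) : B p -> (forall b, b \in s -> B b) -> uniq s ->
  E (asum p l) (\sum_(b <- s) b) = q p * ((p \in s)%:R - (iter l coxinv p \in s)%:R).
Proof.
move=> hp hs us; rewrite eul_sumr big_seq.
have cnt x : \sum_(b <- s) (b == x)%:R = (x \in s)%:R :> rat.
  elim: s us {hs} => [|y s IH] /=; first by rewrite big_nil.
  move=> /andP[ys us]; rewrite big_cons IH // inE eq_sym.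
  by case: eqVneq => [->|_] /=; rewrite ?(negbTE ys) ?addr0 ?add0r.
under eq_bigr => b bs do rewrite (E_asum _ hp (hs b bs)).
rewrite -big_seq -mulr_sumr; congr (_ * _).
by rewrite sumrB !cnt.
Qed.

Lemma E_asum2 p l p' l' r' : B p -> B p' -> period p' r' -> (l' <= r')%N ->
  E (asum p l) (asum p' l') = q p * ((p \in seg p' l')%:R - (iter l coxinv p \in seg p' l')%:R).
Proof.
move=> hp hp' op' lr; apply: E_sum_asum => //; last exact: arc_uniq op' lr.
by move=> b; apply: arc_B.
Qed.

(* The tube support of [x] is the proper arc [p, c^-1 p, ..., c^-(l-1) p] of the
   cycle of length [r] formed by the orbit of [p]. *)
Definition is_arc x p l r := [/\ B p, period p r, (0 < l < r)%N & x = asum p l].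

Lemma arc_q x p l r : is_arc x p l r -> q x = q p.
Proof.
case=> hp op /andP[l0 lr] ->; rewrite /q (E_asum2 _ hp hp op (ltnW lr)).
rewrite (mem_arc_iter op (ltnW lr) lr) ltnn -[p in p \in _]/(iter 0 coxinv p).
by rewrite (mem_arc_iter op (ltnW lr)) ?l0 ?subr0 ?mulr1 //; apply: ltn_trans lr.
Qed.

Lemma arc_lroot x p l r : is_arc x p l r -> lroot x.
Proof.
move=> hx; have qx := arc_q hx; have [hp op /andP[l0 lr] xE] := hx.
split=> [i||i]; rewrite ?qx ?(B_q hp) // xE asumE summxE.
  by rewrite rpred_sum // => j _; have [_ [h _ _]] := Bit j hp; apply: h.
rewrite 2!mulr_suml rpred_sum // => j _.
by have [_ [_ _ h]] := Bit j hp; have := h i; rewrite (q_iter good).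
Qed.

Lemma arc_U x p l r : is_arc x p l r -> U x.
Proof.
case=> hp _ _ ->; rewrite asumE; apply: (subspace_sum sU) => j _.
exact: BU (Bit j hp).
Qed.
Lemma arc_nonneg x p l r : is_arc x p l r -> nonneg x.
Proof.
by case=> hp _ _ ->; rewrite asumE; apply: nonneg_sum => j; apply: Bnn; apply: Bit.
Qed.

(** A full turn sums to a positive multiple of delta. *)
Lemma full_not_fin p r : B p -> period p r -> (asum p r) ord0 (caff D) <> 0.
Proof.
move=> hp op; have [c c0 hS] := orbit_sum good gcox HP hp op.
by rewrite asumE hS mxE => /eqP; rewrite gt_eqF // mulr_gt0 // dl_gt0.
Qed.

Lemma E_B_asum b p l r : B b -> B p -> period p r -> (l <= r)%N ->
  E b (asum p l) = q b * ((b \in seg p l)%:R - (coxinv b \in seg p l)%:R).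
Proof. by move=> hb hp op lr; rewrite -{1}[b]asum1 (E_asum2 1 hb hp op lr). Qed.

(** By [finU_ind]: a simple root with negative product against an arc is the successor of its end or
    the predecessor of its start, and the reflection lengthens the arc by it. The zero affine
    coordinate prevents the arc from closing up. *)
Lemma finU_arc x : lroot x -> nonneg x -> U x -> x ord0 (caff D) = 0 ->
  exists p l r, is_arc x p l r.
Proof.
move: x; apply: (finU_ind (Q := fun x => exists p l r, is_arc x p l r) good gcox HP)
  => [p hp pa|p y hp pa ry py uy ya [p' [l [r hy]]] K0].
  have [r op] := period_exists good gcox HP hp; exists p, 1%N, r.
  by split; rewrite ?asum1 //=; apply: (period_ge2 good hp op).
have [hp' op' /andP[l0 lr] yE] := hy; have [r0 er _] := op'.
have qp := B_q hp; have qp' := B_q hp'.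
have Kpy : K p y = q p * ((p \in seg p' l)%:R - (coxinv p \in seg p' l)%:R) +
    q p' * ((p == p')%:R - (p == iter l coxinv p')%:R).
  by rewrite (K_eul dsym a2) yE (E_B_asum hp hp' op' (ltnW lr)) (E_asum l hp' hp).
rewrite Kpy in K0.
have sl0 : p' \in seg p' l by rewrite -[p' in p' \in _]/(iter 0 coxinv p') (mem_arc_iter op' (ltnW lr)).
have sll : iter l coxinv p' \notin seg p' l by rewrite (mem_arc_iter op' (ltnW lr)) ?ltnn.
have pn : p \notin seg p' l.
  apply/negP => pin; move: K0; rewrite pin.
  have -> : (p == iter l coxinv p') = false by apply/negP => /eqP e; rewrite -e pin in sll.
  by case: (p == p'); case: (coxinv p \in _); rewrite /= ?subr0 ?subrr; lra.
have pp' : (p == p') = false by apply/negP => /eqP e; rewrite e sl0 in pn.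
have prev : coxinv p \in seg p' l -> coxinv p = p'.
  case/arcP=> [[//|i]] il; rewrite iterS => /(can_inj coxinvK) e.
  by move/negP: pn; case; apply/arcP; exists i => //; apply: ltnW.
case: (eqVneq p (iter l coxinv p')) => e.
  have lr1 : (l.+1 < r)%N.
    rewrite ltn_neqAle lr andbT; apply/eqP => h; apply: (full_not_fin hp' op').
    by rewrite -h asumSr mxE -yE -e ya pa addr0.
  exists p', l.+1, r; split => //; rewrite asumSr -yE -e.
  have cn : coxinv p \in seg p' l = false.
    by rewrite e -iterS (mem_arc_iter op' (ltnW lr) lr1) ltnNge leqnSn.
  rewrite /trefl Kpy pp' -e eqxx (negbTE pn) cn.
  rewrite (_ : _ / _ = -1) ?scaleN1r ?opprK //; last by rewrite e (q_iter good) /=; field; rewrite gt_eqF.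
move: K0; rewrite pp' (negbTE e) (negbTE pn) subrr mulr0 addr0 sub0r.
case: (boolP (coxinv p \in seg p' l)) => [/prev h _|_]; last by rewrite oppr0 mulr0 ltxx.
have op : period p r by rewrite -[p]coxinvK h; apply: period_cox.
have lr1 : (l.+1 < r)%N.
  rewrite ltn_neqAle lr andbT; apply/eqP => hh; apply: (full_not_fin hp op).
  by rewrite -hh asumS mxE h -yE ya pa addr0.
exists p, l.+1, r; split => //; rewrite asumS h -yE addrC.
rewrite /trefl Kpy pp' (negbTE e) (negbTE pn) h sl0.
by rewrite (_ : _ / _ = -1) ?scaleN1r ?opprK //=; field; rewrite gt_eqF.
Qed.

Lemma is_arc_coxinv x p l r : is_arc x p l r -> is_arc (coxinv x) (coxinv p) l r.
Proof.
case=> hp op lr ->; split => //; [exact: Bci|exact: period_coxinv|exact: coxinv_asum].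
Qed.
Lemma is_arc_cox x p l r : is_arc x p l r -> is_arc (cox x) (cox p) l r.
Proof.
case=> hp op lr ->; split => //; [exact: Bc|exact: period_cox|exact: cox_asum].
Qed.
Lemma is_arc_iter k x p l r : is_arc x p l r -> is_arc (iter k coxinv x) (iter k coxinv p) l r.
Proof. by move=> h; elim: k => //= k; apply: is_arc_coxinv. Qed.

Lemma is_arc_iterc k x p l r : is_arc x p l r -> is_arc (iter k cox x) (iter k cox p) l r.
Proof. by move=> h; elim: k => //= k; apply: is_arc_cox. Qed.

Lemma conn_iter p b r : B p -> period p r -> conn p b -> exists2 k, (k < r)%N & b = iter k coxinv p.
Proof.
move=> hp op /(conn_in_orbit good gcox HP)/(_ hp)[k <-].
have [r0 _ _] := op; exists (k %% r)%N; first by rewrite ltn_pmod.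
exact: iter_mod.
Qed.

(** Some iterate of a root of Upsilon_c^re is of finite type, hence an arc, and c rotates arcs.
    Conversely a proper arc can be rotated away from the unique simple root of its tube with nonzero
    affine coordinate. *)
Lemma UpsreP x : Upsre x <-> exists p l r, is_arc x p l r.
Proof.
split=> [[rx [px [ux [k [_ ka]]]]]|[p [l [r hx]]]].
  move: rx px ux ka => /(real_lroot good) rx /pos_nonneg px ux.
  case: k => m /= ka.
    have [||| p [l [r h]]] := finU_arc _ _ _ ka.
    - by apply: (iter_ind_pred (Q := lroot)) => // u; apply: lroot_cox.
    - have : lroot (iter m cox x) /\ nonneg (iter m cox x) /\ U (iter m cox x); last by case=> _ [].
      elim: m {ka} => [//|m [r1 [p1 u1]]] /=; split; first exact: lroot_cox.
      by split; [exact: (nonneg_cox good gcox r1 p1 u1)|rewrite inU_cox].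
    - by apply: (iter_ind_pred (Q := U)) => // u; rewrite inU_cox.
    exists (iter m coxinv p), l, r; rewrite -[x](iter_can m coxK); exact: is_arc_iter h.
  have [||| p [l [r h]]] := @finU_arc (iter m.+1 coxinv x) _ _ _ ka.
  - by apply: (iter_ind_pred (Q := lroot)) => // u; apply: lroot_coxinv.
  - have : lroot (iter m.+1 coxinv x) /\ nonneg (iter m.+1 coxinv x) /\ U (iter m.+1 coxinv x); last by case=> _ [].
    elim: m.+1 => [//|k [r1 [p1 u1]]] /=; split; first exact: lroot_coxinv.
    by split; [exact: (nonneg_coxinv good gcox r1 p1 u1)|rewrite inU_coxinv].
  - by apply: (iter_ind_pred (Q := U)) => // u; rewrite inU_coxinv.
  exists (iter m.+1 cox p), l, r; rewrite -[x](iter_can m.+1 coxinvK).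
  exact: is_arc_iterc h.
have rx := arc_lroot hx; have [hp op /andP[l0 lr] xE] := hx.
split; first exact: (lroot_real good).
split; first exact: nonneg_pos rx (arc_nonneg hx).
split; first exact: arc_U hx.
have [j [jr ja]] := special_exists (caff D) hp op.
(* The rotated arc occupies the indices j + r - l, ..., j + r - 1 and so stops just before j + r,
   which is j modulo r. Adding r keeps m positive, and [Negz m.-1] then encodes c^-m. *)
pose m := (j + r - l)%N; have m0 : (0 < m)%N by rewrite /m; lia.
have hm : iter m coxinv x = asum (iter m coxinv p) l.
  by have [_ _ _ ->] := is_arc_iter m hx.
exists (Negz m.-1); rewrite /coxz prednK // hm; split.
  by left; apply: (lroot_real good); rewrite -hm; exact: arc_lroot (is_arc_iter m hx).
have [_ er _] := op.
rewrite asumE summxE big1 // => i _; rewrite -iterD; apply/eqP/negPn/negP => h.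
have bj : iter (i + m) coxinv p = iter j coxinv p.
  apply: (special_unique sa _ _ h ja); first exact: Bit.
  exact: (conn_trans (conn_sym good (conn_orbit _ hp)) (conn_orbit _ hp)).
have : iter (i + r - l) coxinv p = p.
  apply: (iter_coxinv_inj good (k := j)); rewrite -iterD -bj; congr (iter _ _ _).
  by rewrite /m; lia.
rewrite (iter_mod _ op) => e; have il := ltn_ord i.
have [_ _ hper] := op; apply: (hper (i + r - l)%N); first lia.
by rewrite (iter_mod _ op).
Qed.

End ArcRoots.

(** * Compatibility degrees *)

Section Degrees.
Variables (n : nat) (D : cdata n) (gamma : 'rV[rat]_n) (P : 'rV[rat]_n -> Prop).
Local Notation V := 'rV[rat]_n.
Local Notation d := (cd D).
Local Notation E := (eul D).
Local Notation dl := (delta D).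
Local Notation q := (q D).
Local Notation lroot := (lroot D).
Local Notation cox := (cox D).
Local Notation coxinv := (coxinv D).
Local Notation conn := (conn D P).
Implicit Types (u v w x y z b p : V) (s t : rat).

Hypothesis good : good_data D.
Hypothesis gaff : gamma ord0 (caff D) = 0.
Hypothesis gcox : cox gamma = gamma + dl.
Hypothesis HP : is_Pic D gamma P.
Local Notation dsym := (dsym good).
Local Notation dpos := (dpos good).
Local Notation sa := (special_aff good).
Local Notation B := (B D P).
Local Notation period := (period D).
Local Notation special_unique := (special_unique good gcox HP).
Local Notation special_exists := (special_exists good gcox HP).
Local Notation E_asum := (E_asum good gaff gcox HP).
Local Notation asum := (asum D).
Local Notation seg := (seg D).
Local Notation conn_orbit := (conn_orbit good gaff gcox HP).
Local Notation arc_B := (arc_B good gcox HP).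
Local Notation is_arc := (is_arc D P).
Local Notation arc_lroot := (arc_lroot good gaff gcox HP).
Local Notation mem_arc_iter := (mem_arc_iter good).
Local Notation arc_uniq := (arc_uniq good).
Local Notation E_asum2 := (E_asum2 good gaff gcox HP).
Local Notation Supp := (Supp D P).
Local Notation comp_full := (comp_full D P).

Lemma conn_B p b : B p -> conn p b -> B b.
Proof. by move=> hp c; have [_ pb] := conn_P c; exact: (B_P good gcox HP hp pb). Qed.

Lemma E_asum_conn p p' l l' r' : B p -> B p' -> period p' r' -> (l' <= r')%N ->
  ~ conn p p' -> E (asum p l) (asum p' l') = 0.
Proof.
move=> hp hp' op' lr nc; rewrite (E_asum2 l hp hp' op' lr).
have out k : (iter k coxinv p \in seg p' l') = false.
  apply/negP => /arcP[i _ e]; apply: nc.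
  apply: conn_trans (conn_orbit k hp) _; rewrite e; apply: (conn_sym good); exact: conn_orbit.
by rewrite (out l) (out 0%N) subrr mulr0.
Qed.

(** [Supp] allows any expansion within the component of b, so its coefficients have to be recovered
    by a functional dual to b. *)
Lemma Supp_arc x p l r b : is_arc x p l r -> Supp x b <-> b \in seg p l.
Proof.
move=> hx; have [hp op /andP[l0 lr] xE] := hx.
have inseg y : y \in seg p l -> conn p y by case/arcP=> i _ ->; apply: conn_orbit.
split=> [[pb [s [f [us [hs [xs [bs fb]]]]]]]|bin]; last first.
  have [pb _] := arc_B hp bin.
  split => //; exists (seg p l), (fun=> 1); split; first exact: arc_uniq op (ltnW lr).
  split; first by move=> y /inseg; apply: conn_trans; apply: (conn_sym good); apply: inseg.
  split; last by split => //; rewrite oner_neq0.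
  by rewrite xE; apply: eq_bigr => y _; rewrite scale1r.
have hb : B b := B_P good gcox HP hp pb.
case: (classic (conn p b)) => [cpb|nc]; last first.
  exfalso; have := K_pos good (arc_lroot hx).
  rewrite {1}xE xs (K_not_conn good nc) ?ltxx //.
    rewrite /asum; apply: (subspace_sum (lspan_subspace _)) => y /inseg cy.
    by apply: lspan_in; left.
  apply: (subspace_sum (lspan_subspace _)) => y ys.
  by apply: (subspaceZ _ (lspan_subspace _)); apply: lspan_in; left; apply: hs.
have [rb ob] := period_exists good gcox HP hb.
have [j [jr ja]] := special_exists (caff D) hb ob.
pose b0 := iter j coxinv b; pose m := b0 ord0 (caff D).
(* On the simple roots of the component the first term is 1 at b and -1 at [b0], the only root with
   nonzero affine coordinate, and the second is 1 at [b0]; their sum is the indicator of b. *)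
pose phi (y : V) := E (asum b j) y / q b + y ord0 (caff D) / m.
have phiE y : conn b y -> phi y = (y == b)%:R.
  move=> cby; have hy := conn_B hb cby; rewrite /phi (E_asum j hb hy).
  rewrite [q b * _]mulrC mulfK; last by rewrite gt_eqF // (B_q hb).
  have -> : y ord0 (caff D) / m = (y == b0)%:R.
    case: eqP => [->|yb]; first by rewrite divff.
    apply/eqP; rewrite mulf_eq0; apply/orP; left; apply/negPn/negP => ya.
    apply: yb; apply: (special_unique sa hy _ ya ja).
    exact: conn_trans (conn_sym good cby) (conn_orbit j hb).
  by rewrite subrK.
have phi_sum (t : seq V) (g : V -> rat) : phi (\sum_(y <- t) g y *: y) = \sum_(y <- t) g y * phi y.
  rewrite /phi eul_sumr summxE !mulr_suml -big_split; apply: eq_bigr => z _.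
  by rewrite eulZr mxE /=; ring.
have : phi x = f b.
  rewrite xs phi_sum (bigD1_seq b) //= big_seq_cond big1 ?addr0.
    by rewrite phiE ?eqxx ?mulr1 //; constructor.
  by move=> y /andP[ys yb]; rewrite phiE ?(negbTE yb) ?mulr0 //; apply: hs.
apply: contraPT => nb; have -> : phi x = 0.
  rewrite xE /asum; have -> : \sum_(y <- seg p l) y = \sum_(y <- seg p l) (1 : rat) *: y.
    by apply: eq_bigr => y _; rewrite scale1r.
  rewrite phi_sum big_seq big1 // => y ys; rewrite phiE.
    by case: eqP => [yb|]; rewrite ?mulr0 // -yb ys in nb.
  by apply: conn_trans (conn_sym good cpb) (inseg _ ys).
by move=> h; rewrite -h eqxx in fb.
Qed.

Lemma asum_inj p l r p' l' r' : is_arc (asum p l) p l r -> is_arc (asum p' l') p' l' r' ->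
  asum p l = asum p' l' -> seg p l =i seg p' l'.
Proof.
move=> h h' e b; apply/idP/idP => [/(Supp_arc b h)|/(Supp_arc b h')].
  by rewrite e => /(Supp_arc b h').
by rewrite -e => /(Supp_arc b h).
Qed.

(** A proper arc omits the element following its end, so it never fills its component alone; the
    filled component must meet both supports. *)
Lemma comp_full_conn x p l r y p' l' r' : is_arc x p l r -> is_arc y p' l' r' ->
  comp_full x y -> conn p p'.
Proof.
move=> hx hy [p0 [pp0 hf]]; apply: NNPP => nc.
have [hp op /andP[l0 lr] xE] := hx; have [hp' op' /andP[l0' lr'] yE] := hy.
have h0 : B p0 := B_P good gcox HP hp pp0.
have inx b : Supp x b -> conn p b.
  by move/(Supp_arc b hx)/arcP=> [i _ ->]; apply: conn_orbit.
have iny b : Supp y b -> conn p' b.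
  by move/(Supp_arc b hy)/arcP=> [i _ ->]; apply: conn_orbit.
case: (hf p0 (conn_refl _ pp0)) => [/inx c|/iny c].
  have c1 := conn_trans (conn_sym good c) (conn_orbit l hp).
  case: (hf _ c1) => [/(Supp_arc _ hx)|/iny c']; first by rewrite (mem_arc_iter op (ltnW lr) lr) ltnn.
  by apply: nc; apply: conn_trans (conn_orbit l hp) (conn_sym good c').
have c1 := conn_trans (conn_sym good c) (conn_orbit l' hp').
case: (hf _ c1) => [/inx c'|/(Supp_arc _ hy)]; last by rewrite (mem_arc_iter op' (ltnW lr') lr') ltnn.
by apply: nc; apply: conn_trans c' (conn_sym good (conn_orbit l' hp')).
Qed.

Lemma comp_full_miss x p l r y p' l' r' b : is_arc x p l r -> is_arc y p' l' r' ->
  conn p b -> b \notin seg p l -> b \notin seg p' l' -> ~ comp_full x y.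
Proof.
move=> hx hy cb bx by_ hf; have c := comp_full_conn hx hy hf.
have [p0 [pp0 h]] := hf.
have c0 : conn p0 p.
  case: (h p0 (conn_refl _ pp0)) => [/(Supp_arc _ hx)|/(Supp_arc _ hy)] /arcP[i _ ->].
    by apply: (conn_sym good); apply: conn_orbit; case: hx.
  apply: conn_trans (conn_sym good c); apply: (conn_sym good); apply: conn_orbit; by case: hy.
by case: (h b (conn_trans c0 cb)) => [/(Supp_arc _ hx)|/(Supp_arc _ hy)]; apply/negP.
Qed.

(* The coordinates of [dl^vee] are [d_i dl_i / d_aff], so that in the degrees
   [dl] behaves as a root with [q dl = d_aff]. *)
Definition qs x : rat := if x == dl then d (caff D) else q x.

Lemma lroot_neq_dl x : lroot x -> (x == dl) = false.
Proof. by move=> rx; apply/negP => /eqP h; apply: (@lroot_dl n D good 1); rewrite scale1r -h. Qed.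

Lemma qs_lroot x : lroot x -> qs x = q x.
Proof. by move=> rx; rewrite /qs lroot_neq_dl. Qed.
Lemma qs_dl : qs dl = d (caff D). Proof. by rewrite /qs eqxx. Qed.

Definition lrootd x := lroot x \/ x = dl.

Lemma qs_gt0 x : lrootd x -> 0 < qs x.
Proof. by case=> [rx|->]; rewrite ?qs_dl ?dpos // qs_lroot //; case: rx. Qed.

(** The two cases of [corc] agree once delta is given the norm [qs]. *)
Lemma corcE x i : lrootd x -> corc D x i = x ord0 i * d i / qs x.
Proof.
case=> [rx|->]; last first.
  by rewrite /corc eqxx qs_dl (cdvlE good i sa) [d i * _]mulrC.
rewrite /corc lroot_neq_dl // (K_q good) qs_lroot //; field.
by case: rx => _ h _; rewrite gt_eqF.
Qed.

Lemma ppart_nonneg (t : rat) : 0 <= t -> ppart t = t.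
Proof. by move=> h; rewrite /ppart; apply/max_idPl. Qed.
Lemma ppart_nonpos (t : rat) : t <= 0 -> ppart t = 0.
Proof. by move=> h; rewrite /ppart; apply/max_idPr. Qed.

Lemma corc_ge0 x i : lrootd x -> nonneg x -> 0 <= corc D x i.
Proof. by move=> rx px; rewrite corcE // divr_ge0 ?mulr_ge0 ?(ltW (dpos _)) // ltW // qs_gt0. Qed.

Lemma deg_right_nn x y : lrootd x -> nonneg x -> nonneg y -> deg_right D x y = - (E x y / qs x).
Proof.
move=> rx px py; rewrite /deg_right -opprD; congr (- _).
rewrite /eul /bil mulr_suml -big_split; apply: eq_bigr => i _ /=.
rewrite (ppart_nonneg (corc_ge0 i rx px)) corcE // [in RHS](bigD1 i) //= mulrDl; congr (_ + _).
  by rewrite /ecoef eqxx; ring.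
rewrite mulr_suml big_mkcond [RHS]big_mkcond; apply: eq_bigr => j _ /=.
rewrite ppart_nonneg // /ecoef [i == j]eq_sym; case: (eqVneq j i) => [->|ji] /=.
  by rewrite ltnn.
by case: ifP => _; ring.
Qed.

Lemma deg_left_nn x y : lrootd x -> nonneg x -> nonneg y -> deg_left D x y = - (E y x / qs x).
Proof.
move=> rx px py; rewrite /deg_left -opprD; congr (- _).
rewrite /eul bilC /bil mulr_suml -big_split; apply: eq_bigr => i _ /=.
rewrite (ppart_nonneg (corc_ge0 i rx px)) corcE // [in RHS](bigD1 i) //= mulrDl; congr (_ + _).
  by rewrite /ecoef eqxx; ring.
rewrite mulr_suml big_mkcond [RHS]big_mkcond; apply: eq_bigr => j _ /=.
rewrite ppart_nonneg // /ecoef; case: (eqVneq j i) => [->|ji] /=.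
  by rewrite ltnn.
case: ifP => _; last by ring.
rewrite -[d j * _](dsym i j); ring.
Qed.

Lemma qs_negsr i : qs (- sr i) = d i.
Proof. by rewrite qs_lroot ?q_N ?q_sr //; apply: lroot_N; apply: lroot_sr. Qed.

Lemma corc_negsr i j : corc D (- sr i) j = - (j == i)%:R.
Proof.
rewrite corcE; last by left; apply: lroot_N; apply: lroot_sr.
rewrite qs_negsr mxE srE; case: eqP => [->|_]; last by rewrite oppr0 !mul0r.
by rewrite mulN1r mulNr divff // gt_eqF ?dpos.
Qed.

Lemma deg_negsr_l i y : deg_right D (- sr i) y = y ord0 i /\ deg_left D (- sr i) y = y ord0 i.
Proof.
rewrite /deg_right /deg_left; have -> : \sum_j corc D (- sr i) j * y ord0 j = - y ord0 i.
  rewrite (bigD1 i) //= big1 => [|j ji]; rewrite corc_negsr ?eqxx ?addr0 ?mulN1r //.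
  by rewrite (negbTE ji) oppr0 mul0r.
have z j : ppart (corc D (- sr i) j) = 0.
  by apply: ppart_nonpos; rewrite corc_negsr oppr_le0 ler0n.
rewrite !big1 ?opprK ?subr0 // => k _; apply: big1 => j _; by rewrite z mulr0 mul0r.
Qed.

Lemma deg_negsr_r i x : lrootd x ->
  deg_right D x (- sr i) = x ord0 i * d i / qs x /\ deg_left D x (- sr i) = x ord0 i * d i / qs x.
Proof.
move=> rx; rewrite /deg_right /deg_left.
have -> : \sum_j corc D x j * (- sr i : V) ord0 j = - corc D x i.
  rewrite (bigD1 i) //= big1 => [|j ji]; rewrite mxE srE ?eqxx ?addr0 ?mulrN1 //.
  by rewrite (negbTE ji) oppr0 mulr0.
have z j : ppart ((- sr i : V) ord0 j) = 0.
  by apply: ppart_nonpos; rewrite mxE srE oppr_le0 ler0n.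
by rewrite !big1 ?opprK ?subr0 ?corcE // => k _; apply: big1 => j _; rewrite z mulr0.
Qed.

End Degrees.

(** * Compatibility with tube roots and clusters containing delta *)

Section Clusters.
Variables (n : nat) (D : cdata n) (gamma : 'rV[rat]_n) (P : 'rV[rat]_n -> Prop).
Local Notation V := 'rV[rat]_n.
Local Notation d := (cd D).
Local Notation E := (eul D).
Local Notation dl := (delta D).
Local Notation q := (q D).
Local Notation lroot := (lroot D).
Local Notation cox := (cox D).
Local Notation coxinv := (coxinv D).
Local Notation U := (inU D gamma).
Local Notation conn := (conn D P).
Implicit Types (u v w x y z b p : V) (s t : rat).

Hypothesis good : good_data D.
Hypothesis gaff : gamma ord0 (caff D) = 0.
Hypothesis gcox : cox gamma = gamma + dl.
Hypothesis HP : is_Pic D gamma P.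
Local Notation dpos := (dpos good).
Local Notation inUE := (inUE good gcox).
Local Notation B := (B D P).
Local Notation period := (period D).
Local Notation Bci := (B_coxinv good gcox HP).
Local Notation asum := (asum D).
Local Notation seg := (seg D).
Local Notation conn_orbit := (conn_orbit good gaff gcox HP).
Local Notation Upsre := (Upsre D gamma).
Local Notation is_arc := (is_arc D P).
Local Notation UpsreP := (UpsreP good gaff gcox HP).
Local Notation arc_lroot := (arc_lroot good gaff gcox HP).
Local Notation arc_nonneg := (arc_nonneg good gcox HP).
Local Notation mem_arc_iter := (mem_arc_iter good).
Local Notation E_asum2 := (E_asum2 good gaff gcox HP).
Local Notation Supp := (Supp D P).
Local Notation comp_full := (comp_full D P).
Local Notation conn_B := (conn_B good gcox HP).
Local Notation E_asum_conn := (E_asum_conn good gaff gcox HP).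
Local Notation Supp_arc := (Supp_arc good gaff gcox HP).
Local Notation asum_inj := (asum_inj good gaff gcox HP).
Local Notation comp_full_miss := (comp_full_miss good gaff gcox HP).
Local Notation qs := (qs D).
Local Notation lrootd := (lrootd D).
Local Notation compatible := (compatible D gamma P).
Local Notation cdeg := (cdeg D gamma P).
Local Notation tube_case := (tube_case D gamma P).
Local Notation Phic := (Phic D gamma).
Local Notation is_cluster := (is_cluster D gamma P).

Lemma Upsre_lroot x : Upsre x -> [/\ lroot x, nonneg x & U x].
Proof. by case=> /(real_lroot good) rx [/pos_nonneg px [ux _]]. Qed.

Lemma PhicP x : Phic x -> [\/ exists i, x = - sr i, [/\ lroot x, nonneg x & E x dl != 0],
   Upsre x | x = dl].
Proof.
case=> [[i ->]|[[[rx px] nu]|[ux|->]]]; [by apply: Or41; exists i| |exact: Or43|exact: Or44].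
case: rx => [/(real_lroot good) rx|[m [_ xE]]].
  apply: Or42; split => //; first exact: pos_nonneg.
  by apply/eqP => h; apply: nu; apply/inUE.
by case: nu; rewrite xE; apply: inUZ; exact: (inU_dl good gcox).
Qed.

Lemma nonneg_dl : nonneg dl. Proof. by move=> i; apply: ltW; apply: dl_gt0. Qed.

Lemma Upsre_negsr i : ~ Upsre (- sr i).
Proof.
by move=> /Upsre_lroot[_ /(_ i)]; rewrite mxE srE eqxx oppr_ge0 ler10.
Qed.
Lemma Upsre_dl : ~ Upsre dl.
Proof. by move=> /Upsre_lroot[/(lroot_neq_dl good)]; rewrite eqxx. Qed.

Lemma tube_not_l x y : ~ Upsre x -> ~ tube_case x y. Proof. by move=> h []. Qed.
Lemma tube_not_r x y : ~ Upsre y -> ~ tube_case x y. Proof. by move=> h [_ []]. Qed.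
Lemma tube_not_full x y : ~ comp_full x y -> ~ tube_case x y. Proof. by move=> h [_ []]. Qed.

Lemma cdeg_max x y k : ~ tube_case x y -> cdeg x y k <-> k = Num.max (deg_right D x y) (deg_left D x y).
Proof. by move=> nt; split=> [[[]|[_]]//|->]; right. Qed.

Lemma cdeg_nn x y k : lrootd x -> nonneg x -> nonneg y -> ~ tube_case x y ->
  cdeg x y k <-> k = Num.max (- (E x y / qs x)) (- (E y x / qs x)).
Proof.
by move=> rx px py nt; rewrite cdeg_max // (deg_right_nn good) // (deg_left_nn good).
Qed.

Lemma compat_nn x y : lrootd x -> nonneg x -> nonneg y -> ~ tube_case x y ->
  compatible x y <-> Num.min (E x y) (E y x) = 0.
Proof.
move=> rx px py nt; rewrite /Defs.compatible cdeg_nn //.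
have q0 := qs_gt0 good rx; rewrite -!mulNr -maxr_pMl; last by rewrite invr_ge0 ltW.
rewrite -oppr_min mulNr; split=> [/esym/eqP|->]; last by rewrite mul0r oppr0.
by rewrite oppr_eq0 mulf_eq0 invr_eq0 (gt_eqF q0) orbF => /eqP.
Qed.

Lemma cdeg_negsr_l i y k : cdeg (- sr i) y k <-> k = y ord0 i.
Proof.
rewrite cdeg_max; last exact: tube_not_l (@Upsre_negsr i).
by have [-> ->] := deg_negsr_l good i y; rewrite maxxx.
Qed.

Lemma cdeg_negsr_r i x k : lrootd x -> cdeg x (- sr i) k <-> k = x ord0 i * d i / qs x.
Proof.
move=> rx; rewrite cdeg_max; last exact: tube_not_r (@Upsre_negsr i).
by have [-> ->] := deg_negsr_r good i rx; rewrite maxxx.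
Qed.

Lemma compat_negsr_l i y : compatible (- sr i) y <-> y ord0 i = 0.
Proof. by rewrite /Defs.compatible cdeg_negsr_l; split=> ->. Qed.

Lemma compat_negsr_r i x : lrootd x -> compatible x (- sr i) <-> x ord0 i = 0.
Proof.
move=> rx; rewrite /Defs.compatible cdeg_negsr_r //; split=> [/esym/eqP|->]; last by rewrite !mul0r.
by rewrite !mulf_eq0 invr_eq0 (gt_eqF (qs_gt0 good rx)) (gt_eqF (dpos i)) !orbF => /eqP.
Qed.

(** The element b is counted by [adj]: it enters the support of c^-1 x, is absent from that of x and
    present in that of y. *)
Lemma tube_incompat x p l r y b : is_arc x p l r -> tube_case x y -> Supp y b ->
  b \in seg (coxinv p) l -> b \notin seg p l -> ~ compatible x y.
Proof.
move=> hx tc sy bx nb; case=> [[_ [m [[t [ut [st ht]]] /esym/eqP]]]|[]//].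
rewrite pnatr_eq0 => /eqP m0; have t0 : t = [::] by apply: size0nil; rewrite st.
suff : b \in t by rewrite t0.
apply/ht; split => //; split.
  by right; have hx' := is_arc_coxinv good gcox HP hx; apply/(Supp_arc b hx').
by move/(Supp_arc b hx); apply/negP.
Qed.

Lemma conn_period p p' r : B p -> period p r -> conn p p' -> period p' r.
Proof.
move=> hp op c; have [k _ ->] := conn_iter good gcox HP hp op c; exact: period_iter.
Qed.

Lemma tube_Upsre x p l r y p' l' r' : is_arc x p l r -> is_arc y p' l' r' -> comp_full x y ->
  tube_case x y.
Proof.
move=> hx hy hf; split; first by apply/UpsreP; exists p, l, r.
by split => //; apply/UpsreP; exists p', l', r'.
Qed.

Lemma mem_seg0 p l r : period p r -> (0 < l <= r)%N -> p \in seg p l.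
Proof.
by move=> op /andP[l0 lr]; rewrite -[p in p \in _]/(iter 0 coxinv p) (mem_arc_iter op lr) //;
  apply: leq_trans lr.
Qed.

(** If the pair is component-full, [adj] counts b. Otherwise E(x, y) >= 0 forces y to contain the
    start p of x as well; being no longer than x, y reaches p and b only by passing through
    everything outside x, and the pair is component-full after all. *)
Lemma last_incompat x p l r y p' l' : is_arc x p l r -> is_arc y p' l' r ->
  (l' <= l)%N -> iter l coxinv p \in seg p' l' -> ~ compatible x y.
Proof.
move=> hx hy ll bin cmp; set b := iter l coxinv p in bin.
have [hp op /andP[l0 lr] xE] := hx; have [hp' op' /andP[l0' lr'] yE] := hy.
have nb : b \notin seg p l by rewrite (mem_arc_iter op (ltnW lr) lr) ltnn.
have sy : Supp y b by apply/(Supp_arc b hy).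
have bx : b \in seg (coxinv p) l.
  by apply/arcP; exists l.-1; rewrite ?prednK // -iterSr prednK.
case: (classic (comp_full x y)) => hf.
  exact: (tube_incompat hx (tube_Upsre hx hy hf) sy bx nb).
have rx : lrootd x by left; apply: arc_lroot hx.
move/(compat_nn rx (arc_nonneg hx) (arc_nonneg hy) (tube_not_full hf)): cmp => hmin.
have Exy : 0 <= E x y by rewrite -hmin ge_min lexx.
move: Exy; rewrite xE yE (E_asum2 l hp hp' op' (ltnW lr')) -/b bin.
case: (boolP (p \in seg p' l')) => [pin _|_]; last by rewrite sub0r mulrN1 oppr_ge0 leNgt (B_q hp).
case/arcP: (pin) => i il pE; case/arcP: (bin) => j jl bE.
have lij : iter (l + i) coxinv p' = iter j coxinv p' by rewrite iterD -pE -bE.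
case: (ltnP (l + i) r) => h.
  have := iter_period_inj good op' h (ltn_trans jl lr') lij; lia.
have jE : j = (l + i - r)%N.
  have er : iter r coxinv p' = p' by case: op'.
  apply: (iter_period_inj good op'); [lia|lia|].
  by rewrite -lij -{1}(subnK h) iterD er.
apply: hf; exists p; split; first by case: hp.
move=> z cz; have [m mr ->] := conn_iter good gcox HP hp op cz.
case: (ltnP m l) => ml; [left|right].
  by apply/(Supp_arc _ hx); rewrite (mem_arc_iter op (ltnW lr) mr).
apply/(Supp_arc _ hy); have er : iter r coxinv p' = p' by case: op'.
apply/arcP; exists (m + i - r)%N; first lia.
by rewrite pE -iterD -[in LHS](@subnK r (m + i)) ?iterD ?er //; lia.
Qed.

Lemma near_full_arc b r : B b -> period b r -> is_arc (asum (coxinv b) r.-1) (coxinv b) r.-1 r.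
Proof.
move=> hb ob; have r2 := period_ge2 good hb ob.
by split => //; [exact: Bci|exact: period_coxinv|lia].
Qed.

Lemma near_full_mem b r z : B b -> period b r -> conn b z ->
  (z \in seg (coxinv b) r.-1) = (z != b).
Proof.
move=> hb ob cz; have [r0 er _] := ob; have oc := period_coxinv good ob.
have cz' : conn (coxinv b) z.
  by apply: conn_trans cz; apply: (conn_sym good); apply: (conn_orbit 1 hb).
have [k kr ->] := conn_iter good gcox HP (Bci hb) oc cz'.
rewrite (mem_arc_iter oc _ kr) ?leq_pred //; have bE : b = iter r.-1 coxinv (coxinv b).
  by rewrite -iterSr prednK.
case: eqP => [|ne] /=.
  by rewrite {2}bE => /(iter_period_inj good oc kr) -> //; rewrite ?ltnn ?prednK.
rewrite ltn_neqAle; apply/andP; split; last by rewrite -ltnS prednK.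
by apply/eqP => h; apply: ne; rewrite {2}bE h.
Qed.

(** Both Euler products are nonnegative. E(x, y) is nonzero only if y contains c^-1 b, and E(y, x)
    only if y ends just before b; together these make y equal to x. *)
Lemma near_full_compat b r y p l r' : B b -> period b r -> is_arc y p l r' ->
  b \notin seg p l -> y <> asum (coxinv b) r.-1 ->
  compatible (asum (coxinv b) r.-1) y /\ compatible y (asum (coxinv b) r.-1).
Proof.
move=> hb ob hy nb ne; set x := asum _ _ in ne *.
have hx := near_full_arc hb ob; rewrite -/x in hx.
have [hp op /andP[l0 lr] yE] := hy; have [hc oc _ _] := hx.
have rx : lrootd x by left; apply: arc_lroot hx.
have ry : lrootd y by left; apply: arc_lroot hy.
have nbx : b \notin seg (coxinv b) r.-1.
  by rewrite near_full_mem ?eqxx //; constructor; case: hb.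
have cbc : conn (coxinv b) b by apply: (conn_sym good); apply: (conn_orbit 1 hb).
have c_cases : conn (coxinv b) p \/ ~ conn (coxinv b) p := classic _.
have nf : ~ comp_full x y by apply: (comp_full_miss hx hy cbc nbx nb).
have nf' : ~ comp_full y x.
  move=> h; have cp := comp_full_conn good gaff gcox HP hy hx h.
  exact: (comp_full_miss hy hx (conn_trans cp cbc) nb nbx h).
have [r0 er _] := ob.
suff h : Num.min (E x y) (E y x) = 0.
  split; apply/compat_nn => //; try exact: tube_not_full.
  - exact: arc_nonneg hx.
  - exact: arc_nonneg hy.
  - exact: arc_nonneg hy.
  - exact: arc_nonneg hx.
  - by rewrite minC.
case: c_cases => c; last first.
  have -> : E x y = 0 by rewrite yE (E_asum_conn _ hc hp op (ltnW lr) c).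
  have -> : E y x = 0; last by rewrite minxx.
  rewrite yE (E_asum_conn _ hp hc oc _ _) ?leq_pred //.
  by move=> c'; apply: c; apply: (conn_sym good).
have op' : period p r := conn_period hc oc c.
have rr : r' = r.
  have [h1 h2 h3] := op; have [k1 k2 k3] := op'.
  case: (ltngtP r' r) => // h; first by case: (k3 r'); rewrite ?h1.
  by case: (h3 r); rewrite ?k1.
rewrite rr in lr.
have Exy : E x y = q (coxinv b) * (coxinv b \in seg p l)%:R.
  rewrite yE (E_asum2 _ hc hp op' (ltnW lr)) -iterSr prednK // er.
  by rewrite (negbTE nb) subr0.
have pb : p != b.
  apply/eqP => pb; move: nb; rewrite -pb (mem_seg0 op') //; lia.
have cbp : conn b p by apply: conn_trans c; apply: (conn_orbit 1 hb).
have Eyx : E y x = q p * (iter l coxinv p == b)%:R.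
  rewrite {1}yE (E_asum2 _ hp hc oc (leq_pred r)) !near_full_mem //; last first.
    exact: conn_trans cbp (conn_orbit l hp).
  by rewrite pb; case: (iter l coxinv p == b); rewrite /= ?subr0 ?subrr.
case: (eqVneq (iter l coxinv p) b) Eyx => [lb|lb] Eyx; last first.
  rewrite Eyx mulr0 Exy; apply/min_idPr; by rewrite mulr_ge0 ?ler0n // ltW // (B_q hc).
case: (boolP (coxinv b \in seg p l)) Exy => [cin|_] Exy; last first.
  by rewrite Exy mulr0 Eyx; apply/min_idPl; rewrite mulr_ge0 ?ler0n // ltW // (B_q hp).
case: ne; case/arcP: cin => i il cE.
have e1 : iter l.+1 coxinv p = iter i coxinv p by rewrite iterS lb -cE.
have lr1 : l.+1 = r.
  case: (ltngtP l.+1 r) => h //; last lia.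
  have := iter_period_inj good op' h _ e1; lia.
have i0 : i = 0%N.
  have [_ er' _] := op'; apply: (iter_period_inj good op'); [lia|lia|].
  by rewrite -e1 lr1 er'.
by rewrite yE /x cE i0 /= -lr1.
Qed.

(** Outside U_c the numbers E(z, delta) and E(delta, z) are opposite and nonzero, so their minimum
    is negative; a negative simple root sees a positive coordinate of delta. *)
Lemma compat_dl_Upsre z : Phic z -> z <> dl -> compatible z dl -> Upsre z.
Proof.
move=> hz zd; case: (PhicP hz) => // [[i ->]|[rz pz ez]].
  by move=> /compat_negsr_l h; have := dl_gt0 good i; rewrite h ltxx.
have rz' : lrootd z by left.
move/(compat_nn rz' pz nonneg_dl (tube_not_r Upsre_dl)).
rewrite (E_dll good) => h; case/eqP: ez; move: h; case: (lerP (E z dl) (- E z dl)); lra.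
Qed.

Lemma E_U_dl x : U x -> E x dl = 0 /\ E dl x = 0.
Proof. by move=> /inUE h; rewrite (E_dll good) h oppr0. Qed.

Lemma compat_dl x : Upsre x -> compatible x dl /\ compatible dl x.
Proof.
move=> hx; have [rx px ux] := Upsre_lroot hx; have [e1 e2] := E_U_dl ux.
have rd : lrootd dl by right. have rx' : lrootd x by left.
split; apply/compat_nn => //; try exact: nonneg_dl; try (by rewrite e1 e2 minxx).
  exact: tube_not_r Upsre_dl.
exact: tube_not_l Upsre_dl.
Qed.

Lemma max_exists (Q : nat -> Prop) N : (exists l, Q l) -> (forall l, Q l -> (l < N)%N) ->
  exists l, Q l /\ forall l', Q l' -> (l' <= l)%N.
Proof.
move=> [l0 h0] hN; elim: N hN => [|N IH] hN; first by have := hN _ h0.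
case: (classic (Q N)) => hQ; first by exists N; split => // l' /hN.
apply: IH => l hl; have := hN l hl; rewrite ltnS leq_eqVlt => /orP[/eqP e|//].
by case: hQ; rewrite -e.
Qed.

Lemma cluster_add C x : is_cluster C -> Phic x ->
  (forall y, C y -> y <> x -> compatible x y /\ compatible y x) -> C x.
Proof.
move=> [hC [hp hm]] hx h; apply: (hm (fun y => C y \/ y = x)).
- by move=> y; left.
- by move=> y [/hC|->].
- move=> y z [Cy|->] [Cz|->] yz; [exact: hp| | |by case: yz].
  + by have [] := h y Cy yz.
  + by have [] := h z Cz (fun e => yz (esym e)).
- by right.
Qed.

(** The longest arc of [C] in the tube is followed by an element b that lies in no arc of [C], by
    [last_incompat]; if [C] has no arc there, any b will do. The arc missing only b is then
    compatible with all of [C] and belongs to it by maximality. *)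
Lemma near_full_exists C p r : is_cluster C -> C dl -> B p -> period p r ->
  exists2 b, conn p b & C (asum (coxinv b) r.-1).
Proof.
move=> hC Cd hp op.
have [b cb hb] : exists2 b, conn p b & forall y p' l' r', C y -> is_arc y p' l' r' -> b \notin seg p' l'.
  pose Q l := exists p', conn p p' /\ (0 < l < r)%N /\ C (asum p' l).
  case: (classic (exists l, Q l)) => hQ; last first.
    exists p; first by constructor; case: hp.
    move=> y p' l' r' Cy hy; apply/negP => pin; apply: hQ; have [hp' op' lr' yE] := hy.
    have cp : conn p' p by case/arcP: pin => i _ ->; apply: conn_orbit.
    exists l', p'; split; first exact: conn_sym.
    split; last by rewrite -yE.
    have opr := conn_period hp' op' cp.
    have -> // : r = r'.
    have [h1 h2 h3] := op; have [k1 k2 k3] := opr.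
    case: (ltngtP r' r) => // h; first by case: (h3 r'); rewrite ?k1.
    by case: (k3 r); rewrite ?h1.
  have [l [[p' [cp [lr Cx]]] hmax]] := @max_exists Q r hQ ltac:(by move=> l [? [_ [/andP[]]]]).
  have hp' := conn_B hp cp; have op' := conn_period hp op cp.
  have hx : is_arc (asum p' l) p' l r by [].
  exists (iter l coxinv p'); first exact: conn_trans cp (conn_orbit l hp').
  move=> y p'' l'' r'' Cy hy; apply/negP => bin; have [hp'' op'' lr'' yE] := hy.
  have cb : conn p'' (iter l coxinv p') by case/arcP: bin => i _ ->; apply: conn_orbit.
  have cp' : conn p p''.
    by apply: conn_trans (conn_sym good cb); apply: conn_trans cp (conn_orbit l hp').
  have opr := conn_period hp op cp'.
  have rr : r'' = r.
    have [h1 h2 h3] := op''; have [k1 k2 k3] := opr.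
    case: (ltngtP r'' r) => // h; first by case: (k3 r''); rewrite ?h1.
    by case: (h3 r); rewrite ?k1.
  rewrite rr in hy lr'' op''; have hle : (l'' <= l)%N.
    by apply: hmax; exists p''; split => //; split => //; rewrite -yE.
  apply: (last_incompat hx hy hle bin); case: hC => _ [hpair _]; apply: hpair => // e.
  have hy' : is_arc (asum p'' l'') p'' l'' r by rewrite -yE.
  have /(_ (iter l coxinv p')) := asum_inj hx hy' (etrans e yE).
  have /andP[_ lr'] := lr; rewrite bin (mem_arc_iter op' (ltnW lr') lr').
  by rewrite ltnn.
exists b => //; have hb' := conn_B hp cb; have ob := conn_period hp op cb.
have hx := near_full_arc hb' ob.
apply: (cluster_add hC); first by right; right; left; apply/UpsreP; do 3!eexists; exact: hx.
move=> y Cy yx; case: (classic (y = dl)) => [->|yd].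
  by have [] := compat_dl (proj2 (UpsreP _) (ex_intro _ _ (ex_intro _ _ (ex_intro _ _ hx)))).
have [p' [l' [r' hy]]] : exists p' l' r', is_arc y p' l' r'.
  by case: hC => hC [hpair _]; apply/UpsreP; apply: compat_dl_Upsre => //; [exact: hC|exact: hpair].
by apply: (near_full_compat hb' ob hy) => //; apply: hb Cy hy.
Qed.

End Clusters.

(** * Exchangeable roots have degree one *)

Section Norm.
Variables (n : nat) (D : cdata n) (gamma : 'rV[rat]_n) (P : 'rV[rat]_n -> Prop).
Local Notation V := 'rV[rat]_n.
Local Notation d := (cd D).
Local Notation K := (K D).
Local Notation E := (eul D).
Local Notation dl := (delta D).
Local Notation q := (q D).
Local Notation lroot := (lroot D).
Local Notation cox := (cox D).
Local Notation coxinv := (coxinv D).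
Local Notation U := (inU D gamma).
Local Notation conn := (conn D P).
Implicit Types (u v w x y z b p : V) (s t : rat).

Hypothesis good : good_data D.
Hypothesis gaff : gamma ord0 (caff D) = 0.
Hypothesis gcox : cox gamma = gamma + dl.
Hypothesis HP : is_Pic D gamma P.
Local Notation dpos := (dpos good).
Local Notation Ksym := (K_symm good).
Local Notation sa := (special_aff good).
Local Notation inUE := (inUE good gcox).
Local Notation sU := (@subspace_U n D gamma).
Local Notation B := (B D P).
Local Notation period := (period D).
Local Notation Bit := (B_iter good gcox HP).
Local Notation BU := (B_U HP).
Local Notation special_unique := (special_unique good gcox HP).
Local Notation special_exists := (special_exists good gcox HP).
Local Notation E_asum := (E_asum good gaff gcox HP).
Local Notation asum := (asum D).
Local Notation conn_orbit := (conn_orbit good gaff gcox HP).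
Local Notation conn_B := (conn_B good gcox HP).
Local Notation Pr := (proj D (enum 'I_n)).

Lemma mem_tl (T : eqType) (x y : T) (s : seq T) : y \in s -> y \in x :: s.
Proof. by move=> ys; rewrite inE ys orbT. Qed.

Lemma conn_cover : exists T : seq V, (forall p, p \in T -> B p) /\
  forall Q, subspace Q -> Q dl -> (forall p z, p \in T -> conn p z -> Q z) -> forall v, U v -> Q v.
Proof.
have [xs [hx hU _]] := tube_roots good gaff gcox.
have [T [hT hT']] : exists T : seq V, (forall p, p \in T -> B p) /\
    forall x, x \in xs -> exists2 p, p \in T & lspan (fun y => conn p y \/ y = dl) x.
  elim: xs hx {hU} => [|x xs IH] hx; first by exists [::].
  have [T [h1 h2]] := IH (fun y hy => hx y (mem_tl _ hy)).
  have [rx xa ux] := hx x (mem_head _ _).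
  have [p hp sp] : exists2 p, B p & lspan (fun y => conn p y \/ y = dl) x.
    case: (lroot_posneg good rx) => h; first exact: (finU_conn good gcox HP rx h ux xa).
    have [|p hp sp] := finU_conn good gcox HP (lroot_N rx) h (subspaceN sU ux).
      by rewrite mxE xa oppr0.
    by exists p => //; rewrite -[x]opprK; apply: (subspaceN (lspan_subspace _)).
  exists (p :: T); split=> [y|y]; rewrite inE => /orP[/eqP ->//|yT]; first exact: h1.
    by exists p; rewrite ?mem_head.
  by have [p' h3 h4] := h2 y yT; exists p'; rewrite // inE h3 orbT.
exists T; split => // Q sQ Qd hQ v uv; apply: (hU Q) => // x /hT'[p pT]; apply => //.
by move=> y [c|->] //; apply: hQ c.
Qed.

(* A cluster containing [dl] contains in each tube an arc missing a single
   simple root [b]; compatibility with these arcs forces this condition. *)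
Definition concentrated g := forall p, B p ->
  exists2 b, conn p b & forall z, conn p z -> z <> b -> E g z = 0.

(** Summing E(g, -) over the orbit gives c E(g, delta), and b carries the only nonzero term. *)
Lemma concentrated_val g p b c r : B p -> period p r -> conn p b ->
  (forall z, conn p z -> z <> b -> E g z = 0) ->
  \sum_(i < r) iter i coxinv p = c *: dl -> E g b = c * E g dl.
Proof.
move=> hp op cb h hS; rewrite -eulZr -hS eul_sumr.
have [k kr bE] := conn_iter good gcox HP hp op cb.
rewrite (bigD1 (Ordinal kr)) //= big1 ?addr0 -?bE // => i ik.
apply: h; first exact: conn_orbit.
by rewrite bE => /(iter_period_inj good op (ltn_ord i) kr) e; move/eqP: ik; apply; apply: val_inj.
Qed.

(** If g and h are concentrated at b and b', a multiple w of the arc from b to just before b'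
    reproduces E(g - h, -) on the component. Since w - c^-1 w is a multiple of b - b', the last
    clause reduces to E(g + h, b) = E(g + h, b'). *)
Lemma norm_component g h p : E g dl = 1 -> E h dl = 1 -> concentrated g -> concentrated h -> B p ->
  exists w, [/\ U w, forall z, conn p z -> E w z = E (g - h) z,
    forall z, B z -> ~ conn p z -> E w z = 0 & E (g + h) (w - coxinv w) = 0].
Proof.
move=> eg eh cg ch hp; have [r op] := period_exists good gcox HP hp.
have [c c0 hS] := orbit_sum good gcox HP hp op.
have [b cb hb] := cg p hp; have [b' cb' hb'] := ch p hp.
have gb := concentrated_val hp op cb hb hS; have hb'v := concentrated_val hp op cb' hb' hS.
rewrite eg mulr1 in gb; rewrite eh mulr1 in hb'v.
have Bb := conn_B hp cb; have ob := conn_period good gcox HP hp op cb.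
have [l lr b'E] := conn_iter good gcox HP Bb ob (conn_trans (conn_sym good cb) cb').
have qb := B_q Bb.
exists ((c / q b) *: asum b l); split.
- apply: inUZ; rewrite asumE; apply: (subspace_sum sU) => i _; exact: BU (Bit i Bb).
- move=> z cz; have Bz := conn_B hp cz; rewrite eulZl (E_asum l Bb Bz) -b'E mulrA divfK ?gt_eqF //.
  rewrite eulBl mulrBr; congr (_ - _).
    by case: eqP => [->|zb]; rewrite ?mulr1 ?gb // mulr0 hb.
  by case: eqP => [->|zb]; rewrite ?mulr1 ?hb'v // mulr0 hb'.
- move=> z Bz nc; rewrite eulZl (E_asum l Bb Bz) -b'E.
  have -> : (z == b) = false by apply/negP => /eqP e; apply: nc; rewrite e.
  have -> : (z == b') = false by apply/negP => /eqP e; apply: nc; rewrite e.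
  by rewrite subrr !mulr0.
- rewrite linearZ /= -scalerBr eulZr coxinv_asum.
  have -> : asum b l - asum (coxinv b) l = b - b'.
    have := asumS D b l; rewrite asumSr -b'E => e.
    by apply/eqP; rewrite subr_eq addrAC -subr_eq opprK e.
  rewrite eulBr !eulDl gb hb'v.
  case: (eqVneq b b') => [e|/eqP ne].
    by rewrite -e in hb'v *; rewrite hb'v gb subrr mulr0.
  by rewrite (hb' b cb ne) (hb b' cb' (fun e => ne (esym e))) addr0 add0r subrr mulr0.
Qed.

(** Sum the corrections w over the components. The vector y = w - (g - h) lies in U_c and E(y, -)
    vanishes on U_c, so y is isotropic and g - h agrees with w modulo delta. Then K(g + h, g - h) =
    E(g + h, w - c^-1 w) = 0. *)
Lemma concentrated_norm g h : E g dl = 1 -> E h dl = 1 -> concentrated g -> concentrated h ->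
  K g g = K h h.
Proof.
move=> eg eh cg ch; have [T [hT cov]] := conn_cover.
have [w [uw w1 w2 w3]] : exists w, [/\ U w,
    forall z, (exists2 p, p \in T & conn p z) -> E w z = E (g - h) z,
    forall z, B z -> ~ (exists2 p, p \in T & conn p z) -> E w z = 0 &
    E (g + h) (w - coxinv w) = 0].
  elim: T hT {cov} => [|p T IH] hT.
    exists 0; split=> [||z _ _|]; first by case: sU.
    - by move=> z [].
    - by rewrite eul0l.
    - by rewrite linear0 subrr eul0r.
  have [w [uw w1 w2 w3]] := IH (fun y hy => hT y (mem_tl _ hy)).
  have hp := hT p (mem_head _ _).
  (* [T] may meet a component more than once; its correction must be added only once. *)
  case: (classic (exists2 p', p' \in T & conn p' p)) => [[p' pT c]|np].
    exists w; split => // z.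
      case=> y; rewrite inE => /orP[/eqP ->|yT] cz; apply: w1; last by exists y.
      by exists p' => //; apply: conn_trans c cz.
    move=> hz nex; apply: w2 => // -[y yT cz]; apply: nex; exists y => //.
    by rewrite inE yT orbT.
  have [v [uv v1 v2 v3]] := norm_component eg eh cg ch hp.
  exists (w + v); split.
  - exact: inUD.
  - move=> z [y]; rewrite inE eulDl => /orP[/eqP ->|yT] cz.
      rewrite v1 // w2 ?add0r //; first exact: conn_B hp cz.
      by move=> [y' yT cz']; apply: np; exists y' => //; apply: conn_trans cz' (conn_sym good cz).
    rewrite w1; last by exists y.
    rewrite v2 ?addr0 //; first by apply: conn_B cz; apply: hT; rewrite inE yT orbT.
    by move=> c; apply: np; exists y => //; apply: conn_trans cz (conn_sym good c).
  - move=> z hz nex; rewrite eulDl w2 ?v2 ?addr0 //.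
      by move=> c; apply: nex; exists p => //; rewrite mem_head.
    by move=> [y yT c]; apply: nex; exists y => //; rewrite inE yT orbT.
  - by rewrite linearD opprD addrACA eulDr w3 v3 addr0.
pose y := w - (g - h).
have uy : U y.
  apply: (subspaceB sU) => //; apply/inUE; by rewrite eulBl eg eh subrr.
have Ey u : U u -> E y u = 0.
  apply: (cov (fun u => E y u = 0)); first exact: subspace_Er.
    by rewrite (proj1 (inUE y)).
  by move=> p z pT cz; rewrite eulBl w1 ?subrr //; exists p.
have Ky : K y y = 0.
  by rewrite (K_coxi good) Ey //; apply: (subspaceB sU) => //; rewrite inU_coxinv.
have yE := K_eq0 good (caff D) Ky; set t := _ / _ in yE.
have gh : g - h = w - t *: dl by rewrite -yE /y opprB addrCA subrr addr0.
have : K (g + h) (g - h) = 0.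
  rewrite gh KBr KZr (K_dlr good) mulr0 subr0 (K_coxi good); exact: w3.
by rewrite KDl !KBr (Ksym h g); lra.
Qed.

Lemma concentratedZ t g : concentrated g -> concentrated (t *: g).
Proof.
move=> h p hp; have [b cb hb] := h p hp; exists b => // z cz zb.
by rewrite eulZl hb // mulr0.
Qed.

Lemma concentrated_Pr e : special D e -> concentrated (Pr e).
Proof.
move=> se p hp; have [r op] := period_exists good gcox HP hp.
have [k [kr hk]] := special_exists e hp op.
exists (iter k coxinv p); first exact: conn_orbit.
move=> z cz zb; rewrite (E_Pr good); apply/eqP; rewrite mulf_eq0; apply/orP; right.
apply/negPn/negP => ze; apply: zb; apply: (special_unique se _ _ ze hk).
  exact: conn_B cz.
exact: conn_trans (conn_sym good cz) (conn_orbit k hp).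
Qed.

(** [concentrated_norm] compares g and P_aff, both scaled to E(-, delta) = 1; for P_aff both q and
    E(-, delta) equal d_aff. *)
Lemma concentrated_q g : E g dl != 0 -> concentrated g ->
  q g = (E g dl) ^+ 2 / d (caff D).
Proof.
move=> g0 cg; have sa' := sa; have da := dpos (caff D).
have eP : E (Pr (caff D)) dl = d (caff D) by rewrite (E_Pr good) dl_special ?mulr1.
have := @concentrated_norm ((E g dl)^-1 *: g) ((d (caff D))^-1 *: Pr (caff D)).
rewrite !eulZl eP (mulVf g0) (mulVf (lt0r_neq0 da)) => /(_ erefl erefl (concentratedZ _ cg)).
move=> /(_ (concentratedZ _ (concentrated_Pr sa'))).
rewrite !KZl !KZr !(K_q good) (q_Pr good) => h.
have : 2 * q g = (E g dl) ^+ 2 * ((d (caff D))^-1 * ((d (caff D))^-1 * (2 * d (caff D)))).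
  by rewrite -h; field.
move=> h2; have : 2 * q g = 2 * ((E g dl) ^+ 2 / d (caff D)).
  by rewrite h2; field; rewrite gt_eqF.
lra.
Qed.

(** Divided by d_aff, the first argument delta has the integral coordinates of delta^vee. *)
Lemma E_dl_int v : intvec v -> E v dl / d (caff D) \is a Num.int.
Proof.
move=> iv; rewrite -[E v dl]opprK -(E_dll good) mulNr rpredN.
rewrite /eul /bil mulr_suml rpred_sum // => i _.
rewrite mulr_suml rpred_sum // => j _; rewrite /ecoef.
set e := (if _ then _ else _).
rewrite (_ : _ / _ = (cdvl D i)%:R * (v ord0 j * e)).
  by rewrite rpredM ?natr_int // rpredM //; apply: ecase_int.
by rewrite (cdvlE good i sa) -/dl; field; rewrite gt_eqF ?dpos.
Qed.

Lemma concentrated_unit g : lroot g -> E g dl != 0 -> concentrated g ->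
  q g = d (caff D) /\ `|E g dl| = d (caff D).
Proof.
move=> rg g0 cg; have qE := concentrated_q g0 cg; have da := dpos (caff D).
(* M is an integer by [E_dl_int]. Its inverse is, up to sign, E(g, delta) / q g by the formula for q
   g, an integer because the coroot of g is integral. *)
pose M := `|E g dl| / d (caff D).
have M0 : 0 < M by rewrite divr_gt0 ?normr_gt0.
have iM : M \is a Num.int.
  have := E_dl_int (let: And3 h _ _ := rg in h); rewrite /M.
  by case: (ler0P (E g dl)) => _; rewrite // mulNr rpredN.
have iM' : M^-1 \is a Num.int.
  have := lroot_Er rg (dl_int D); rewrite qE => h.
  have : (E g dl)^-1 * d (caff D) \is a Num.int.
    by move: h; congr (_ \is a _); field; rewrite g0 gt_eqF.
  have -> : M^-1 = `|E g dl|^-1 * d (caff D) by rewrite /M invf_div mulrC.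
  by case: (ler0P (E g dl)) => _ // h'; rewrite invrN mulNr rpredN.
have M1 := int_unit M0 iM iM'.
have e : `|E g dl| = d (caff D) by rewrite -[LHS](divfK (lt0r_neq0 da)) -/M M1 mul1r.
by split => //; rewrite qE -real_normK ?num_real // e expr2 mulfK // gt_eqF.
Qed.

End Norm.

(** * Degrees with delta and the partners in an exchange *)

Section ExchangeDegree.
Variables (n : nat) (D : cdata n) (gamma : 'rV[rat]_n) (P : 'rV[rat]_n -> Prop).
Local Notation V := 'rV[rat]_n.
Local Notation d := (cd D).
Local Notation E := (eul D).
Local Notation dl := (delta D).
Local Notation q := (q D).
Local Notation lroot := (lroot D).
Local Notation cox := (cox D).
Local Notation coxinv := (coxinv D).
Local Notation conn := (conn D P).
Implicit Types (u v w x y z b p : V) (s t : rat).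

Hypothesis good : good_data D.
Hypothesis gaff : gamma ord0 (caff D) = 0.
Hypothesis gcox : cox gamma = gamma + dl.
Hypothesis HP : is_Pic D gamma P.
Local Notation dpos := (dpos good).
Local Notation coxK := (coxK' good).
Local Notation sa := (special_aff good).
Local Notation B := (B D P).
Local Notation period := (period D).
Local Notation Bci := (B_coxinv good gcox HP).
Local Notation Bc := (B_cox good gcox HP).
Local Notation Bit := (B_iter good gcox HP).
Local Notation Bnn := (B_nonneg HP).
Local Notation asum := (asum D).
Local Notation seg := (seg D).
Local Notation conn_orbit := (conn_orbit good gaff gcox HP).
Local Notation Upsre := (Upsre D gamma).
Local Notation arc_B := (arc_B good gcox HP).
Local Notation is_arc := (is_arc D P).
Local Notation arc_lroot := (arc_lroot good gaff gcox HP).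
Local Notation arc_nonneg := (arc_nonneg good gcox HP).
Local Notation conn_B := (conn_B good gcox HP).
Local Notation lrootd := (lrootd D).
Local Notation compatible := (compatible D gamma P).
Local Notation cdeg := (cdeg D gamma P).
Local Notation tube_case := (tube_case D gamma P).
Local Notation Phic := (Phic D gamma).
Local Notation PhicP := (PhicP good gcox).
Local Notation compat_nn := (compat_nn good).
Local Notation compat_negsr_l := (compat_negsr_l gamma P good).
Local Notation near_full_arc := (near_full_arc good gcox HP).
Local Notation near_full_mem := (near_full_mem good gaff gcox HP).
Local Notation near_full_exists := (near_full_exists good gaff gcox HP).
Local Notation compat_dl := (compat_dl P good gcox).
Local Notation Pr := (proj D (enum 'I_n)).
Local Notation In := (inj D (enum 'I_n)).
Local Notation lroot_Pr := (lroot_Pr good).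
Local Notation nonneg_dl := (nonneg_dl good).
Local Notation concentrated_unit := (concentrated_unit good gaff gcox HP).
Local Notation E_Pr := (E_Pr good).
Local Notation E_In := (E_In good).

Definition unit_deg al := cdeg al dl 1 /\ cdeg dl al 1.

Lemma specialP i : special D i <-> 1 = dl ord0 i /\ 1 = dl ord0 i * d i / d (caff D).
Proof.
rewrite [dl ord0 i * _]mulrC -(cdvlE good i sa) mxE; split=> [[-> ->]//|[/esym h1 /esym h2]].
by split; apply/eqP; rewrite -(eqr_nat rat) ?h1 ?h2.
Qed.

Lemma unit_deg_negsr i : unit_deg (- sr i) <-> special D i.
Proof.
rewrite /unit_deg (cdeg_negsr_l gamma P good) (cdeg_negsr_r gamma P good); last by right.
by rewrite qs_dl specialP.
Qed.

Lemma max_opp (x : rat) : Num.max (- x) x = `|x|.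
Proof. by case: (ler0P x) => h; case: (lerP (- x) x) => h'; lra. Qed.

Lemma cdeg_dl_r al k : lroot al -> nonneg al -> cdeg al dl k <-> k = `|E al dl| / q al.
Proof.
move=> ral pal; have q0 : 0 < q al by case: ral.
rewrite (cdeg_nn good); [|by left|exact: pal|exact: nonneg_dl|exact: tube_not_r (Upsre_dl good)].
rewrite (E_dll good) (qs_lroot good ral) mulNr opprK max_opp normrM [`|_^-1|]ger0_norm //.
by rewrite invr_ge0 ltW.
Qed.

Lemma cdeg_dl_l al k : lroot al -> nonneg al -> cdeg dl al k <-> k = `|E al dl| / d (caff D).
Proof.
move=> ral pal; have d0 := dpos (caff D).
rewrite (cdeg_nn good); [|by right|exact: nonneg_dl|exact: pal|exact: tube_not_l (Upsre_dl good)].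
rewrite (E_dll good) qs_dl mulNr opprK maxC max_opp normrM [`|_^-1|]ger0_norm //.
by rewrite invr_ge0 ltW.
Qed.

Lemma unit_deg_pos al : lroot al -> nonneg al ->
  unit_deg al <-> q al = d (caff D) /\ `|E al dl| = d (caff D).
Proof.
move=> ral pal; rewrite /unit_deg cdeg_dl_r // cdeg_dl_l //; have d0 := dpos (caff D).
have q0 : 0 < q al by case: ral.
split=> [[/esym h1 /esym h2]|[h1 h2]]; last by rewrite h1 h2 divff // gt_eqF.
have h3 : `|E al dl| = d (caff D) by rewrite -[LHS](divfK (lt0r_neq0 d0)) h2 mul1r.
by split => //; rewrite -h3 -[LHS]mul1r -h1 divfK // gt_eqF.
Qed.

(** E(g, -) has one sign on the simple roots of the tubes; a zero sum over all of them except b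
    makes every term vanish. *)
Lemma near_full_concentrated (g : V) (sg : rat) p b r : B p -> period p r -> conn p b ->
  (forall z, B z -> 0 <= sg * E g z) -> sg != 0 -> E g (asum (coxinv b) r.-1) = 0 ->
  forall z, conn p z -> z <> b -> E g z = 0.
Proof.
move=> hp op cb h s0 e z cz zb.
have hb := conn_B hp cb; have ob := conn_period good gcox HP hp op cb.
have cbz := conn_trans (conn_sym good cb) cz.
have zin : z \in seg (coxinv b) r.-1 by rewrite near_full_mem //; apply/eqP.
have /eqP : \sum_(y <- seg (coxinv b) r.-1) sg * E g y = 0.
  by rewrite -mulr_sumr -eul_sumr -/(asum _ _ _) e mulr0.
rewrite big_seq psumr_eq0 => [/allP hh|y yin]; last first.
  by apply: h; apply: (arc_B (Bci hb) yin).
by have := hh z zin; rewrite zin mulf_eq0 (negbTE s0) => /eqP.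
Qed.

(** By invariance this is E(P_i, c^-k z), a positive multiple of a coordinate of a positive root. *)
Lemma E_preproj k i z : B z -> 0 <= E (iter k cox (Pr i)) z.
Proof.
move=> hz; have -> : E (iter k cox (Pr i)) z = E (Pr i) (iter k coxinv z).
  rewrite -(iter_coxinv_E good k (iter k cox (Pr i))); congr (E _ _).
  by rewrite (iter_can k coxK).
rewrite E_Pr mulr_ge0 ?(ltW (dpos _)) //; exact: (Bnn (Bit k hz) i).
Qed.

Lemma E_preinj k i z : B z -> E (iter k coxinv (In i)) z <= 0.
Proof.
move=> hz; have [m ->] : exists m, E (iter k coxinv (In i)) z = - (d i * (iter m cox z) ord0 i).
  exists k.+1; have zE : z = iter k coxinv (iter k cox z) by rewrite (iter_can k coxK).
  rewrite {1}zE (iter_coxinv_E good) -[E (In i) _]opprK -(E_cox good) E_In.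
  by rewrite -iterS.
have hz' : B (iter m cox z) by apply: (iter_ind_pred (Q := B)) hz; exact: Bc.
rewrite oppr_le0 mulr_ge0 ?(ltW (dpos _)) //; exact: (Bnn hz' i).
Qed.

(** Both clusters contain the arcs provided by [near_full_exists], so al is compatible with them and
    is concentrated in every tube; [concentrated_unit] gives the two values. *)
Lemma exch_unit al be : Phic al -> be <> al -> exch_delta D gamma P al be -> unit_deg al.
Proof.
move=> hal nbe [C [C' [hC [hC' [Cd [C'al [C'be hx]]]]]]].
(* If al were delta, [C] would lie in [C'] and would contain be by maximality, while [C] without
   delta avoids be. *)
have ald : al <> dl.
  move=> e; have sub x : C x -> C' x.
    by move=> Cx; case: (classic (x = dl)) => [->|xd]; [rewrite -e|have [] := proj1 (hx x) (conj Cx xd)].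
  have Cbe : C be.
    case: hC => _ [_ hm]; apply: (hm C') => //; by case: hC' => ? [].
  by have [_ []] := proj1 (hx be) (conj Cbe (fun h => nbe (etrans h (esym e)))).
have CC' y : C y -> y <> dl -> C' y /\ y <> al.
  by move=> Cy yd; have [? []] := proj1 (hx y) (conj Cy yd).
have hp' : pairwise_compat D gamma P C' by case: hC' => _ [].
(* A tube root is compatible with delta, and al is compatible with the rest of [C]; maximality would
   put al into [C], which the exchange excludes. *)
have nU : ~ Upsre al.
  move=> ual; have Cal : C al.
    apply: (cluster_add hC hal) => y Cy yal; case: (classic (y = dl)) => [->|yd].
      exact: compat_dl.
    by have [C'y _] := CC' y Cy yd; split; apply: hp' => // /esym.
  by have [_] := CC' al Cal ald; apply.
have near p r : B p -> period p r -> exists b, [/\ conn p b,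
    compatible al (asum (coxinv b) r.-1) & is_arc (asum (coxinv b) r.-1) (coxinv b) r.-1 r].
  move=> hp op; have [b cb Cx] := near_full_exists hC Cd hp op; exists b.
  have ha := near_full_arc (conn_B hp cb) (conn_period good gcox HP hp op cb).
  split => //; have [|C'x xal] := CC' _ Cx.
    by move=> e; have := arc_lroot ha; move/(lroot_neq_dl good); rewrite e eqxx.
  by apply: hp' => // /esym.
have xB p b r : B p -> conn p b -> forall z, z \in seg (coxinv b) r -> B z.
  by move=> hp cb z; apply: (arc_B (Bci (conn_B hp cb))).
have da := dpos (caff D).
case: (PhicP hal) => [[i ali]|[ral pal eal]|//|//].
  (* Compatibility with -alpha_i means vanishing of the i-th coordinate, that is of E(P_i, -), so
     P_i takes the place of al. *)
  have [h1 h2] : q (Pr i) = d (caff D) /\ `|E (Pr i) dl| = d (caff D).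
    apply: concentrated_unit; [exact: lroot_Pr|by rewrite gt_eqF // E_Pr_dl|].
    move=> p hp; have [r op] := period_exists good gcox HP hp.
    have [b [cb cmp ha]] := near p r hp op; exists b => //.
    apply: (@near_full_concentrated _ 1 p b r) => //; last first.
      by move: cmp; rewrite ali => /compat_negsr_l; rewrite E_Pr => ->; rewrite mulr0.
    move=> z hz; rewrite mul1r E_Pr mulr_ge0 ?(ltW (dpos i)) //; exact: (Bnn hz i).
  rewrite (q_Pr good) in h1; rewrite ali; apply/unit_deg_negsr/specialP.
  have e1 : dl ord0 i = 1.
    have := h2; rewrite E_Pr ger0_norm ?h1; last by rewrite mulr_ge0 ?(ltW da) ?(ltW (dl_gt0 good i)).
    by move=> e; apply: (mulfI (lt0r_neq0 da)); rewrite e mulr1.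
  by rewrite e1 h1 mul1r divff ?gt_eqF.
apply/unit_deg_pos => //; apply: concentrated_unit => // p hp.
have [r op] := period_exists good gcox HP hp; have [b [cb cmp ha]] := near p r hp op.
have nt : ~ tube_case al (asum (coxinv b) r.-1) by apply: tube_not_l.
have ral' : lrootd al by left.
move/(compat_nn ral' pal (arc_nonneg ha) nt): cmp; set x := asum _ _ => hmin.
have m1 : 0 <= E al x by rewrite -hmin ge_min lexx.
have m2 : 0 <= E x al by rewrite -hmin ge_min lexx orbT.
(* In the preprojective case E(x, al) = -E(al, c^-1 x) is also nonpositive, hence 0, and the
   concentration is at c^-1 b. In the preinjective case E(al, x) is also nonpositive, hence 0, and
   it is at b. *)
case: (ltrgtP 0 (E al dl)) eal => [hal0|hal0|->] // _.
  have [k [i [alE _]]] := preprojective good gcox ral pal hal0.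
  exists (coxinv b); first exact: conn_trans cb (conn_orbit 1 (conn_B hp cb)).
  have cb' := conn_trans cb (conn_orbit 1 (conn_B hp cb)).
  apply: (@near_full_concentrated _ 1 p _ r) => //.
    by move=> z hz; rewrite mul1r alE; apply: E_preproj.
  rewrite -coxinv_asum -/x; apply/eqP; rewrite eq_le (E_coxinv good) oppr_le0 m2 /=.
  rewrite -(E_coxinv good) /x coxinv_asum eul_sumr big_seq sumr_ge0 // => z zin.
  by rewrite alE; apply: E_preproj; exact: xB hp cb' _ zin.
have [k [i [alE _]]] := preinjective good gcox ral pal hal0.
exists b => //; apply: (@near_full_concentrated _ (-1) p _ r) => //.
  by move=> z hz; rewrite mulN1r oppr_ge0 alE; apply: E_preinj.
apply/eqP; rewrite eq_le m1 andbT /x eul_sumr big_seq sumr_le0 // => z zin.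
by rewrite alE; apply: E_preinj; exact: xB hp cb _ zin.
Qed.

End ExchangeDegree.

(** * Exchanging a negative simple root with delta *)

Section ExchangeSpecial.
Variables (n : nat) (D : cdata n) (gamma : 'rV[rat]_n) (P : 'rV[rat]_n -> Prop).
Local Notation V := 'rV[rat]_n.
Local Notation d := (cd D).
Local Notation K := (K D).
Local Notation E := (eul D).
Local Notation dl := (delta D).
Local Notation lroot := (lroot D).
Local Notation cox := (cox D).
Local Notation coxinv := (coxinv D).
Local Notation U := (inU D gamma).
Local Notation conn := (conn D P).
Implicit Types (u v w x y z b p : V) (s t : rat).

Hypothesis good : good_data D.
Hypothesis gaff : gamma ord0 (caff D) = 0.
Hypothesis gcox : cox gamma = gamma + dl.
Hypothesis HP : is_Pic D gamma P.
Local Notation dpos := (dpos good).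
Local Notation coxK := (coxK' good).
Local Notation coxinvK := (coxinvK' good).
Local Notation inUE := (inUE good gcox).
Local Notation sU := (@subspace_U n D gamma).
Local Notation B := (B D P).
Local Notation period := (period D).
Local Notation Bci := (B_coxinv good gcox HP).
Local Notation Bnn := (B_nonneg HP).
Local Notation special_unique := (special_unique good gcox HP).
Local Notation special_exists := (special_exists good gcox HP).
Local Notation asum := (asum D).
Local Notation seg := (seg D).
Local Notation conn_orbit := (conn_orbit good gaff gcox HP).
Local Notation Upsre := (Upsre D gamma).
Local Notation arc_B := (arc_B good gcox HP).
Local Notation is_arc := (is_arc D P).
Local Notation UpsreP := (UpsreP good gaff gcox HP).
Local Notation arc_lroot := (arc_lroot good gaff gcox HP).
Local Notation arc_nonneg := (arc_nonneg good gcox HP).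
Local Notation mem_arc_iter := (mem_arc_iter good).
Local Notation E_asum2 := (E_asum2 good gaff gcox HP).
Local Notation Supp := (Supp D P).
Local Notation comp_full := (comp_full D P).
Local Notation conn_B := (conn_B good gcox HP).
Local Notation E_asum_conn := (E_asum_conn good gaff gcox HP).
Local Notation Supp_arc := (Supp_arc good gaff gcox HP).
Local Notation asum_inj := (asum_inj good gaff gcox HP).
Local Notation comp_full_miss := (comp_full_miss good gaff gcox HP).
Local Notation lrootd := (lrootd D).
Local Notation compatible := (compatible D gamma P).
Local Notation tube_case := (tube_case D gamma P).
Local Notation Phic := (Phic D gamma).
Local Notation is_cluster := (is_cluster D gamma P).
Local Notation PhicP := (PhicP good gcox).
Local Notation compat_nn := (compat_nn good).
Local Notation compat_negsr_l := (compat_negsr_l gamma P good).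
Local Notation compat_negsr_r := (compat_negsr_r gamma P good).
Local Notation near_full_arc := (near_full_arc good gcox HP).
Local Notation near_full_mem := (near_full_mem good gaff gcox HP).
Local Notation compat_dl := (compat_dl P good gcox).
Local Notation Pr := (proj D (enum 'I_n)).
Local Notation In := (inj D (enum 'I_n)).
Local Notation lroot_Pr := (lroot_Pr good).
Local Notation lroot_In := (lroot_In good).
Local Notation E_Pr := (E_Pr good).
Local Notation E_In := (E_In good).
Local Notation near_full_concentrated := (near_full_concentrated good gaff gcox HP).
Local Notation E_preproj := (E_preproj good gcox HP).
Local Notation E_preinj := (E_preinj good gcox HP).
Local Notation conn_period := (conn_period good gcox HP).

Lemma other_node j : exists i : 'I_n, i != j.
Proof.
apply: NNPP => nex; have only i : i = j.
  by apply/eqP/negPn/negP => h; apply: nex; exists i.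
have := Kcv_dl good j; rewrite /Kcv (bigD1 j) //= big1 => [|k]; last by rewrite (only k) eqxx.
rewrite addr0 (a_diag good) => /eqP; rewrite mulf_eq0 pnatr_eq0 /=.
by rewrite gt_eqF // dl_gt0.
Qed.

Lemma cover_B Q : subspace Q -> Q dl -> (forall z, B z -> Q z) -> forall v, U v -> Q v.
Proof.
move=> sQ Qd hQ; have [T [hT cov]] := conn_cover good gaff gcox HP.
by apply: cov => // p z pT cz; apply: hQ; apply: conn_B cz; apply: hT.
Qed.

(** After matching E(-, delta), the difference v lies in U_c and E(v, -) vanishes on all simple
    roots, hence on U_c; so v is isotropic and a multiple of delta. *)
Lemma concentrated_same g h : E g dl != 0 ->
  (forall p, B p -> exists2 b, conn p b & forall z, conn p z -> z <> b -> E g z = 0 /\ E h z = 0) ->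
  exists t, h = (E h dl / E g dl) *: g + t *: dl.
Proof.
move=> g0 cgh; pose s := E h dl / E g dl; pose v := h - s *: g.
have vd : E v dl = 0 by rewrite eulBl eulZl /s divfK // subrr.
have uv : U v by apply/inUE.
have vB z : B z -> E v z = 0.
  move=> hz; have [r oz] := period_exists good gcox HP hz.
  have [c c0 hS] := orbit_sum good gcox HP hz oz.
  have [b cb hb] := cgh z hz.
  have gb := concentrated_val good gaff gcox HP hz oz cb (fun y cy yb => proj1 (hb y cy yb)) hS.
  have hbv := concentrated_val good gaff gcox HP hz oz cb (fun y cy yb => proj2 (hb y cy yb)) hS.
  case: (eqVneq z b) => [->|/eqP zb]; last first.
    have cz : conn z z by constructor; case: hz.
    have [e1 e2] := hb z cz zb.
    by rewrite eulBl eulZl e1 e2 mulr0 subrr.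
  by rewrite eulBl eulZl gb hbv /s; field.
have vU u : U u -> E v u = 0.
  by apply: (@cover_B (fun u => E v u = 0)) => //; exact: subspace_Er.
have Kv : K v v = 0.
  by rewrite (K_coxi good) vU //; apply: (subspaceB sU) => //; rewrite inU_coxinv.
have vE := K_eq0 good (caff D) Kv; set t := _ / _ in vE.
by exists t; rewrite -vE /v addrCA subrr addr0.
Qed.

Section Node.
Variable j : 'I_n.
Hypothesis sj : special D j.

Definition fan x := exists b r l,
  [/\ B b, b ord0 j != 0, period b r, (0 < l < r)%N & x = asum (coxinv b) l].

Lemma fan_arc x : fan x -> exists b l r, [/\ B b, b ord0 j != 0, period b r,
  is_arc x (coxinv b) l r & b \notin seg (coxinv b) l].
Proof.
case=> b [r [l [hb bj ob /andP[l0 lr] xE]]]; exists b, l, r; split => //.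
  by split; [exact: Bci|exact: period_coxinv|rewrite l0|].
apply/negP => /arcP[i il bE]; have [r0 er hm] := ob.
by apply: (hm i.+1); [lia|rewrite iterSr].
Qed.

Lemma fan_coord x : fan x -> x ord0 j = 0.
Proof.
move=> /fan_arc[b [l [r [hb bj ob [_ _ _ xE] nb]]]].
rewrite xE /asum summxE big_seq big1 // => z zin; apply/eqP/negPn/negP => zj.
have hz := arc_B (Bci hb) zin.
have cz : conn z b.
  apply: (conn_sym good); case/arcP: zin => i _ ->; rewrite -iterSr; exact: conn_orbit.
by have e := special_unique sj hz cz zj bj; rewrite e in zin; rewrite zin in nb.
Qed.

Lemma fan_Upsre x : fan x -> Upsre x.
Proof. by move=> /fan_arc[b [l [r [_ _ _ h _]]]]; apply/UpsreP; do 3!eexists; exact: h. Qed.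

(** Two arcs of one tube are nested with a common start, so one Euler product is 0 and the other
    positive; both miss b, so the pair is not component-full. Different tubes are orthogonal for
    [E]. *)
Lemma fan_compat x y : fan x -> fan y -> x <> y -> compatible x y.
Proof.
move=> /fan_arc[b [l [r [hb bj ob hx nb]]]] /fan_arc[b' [l' [r' [hb' bj' ob' hy nb']]]] xy.
have [hp op /andP[l0 lr] xE] := hx; have [hp' op' /andP[l0' lr'] yE] := hy.
have rx : lrootd x by left; apply: arc_lroot hx.
case: (classic (conn b b')) => c; last first.
  have cp (u v : V) : B u -> B v -> conn (coxinv u) (coxinv v) -> conn u v.
    move=> hu hv cuv; apply: conn_trans (conn_orbit 1 hu) _; apply: conn_trans cuv _.
    exact: (conn_sym good (conn_orbit 1 hv)).
  apply/(compat_nn rx (arc_nonneg hx) (arc_nonneg hy)).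
    apply: tube_not_full => h; apply: c; apply: cp => //.
    exact: (comp_full_conn good gaff gcox HP hx hy h).
  rewrite xE yE (E_asum_conn _ hp hp' op' (ltnW lr')); last by move=> h; apply: c; apply: cp.
  rewrite (E_asum_conn _ hp' hp op (ltnW lr)) ?minxx //.
  by move=> h; apply: c; apply: (conn_sym good); apply: cp.
have e := special_unique sj hb c bj bj'; subst b'.
have rr : r' = r.
  have [h1 h2 h3] := ob; have [k1 k2 k3] := ob'.
  case: (ltngtP r' r) => // h; first by case: (h3 r'); rewrite ?k1.
  by case: (k3 r); rewrite ?h1.
subst r'.
have cb : conn (coxinv b) b by apply: (conn_sym good); apply: (conn_orbit 1 hb).
have nt : ~ tube_case x y.
  by apply: tube_not_full; exact: (comp_full_miss hx hy cb nb nb').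
apply/(compat_nn rx (arc_nonneg hx) (arc_nonneg hy) nt).
rewrite xE yE (E_asum2 l hp hp' op' (ltnW lr')) (E_asum2 l' hp' hp op (ltnW lr)).
rewrite !(mem_seg0 good op) ?l0 ?l0' ?(ltnW lr) ?(ltnW lr') //.
rewrite !(mem_arc_iter op) ?(ltnW lr) ?(ltnW lr') //.
have qb := B_q hp; case: (ltngtP l l') => h /=; last by rewrite -h -xE in yE; case: xy.
  by rewrite subrr mulr0 subr0 mulr1; apply/min_idPl; apply: ltW.
by rewrite subrr mulr0 subr0 mulr1; apply/min_idPr; apply: ltW.
Qed.

Lemma fan_near_full p : B p -> exists b r, [/\ conn p b, B b, b ord0 j != 0, period b r &
  fan (asum (coxinv b) r.-1)].
Proof.
move=> hp; have [r op] := period_exists good gcox HP hp.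
have [k [kr hk]] := special_exists j hp op.
have cb := conn_orbit k hp; have hb := conn_B hp cb; have ob := conn_period hp op cb.
exists (iter k coxinv p), r; split => //; exists (iter k coxinv p), r, r.-1; split => //.
by have := period_ge2 good hb ob; lia.
Qed.

(** If y contained b, the arc missing only b would be component-full with y and [adj] would count b.
    If y started later than c^-1 b, the arc z of the fan ending just before y would have E(z, y) < 0
    unless y contained c^-1 b, and then y would wrap around over b. *)
Lemma fan_max y : Upsre y -> (forall x, fan x -> x <> y -> compatible x y) -> fan y.
Proof.
move=> /UpsreP[p [l [r hy]]] hc; have [hp op /andP[l0 lr] yE] := hy.
have [b [r' [cb hb bj ob' hf]]] := fan_near_full hp; have ob := conn_period hp op cb.
have rr : r' = r.
  have [h1 h2 h3] := ob; have [k1 k2 k3] := ob'.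
  case: (ltngtP r' r) => // h; first by case: (h3 r'); rewrite ?k1.
  by case: (k3 r); rewrite ?h1.
subst r'; have hx := near_full_arc hb ob; set x := asum _ _ in hf hx.
have [hcb oc _ _] := hx; have [r0 er hm] := ob; have r2 := period_ge2 good hb ob.
have cbb : conn (coxinv b) b by apply: (conn_sym good); apply: (conn_orbit 1 hb).
have nbx : b \notin seg (coxinv b) r.-1 by rewrite near_full_mem ?eqxx //; constructor; case: hb.
have bE : b = iter r.-1 coxinv (coxinv b) by rewrite -iterSr prednK.
have nby : b \notin seg p l.
  apply/negP => bin; have sy : Supp y b by apply/(Supp_arc b hy).
  have xy : x <> y.
    move=> e; have hy' : is_arc (asum p l) p l r by rewrite -yE.
    have hx' : is_arc (asum (coxinv b) r.-1) (coxinv b) r.-1 r by [].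
    by have /(_ b) := asum_inj hx' hy' (etrans e yE); rewrite bin (negbTE nbx).
  have hf' : comp_full x y.
    exists b; split; first by case: hb.
    move=> z cz; case: (eqVneq z b) => [->|zb]; first by right.
    by left; apply/(Supp_arc z hx); rewrite near_full_mem.
  apply: (tube_incompat good gaff gcox HP hx (tube_Upsre good gaff gcox HP hx hy hf') sy _ nbx).
    apply/arcP; exists r.-2; first lia.
    by rewrite -!iterSr (_ : r.-2.+2 = r)%N ?er //; lia.
  exact: hc.
have cbp : conn (coxinv b) p by apply: conn_trans cbb (conn_sym good cb).
have [i ir pE] := conn_iter good gcox HP hcb oc cbp.
case: (posnP i) => [i0|i0].
  by exists b, r, l; split => //; [rewrite l0|rewrite yE pE i0].
have pin : p \in seg p l by apply: (mem_seg0 good op); rewrite l0 ltnW.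
have ir1 : (i < r.-1)%N.
  rewrite ltn_neqAle -ltnS prednK // ir andbT; apply/eqP => h.
  by rewrite pE h -bE in pin; rewrite pE h -bE pin in nby.
pose z := asum (coxinv b) i; have fz : fan z.
  by exists b, r, i; split => //; rewrite i0.
have hz : is_arc z (coxinv b) i r by split => //; rewrite i0.
have npz : p \notin seg (coxinv b) i by rewrite pE (mem_arc_iter oc (ltnW ir) ir) ltnn.
have zy : z <> y.
  move=> e; have hy' : is_arc (asum p l) p l r by rewrite -yE.
  by have /(_ p) := asum_inj hz hy' (etrans e yE); rewrite pin (negbTE npz).
have rz : lrootd z by left; apply: arc_lroot hz.
have nbz : b \notin seg (coxinv b) i.
  by rewrite {1}bE (mem_arc_iter oc (ltnW ir)) ?prednK //; lia.
have nt : ~ tube_case z y by apply: tube_not_full; exact: (comp_full_miss hz hy cbb nbz nby).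
move/(compat_nn rz (arc_nonneg hz) (arc_nonneg hy) nt): (hc z fz zy) => hmin.
have : 0 <= E z y by rewrite -hmin ge_min lexx.
rewrite yE /z (E_asum2 i hcb hp op (ltnW lr)) -pE pin.
case: (boolP (coxinv b \in seg p l)) => [|_]; last first.
  by rewrite sub0r mulrN1 oppr_ge0 leNgt (B_q hcb).
case/arcP=> m ml cE; exfalso; have m0 : (0 < m)%N.
  case: m ml cE => // _ /= cE; have [_ _ hc'] := oc.
  by exfalso; apply: (hc' i); [lia|rewrite -pE cE].
have e1 : iter (i + m) coxinv p = p by rewrite iterD -cE -pE.
have im : (i + m = r)%N.
  have [_ erp hmp] := op; case: (ltngtP (i + m) r) => // h.
    by case: (hmp (i + m)%N) => //; lia.
  case: (hmp (i + m - r)%N) => //; first lia.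
  by rewrite -[in RHS]e1 -{2}(@subnK r (i + m)) ?iterD ?erp //; lia.
move/negP: nby; apply; apply/arcP; exists m.-1; first lia.
by apply: (can_inj coxinvK); rewrite cE -iterS prednK.
Qed.

Local Notation al0 := (- sr j : V).

Lemma Phic_negsr i : Phic (- sr i). Proof. by left; exists i. Qed.

Lemma fan_dl_cluster : is_cluster (fun x => fan x \/ x = dl).
Proof.
split; first by move=> x [/fan_Upsre|->]; [right; right; left|right; right; right].
split=> [x y [fx|->] [fy|->] xy|C' sub hP' hc' x C'x].
- exact: fan_compat.
- by have [] := compat_dl (fan_Upsre fx).
- by have [] := compat_dl (fan_Upsre fy).
- by case: xy.
case: (classic (x = dl)) => [->|xd]; [by right|left].
have ux : Upsre x.
  apply: (compat_dl_Upsre good gcox (hP' x C'x) xd); apply: hc' => //.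
  by apply: sub; right.
apply: fan_max ux _ => y fy yx; apply: hc' => //; by apply: sub; left.
Qed.

(** What a partner [rho] of -alpha_j must satisfy: it fits the fan, it excludes the other negative
    simple roots, and it is the only root outside U_c that completes the fan and -alpha_j. [rho] is
    left open because its choice depends on the position of j. *)
Lemma exch_build rho : lroot rho -> nonneg rho -> rho ord0 j = 0 -> E rho dl != 0 ->
  (forall x, fan x -> Num.min (E rho x) (E x rho) = 0) ->
  (forall i, i != j -> (forall x, fan x -> x ord0 i = 0) -> rho ord0 i <> 0) ->
  (forall y, lroot y -> nonneg y -> E y dl != 0 -> y ord0 j = 0 ->
     (forall x, fan x -> Num.min (E y x) (E x y) = 0) -> Num.min (E y rho) (E rho y) = 0 -> y = rho) ->
  exists be, Phic be /\ be <> al0 /\ exch_delta D gamma P al0 be.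
Proof.
move=> rr pr rj er hf hneg hpos.
have rd : lrootd rho by left.
have rdl : rho <> dl by move=> h; have := lroot_neq_dl good rr; rewrite h eqxx.
have nU : ~ Upsre rho.
  by move=> /(Upsre_lroot good)[_ _ /inUE h]; rewrite h eqxx in er.
have Pr_ : Phic rho.
  right; left; split; last by move/inUE => h; rewrite h eqxx in er.
  by split; [left; exact: (lroot_real good rr)|exact: (nonneg_pos rr pr)].
have ra : rho <> al0.
  by move=> h; have := pr j; rewrite h mxE srE eqxx oppr_ge0 ler10.
exists rho; split => //; split => //.
exists (fun x => fan x \/ x = dl), (fun x => [\/ fan x, x = al0 | x = rho]).
have fan_l x : fan x -> lrootd x /\ nonneg x.
  by move=> /fan_Upsre/(Upsre_lroot good)[? ? _]; split => //; left.
split; first exact: fan_dl_cluster.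
split; last first.
  split; first by right.
  split; first exact: Or32.
  split; first exact: Or33.
  have ne x : fan x -> [/\ x <> dl, x <> al0 & x <> rho].
    move=> fx; have ux := fan_Upsre fx; split => e; rewrite e in ux.
    - exact: (Upsre_dl good ux).
    - exact: (Upsre_negsr good ux).
    - exact: nU.
  move=> x; split=> [[[fx|e] xd]|[[fx|e|e] [xa xr]]] //.
    by have [_ h1 h2] := ne x fx; split => //; apply: Or31.
  by have [h1 _ _] := ne x fx; split => //; left.
have c1 x : fan x -> compatible al0 x /\ compatible x al0.
  move=> fx; have [lx px] := fan_l x fx; split.
    by apply/compat_negsr_l; exact: fan_coord.
  by apply/compat_negsr_r => //; exact: fan_coord.
have c2 x : fan x -> compatible rho x /\ compatible x rho.
  move=> fx; have [lx px] := fan_l x fx; have h := hf x fx; split; apply/compat_nn => //.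
  - exact: tube_not_l.
  - exact: tube_not_r.
  - by rewrite minC.
have c3 : compatible al0 rho /\ compatible rho al0.
  by split; [apply/compat_negsr_l|apply/compat_negsr_r].
split; first by move=> x [/fan_Upsre|->|->] //; [right; right; left|exact: Phic_negsr].
split=> [x y [fx|->|->] [fy|->|->] xy|C' sub hP' hc' y C'y].
- exact: fan_compat.
- by have [] := c1 x fx.
- by have [] := c2 x fx.
- by have [] := c1 y fy.
- by case: xy.
- by have [] := c3.
- by have [] := c2 y fy.
- by have [] := c3.
- by case: xy.
case: (classic (y = al0)) => [->|ya]; first exact: Or32.
case: (classic (y = rho)) => [->|yr]; first exact: Or33.
have ca : compatible al0 y by apply: hc' => //; [apply: sub; apply: Or32|move=> /esym].
have cr : compatible y rho by apply: hc' => //; apply: sub; apply: Or33.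
have cf x : fan x -> x <> y -> compatible x y /\ compatible y x.
  move=> fx xy; have C'x : C' x by apply: sub; apply: Or31.
  by split; apply: hc' => // /esym.
move/compat_negsr_l: ca => yj.
case: (PhicP (hP' y C'y)) => [[i yi]|[ry py ey]|uy|yd].
- have ij : i != j by apply/eqP => e; apply: ya; rewrite yi e.
  exfalso; apply: (hneg i ij) => [x fx|].
    have xy : x <> y.
      by move=> e; have := fan_Upsre fx; rewrite e yi; exact: (Upsre_negsr good).
    by have [_] := cf x fx xy; rewrite yi => /compat_negsr_l.
  by move: cr; rewrite yi => /compat_negsr_l.
- have ly : lrootd y by left.
  have nUy : ~ Upsre y by move=> /(Upsre_lroot good)[_ _ /inUE h]; rewrite h eqxx in ey.
  exfalso; apply: yr; apply: hpos => // [x fx|].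
    have xy : x <> y by move=> e; apply: nUy; rewrite -e; exact: fan_Upsre.
    have [lx px] := fan_l x fx; have [_] := cf x fx xy.
    by move/(compat_nn ly py px (tube_not_l nUy)).
  by move/(compat_nn ly py pr (tube_not_l nUy)): cr.
- by apply: Or31; apply: fan_max => // x fx xy; have [] := cf x fx xy.
- by have := dl_gt0 good j; rewrite -yd yj ltxx.
Qed.

Lemma fan_concentrated g sg : (forall z, B z -> 0 <= sg * E g z) -> sg != 0 ->
  (forall x, fan x -> E g x = 0) -> forall p, B p -> exists b, [/\ conn p b, b ord0 j != 0, B b &
    forall z, conn p z -> z <> b -> E g z = 0].
Proof.
move=> h s0 hx p hp; have [b [r [cb hb bj ob fb]]] := fan_near_full hp.
exists b; split => //; apply: (near_full_concentrated hp (conn_period hb ob (conn_sym good cb)) cb h s0).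
exact: hx.
Qed.

Lemma Pr_conc p b : B p -> conn p b -> b ord0 j != 0 -> forall z, conn p z -> z <> b -> E (Pr j) z = 0.
Proof.
move=> hp cb bj z cz zb; rewrite E_Pr; apply/eqP; rewrite mulf_eq0; apply/orP; right.
apply/negPn/negP => zj; apply: zb; apply: (special_unique sj _ _ zj bj).
  exact: conn_B cz.
exact: conn_trans (conn_sym good cz) cb.
Qed.

Lemma E_Prj_dl : E (Pr j) dl = d j.
Proof. by rewrite E_Pr (dl_special sj) mulr1. Qed.
Lemma E_Inj_dl : E (In j) dl = - d j.
Proof. by rewrite -[LHS]opprK -(E_dll good) E_In (dl_special sj) mulr1. Qed.

Lemma lroot_dl_sub g : lroot g -> g ord0 j = 1 -> lroot (dl - g).
Proof.
by move=> rg g1; rewrite -opprB; apply: lroot_N; have := lroot_proj good sj rg; rewrite g1 scale1r.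
Qed.

(** In the preprojective case c y, in the preinjective case y itself, is concentrated at the same
    simple roots as P_j, hence proportional to it modulo delta. The condition y_j = 0 makes y a
    positive multiple of delta - I_j or delta - P_j, and proportional roots coincide. *)
Lemma fan_completion y : lroot y -> nonneg y -> E y dl != 0 -> y ord0 j = 0 ->
  (forall x, fan x -> Num.min (E y x) (E x y) = 0) -> y = dl - In j \/ y = dl - Pr j.
Proof.
move=> ry py ey yj hm.
have fin_step g s t : lroot g -> g ord0 j = 1 -> y = s *: g + t *: dl -> s < 0 -> y = dl - g.
  move=> rg gj yE s0; have ts : t = - s.
    by have := yj; rewrite yE 3!mxE (dl_special sj) gj !mulr1 => h; lra.
  have {}yE : y = (- s) *: (dl - g).
    by rewrite yE ts scalerBr scaleNr [RHS]addrC scaleNr opprK.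
  have s1 : - s = 1.
    by apply: (lroot_prop good _ (lroot_dl_sub rg gj)); rewrite ?oppr_gt0 // -yE.
  by rewrite yE s1 scale1r.
have [hy|hy] : 0 < E y dl \/ E y dl < 0.
  by move: ey; rewrite neq_lt => /orP[]; auto.
- left; have [k [i [yE _]]] := preprojective good gcox ry py hy.
  have y0 z : B z -> 0 <= 1 * E (cox y) z.
    by move=> hz; rewrite mul1r yE -iterS; apply: E_preproj.
  have yx x : fan x -> E (cox y) x = 0.
    move=> fx; have m2 : 0 <= E x y by rewrite -(hm x fx) ge_min lexx orbT.
    rewrite (E_cox good); apply/eqP; rewrite eq_le oppr_le0 m2 /=.
    rewrite -(E_cox good); have [b [l [r [hb _ ob [hcb _ _ xE] _]]]] := fan_arc fx.
    rewrite xE eul_sumr big_seq sumr_ge0 // => z zin.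
    by rewrite -[E _ _]mul1r; apply: y0; exact: arc_B hcb zin.
  have cy := fan_concentrated y0 (oner_neq0 _) yx.
  have [|p hp|t cyE] := @concentrated_same (Pr j) (cox y).
  - by rewrite E_Prj_dl gt_eqF ?dpos.
  - have [b [cb bj hb hz]] := cy p hp; exists b => // z cz zb.
    by split; [exact: (Pr_conc hp cb bj cz zb)|exact: hz].
  have {}cyE : y = (- (E y dl / d j)) *: In j + t *: dl.
    rewrite -[LHS]coxK cyE linearD !linearZ /= (coxinv_Pr good) (coxinv_dl good).
    by rewrite (E_cox_dl good) E_Prj_dl scalerN scaleNr.
  apply: (fin_step _ _ _ (lroot_In j) (In_diag D j) cyE).
  by rewrite oppr_lt0 divr_gt0 ?dpos.
- right; have [k [i [yE _]]] := preinjective good gcox ry py hy.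
  have y0 z : B z -> 0 <= -1 * E y z.
    by move=> hz; rewrite mulN1r oppr_ge0 yE; apply: E_preinj.
  have yx x : fan x -> E y x = 0.
    move=> fx; have m1 : 0 <= E y x by rewrite -(hm x fx) ge_min lexx.
    apply/eqP; rewrite eq_le m1 andbT.
    have [b [l [r [hb _ ob [hcb _ _ xE] _]]]] := fan_arc fx.
    rewrite xE eul_sumr big_seq sumr_le0 // => z zin.
    by rewrite -oppr_ge0 -mulN1r; apply: y0; exact: arc_B hcb zin.
  have cy := fan_concentrated y0 ltac:(by rewrite oppr_eq0 oner_neq0) yx.
  have [|p hp|t cyE] := @concentrated_same (Pr j) y.
  - by rewrite E_Prj_dl gt_eqF ?dpos.
  - have [b [cb bj hb hz]] := cy p hp; exists b => // z cz zb.
    by split; [exact: (Pr_conc hp cb bj cz zb)|exact: hz].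
  apply: (fin_step _ _ _ (lroot_Pr j) (Pr_diag D j) cyE).
  by rewrite E_Prj_dl pmulr_llt0 // invr_gt0 dpos.
Qed.

(** The value is -d_j. Hence the two candidates of [fan_completion] are incompatible with each
    other, which gives uniqueness of the partner. *)
Lemma E_PI : E (dl - Pr j) (dl - In j) < 0.
Proof.
rewrite eulBl !eulBr (E_dldl good) (E_dll good (In j)) E_Inj_dl E_Prj_dl E_In (Pr_diag D j).
by have := dpos j; lra.
Qed.

(** Vanishing of the i-th coordinate on the fan concentrates P_i at the same simple roots as P_j. *)
Lemma fan_negsr i t : (forall x, fan x -> x ord0 i = 0) -> i != j ->
  exists s t, Pr i = s *: Pr j + t *: dl.
Proof.
move=> hx ij; have y0 z : B z -> 0 <= 1 * E (Pr i) z.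
  by move=> hz; rewrite mul1r E_Pr mulr_ge0 ?(ltW (dpos i)) //; exact: (Bnn hz i).
have yx x : fan x -> E (Pr i) x = 0 by move=> fx; rewrite E_Pr hx // mulr0.
have cy := fan_concentrated y0 (oner_neq0 _) yx.
have [|p hp|t' e] := @concentrated_same (Pr j) (Pr i).
- by rewrite E_Prj_dl gt_eqF ?dpos.
- have [b [cb bj hb hz]] := cy p hp; exists b => // z cz zb.
  by split; [exact: (Pr_conc hp cb bj cz zb)|exact: hz].
by exists (E (Pr i) dl / E (Pr j) dl), t'.
Qed.

Lemma exch_special : exists be, Phic be /\ be <> al0 /\ exch_delta D gamma P al0 be.
Proof.
have fan_B x : fan x -> [/\ U x, nonneg (cox x) & nonneg (coxinv x)].
  move=> /fan_Upsre/(Upsre_lroot good)[rx px ux]; split => //.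
    exact: (nonneg_cox good gcox rx px ux).
  exact: (nonneg_coxinv good gcox rx px ux).
(* P_j vanishes beyond j and I_j vanishes before j. Hence delta - P_j is positive as soon as a node
   follows j; for the last node delta - I_j takes its place, with positivity read off at any other
   node. *)
case: (classic (exists i : 'I_n, (j < i)%N)) => [[i0 ji0]|nex].
  pose rho := dl - Pr j.
  have rr : lroot rho := lroot_dl_sub (lroot_Pr j) (Pr_diag D j).
  have ri i : rho ord0 i = dl ord0 i - (Pr j) ord0 i by rewrite mxE [X in _ + X]mxE.
  apply: (exch_build rr).
  - apply: (nonneg_diag good (i := i0) rr); rewrite ri (Pr_gt D ji0) subr0.
    exact: (dl_gt0 good).
  - by rewrite ri (Pr_diag D) (dl_special sj) subrr.
  - by rewrite eulBl (E_dldl good) E_Prj_dl sub0r oppr_eq0 gt_eqF ?dpos.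
  - move=> x fx; have [ux _ pci] := fan_B x fx; have [e1 e2] := E_U_dl good gcox ux.
    have -> : E rho x = 0 by rewrite eulBl e2 E_Pr (fan_coord fx) mulr0 subrr.
    apply/min_idPl; have -> : E x rho = E (Pr j) (coxinv x).
      by rewrite eulBr e1 sub0r -(E_coxinv good).
    by rewrite E_Pr mulr_ge0 ?(ltW (dpos j)).
  - move=> i ij hx; rewrite ri => /eqP; rewrite subr_eq0 => /eqP pi.
    have [s [t e]] := fan_negsr 0 hx ij.
    (* For i < j, coordinate j of P_i = s P_j + t delta gives s + t = 0, and coordinate i, where P_j
       and delta agree, gives (s + t) delta_i = 1. *)
    case: (ltngtP i j) => [lt|lt|/val_inj h]; last by rewrite h eqxx in ij.
      have h1 := congr1 (fun v : V => v ord0 i) e; have h2 := congr1 (fun v : V => v ord0 j) e.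
      rewrite /= (Pr_diag D) 3!mxE -pi -mulrDl in h1.
      rewrite /= (Pr_gt D lt) 3!mxE (Pr_diag D) (dl_special sj) !mulr1 in h2.
      by move: h1; rewrite -h2 mul0r => /eqP; rewrite oner_eq0.
    by have := dl_gt0 good i; rewrite pi (Pr_gt D lt) ltxx.
  - move=> y ry py ey yj hm hr; case: (fan_completion ry py ey yj hm) => // yE.
    have := E_PI; rewrite -/rho -yE => h; suff : 0 <= E rho y by rewrite leNgt h.
    by rewrite -hr ge_min lexx orbT.
have [i0 i0j] := other_node j.
have le (i : 'I_n) : (i <= j)%N by rewrite leqNgt; apply/negP => h; apply: nex; exists i.
have i0lt : (i0 < j)%N.
  by rewrite ltn_neqAle le andbT; apply: contra i0j => /eqP/val_inj ->.
pose rho := dl - In j.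
have rr : lroot rho := lroot_dl_sub (lroot_In j) (In_diag D j).
have ri i : rho ord0 i = dl ord0 i - (In j) ord0 i by rewrite mxE [X in _ + X]mxE.
apply: (exch_build rr).
- apply: (nonneg_diag good (i := i0) rr); rewrite ri (In_lt D i0lt) subr0.
  exact: (dl_gt0 good).
- by rewrite ri (In_diag D) (dl_special sj) subrr.
- by rewrite eulBl (E_dldl good) E_Inj_dl sub0r opprK gt_eqF ?dpos.
- move=> x fx; have [ux pc _] := fan_B x fx; have [e1 e2] := E_U_dl good gcox ux.
  have -> : E x rho = 0 by rewrite eulBr e1 E_In (fan_coord fx) mulr0 subrr.
  apply/min_idPr; have -> : E rho x = E (cox x) (In j).
    by rewrite eulBl e2 sub0r (E_cox good).
  by rewrite E_In mulr_ge0 ?(ltW (dpos j)).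
- move=> i ij hx; rewrite ri => /eqP; rewrite subr_eq0 => /eqP pi.
  have lt : (i < j)%N by rewrite ltn_neqAle le andbT; apply: contra ij => /eqP/val_inj ->.
  by have := dl_gt0 good i; rewrite pi (In_lt D lt) ltxx.
- move=> y ry py ey yj hm hr; case: (fan_completion ry py ey yj hm) => // yE.
  have := E_PI; rewrite -/rho -yE => h; suff : 0 <= E y rho by rewrite leNgt h.
  by rewrite -hr ge_min lexx.
Qed.

End Node.
End ExchangeSpecial.

(** * Invariance under tau *)

Section Tau.
Variables (n : nat) (D : cdata n) (gamma : 'rV[rat]_n) (P : 'rV[rat]_n -> Prop).
Local Notation V := 'rV[rat]_n.
Local Notation d := (cd D).
Local Notation E := (eul D).
Local Notation dl := (delta D).
Local Notation lroot := (lroot D).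
Local Notation cox := (cox D).
Local Notation coxinv := (coxinv D).
Local Notation conn := (conn D P).
Implicit Types (u v w x y z b p : V) (s t : rat).

Hypothesis good : good_data D.
Hypothesis gaff : gamma ord0 (caff D) = 0.
Hypothesis gcox : cox gamma = gamma + dl.
Hypothesis HP : is_Pic D gamma P.
Local Notation dsym := (dsym good).
Local Notation dpos := (dpos good).
Local Notation a2 := (a_diag good).
Local Notation coxK := (coxK' good).
Local Notation coxinvK := (coxinvK' good).
Local Notation inUE := (inUE good gcox).
Local Notation B := (B D P).
Local Notation Bc := (B_cox good gcox HP).
Local Notation conn_orbit := (conn_orbit good gaff gcox HP).
Local Notation Upsre := (Upsre D gamma).
Local Notation arc_B := (arc_B good gcox HP).
Local Notation UpsreP := (UpsreP good gaff gcox HP).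
Local Notation Supp := (Supp D P).
Local Notation comp_full := (comp_full D P).
Local Notation conn_B := (conn_B good gcox HP).
Local Notation Supp_arc := (Supp_arc good gaff gcox HP).
Local Notation lrootd := (lrootd D).
Local Notation compatible := (compatible D gamma P).
Local Notation tube_case := (tube_case D gamma P).
Local Notation Phic := (Phic D gamma).
Local Notation PhicP := (PhicP good gcox).
Local Notation compat_nn := (compat_nn good).
Local Notation compat_negsr_l := (compat_negsr_l gamma P good).
Local Notation compat_negsr_r := (compat_negsr_r gamma P good).
Local Notation Pr := (proj D (enum 'I_n)).
Local Notation In := (inj D (enum 'I_n)).
Local Notation lroot_Pr := (lroot_Pr good).
Local Notation lroot_In := (lroot_In good).
Local Notation nonneg_dl := (nonneg_dl good).
Local Notation E_Pr := (E_Pr good).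
Local Notation E_In := (E_In good).
Local Notation tau := (tau D).
Local Notation is_arc_cox := (is_arc_cox good gcox HP).
Local Notation is_arc_coxinv := (is_arc_coxinv good gcox HP).

(** tau_c along a suffix of the letters, for comparison with [word] one letter at a time. *)
Definition twd (s : seq 'I_n) v := foldr (fun i w => sigma D i w) v s.

Lemma tauE v : tau v = twd (enum 'I_n) v. Proof. by []. Qed.

Lemma twd_cat (s1 s2 : seq 'I_n) v : twd (s1 ++ s2) v = twd s1 (twd s2 v).
Proof. exact: foldr_cat. Qed.

Lemma sigma_refl i v : (forall j, v <> - sr j) -> sigma D i v = refl D i v.
Proof.
move=> h; rewrite /sigma; case: ifP => // /existsP[j /andP[_ /eqP e]].
by case: (h j).
Qed.

Lemma coord_not_negsr i v : 0 < v ord0 i -> forall j, v <> - sr j.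
Proof. by move=> vi j e; move: vi; rewrite e mxE srE oppr_gt0 ltrn0. Qed.

(** A positive coordinate that no letter touches keeps every partial image away from the negative
    simple roots, so each sigma acts as a reflection. *)
Lemma twd_coord (s : seq 'I_n) v i : i \notin s -> 0 < v ord0 i -> twd s v = word D s v.
Proof.
move=> + vi; elim: s => //= k s IH; rewrite inE negb_or => /andP[ik is_].
rewrite IH // sigma_refl //; apply: (@coord_not_negsr i).
by rewrite word_notin.
Qed.

Lemma sigma_negsr k i : k != i -> sigma D k (- sr i) = - sr i.
Proof.
move=> ki; rewrite /sigma; case: ifP => // /existsP[]; exists i.
by rewrite eq_sym ki eqxx.
Qed.

Lemma twd_negsr (s : seq 'I_n) i : i \notin s -> twd s (- sr i) = - sr i.
Proof.
elim: s => //= k s IH; rewrite inE negb_or eq_sym => /andP[ki is_].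
by rewrite IH // sigma_negsr.
Qed.

Lemma sr_inj i j : (sr i : V) = sr j -> i = j.
Proof.
move=> /rowP/(_ i); rewrite !srE eqxx; by case: eqP => // _ /eqP.
Qed.

Lemma enum_split i : exists s1 s2 : seq 'I_n, [/\ enum 'I_n = s1 ++ i :: s2, i \notin s1, i \notin s2,
  Pr i = word D s1 (sr i) & In i = word D (rev s2) (sr i)].
Proof.
have mi : i \in enum 'I_n by rewrite mem_enum.
have u := enum_uniq 'I_n; have e := split_index mi.
rewrite {1}e cat_uniq /= negb_or in u; have /and3P[_ /andP[h1 _] /andP[h2 _]] := u.
by eexists _, _; split; [exact: e|exact: h1|exact: h2| |].
Qed.

Lemma tau_negsr i : tau (- sr i) = Pr i.
Proof.
have [s1 [s2 [e h1 h2 -> _]]] := enum_split i.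
rewrite tauE e twd_cat /= twd_negsr //.
have -> : sigma D i (- sr i) = sr i.
  rewrite /sigma; case: ifP => [/existsP[j /andP[ji /eqP]]|_].
    by move=> /oppr_inj/sr_inj ij; rewrite ij eqxx in ji.
  by rewrite linearN /= (refl_sr dsym dpos a2) opprK.
by rewrite (twd_coord h1) // srE eqxx.
Qed.

Lemma tau_In i : tau (In i) = - sr i.
Proof.
have [s1 [s2 [e h1 h2 _ IE]]] := enum_split i.
have I1 : 0 < (In i) ord0 i by rewrite (In_diag D).
move: I1 IE; move: (In i) => x I1 IE.
rewrite tauE e twd_cat /= (twd_coord h2 I1) IE (wordK_rev dsym dpos a2).
rewrite sigma_refl; last by apply: (@coord_not_negsr i); rewrite srE eqxx.
by rewrite (refl_sr dsym dpos a2) twd_negsr.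
Qed.

Lemma nonneg_not_negsr v : nonneg v -> forall j, v <> - sr j.
Proof. by move=> pv j e; have := pv j; rewrite e mxE srE eqxx oppr_ge0 ler10. Qed.

(** No partial image becomes negative: at a sign change it would be -alpha_i, and the later letters,
    all different from i, would leave the coordinate -1 in c v. *)
Lemma tau_cox v : lroot v -> nonneg v -> nonneg (cox v) -> tau v = cox v.
Proof.
move=> rv pv pc; rewrite tauE coxE.
suff h (s1 s2 : seq 'I_n) : enum 'I_n = s1 ++ s2 -> twd s2 v = word D s2 v /\ nonneg (word D s2 v).
  by have [] := h [::] _ erefl.
elim: s2 s1 => [//|i s2 IH] s1 e; have [|e2 p2] := IH (rcons s1 i); first by rewrite cat_rcons.
have rw := lroot_word good s2 rv.
split; first by rewrite /= e2 sigma_refl //; exact: nonneg_not_negsr.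
rewrite /=; case: (lroot_posneg good (lroot_refl good i rw)) => // h.
have si := nonneg_refl good rw p2 h; exfalso.
have := pc i; rewrite coxE e word_cat /= si (refl_sr dsym dpos a2) word_notin.
  by rewrite mxE srE eqxx oppr_ge0 ler10.
have := enum_uniq 'I_n; rewrite e cat_uniq /= negb_or => /and3P[_ /andP[]] //.
Qed.

Lemma tau_dl : tau dl = dl.
Proof.
rewrite tauE; elim: (enum 'I_n) => //= i s ->; rewrite sigma_refl ?refl_dl //.
exact: nonneg_not_negsr nonneg_dl.
Qed.

(** The elements on which tau_c acts as c; in Phi_c only the -alpha_i and the I_i remain besides
    them. *)
Definition generic v := [/\ lrootd v, nonneg v & nonneg (cox v)].

Lemma tau_generic v : generic v -> tau v = cox v.
Proof.
by case=> [[rv|->]] pv pc; [exact: tau_cox|rewrite tau_dl cox_dl].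
Qed.

Lemma Phic_cases x : Phic x -> [\/ exists i, x = - sr i, exists i, x = In i | generic x].
Proof.
move=> hx; have root_case : lroot x -> nonneg x -> [\/ exists i, x = - sr i, exists i, x = In i | generic x].
  move=> rx px; case: (classic (nonneg (cox x))) => h; first by apply: Or33; split => //; left.
  by have [i _ ->] := neg_inj good (enum_uniq _) rx px h; apply: Or32; exists i.
case: (PhicP hx) => [[i ->]|[rx px _]|ux|->]; first by apply: Or31; exists i.
- exact: root_case.
- by have [rx px _] := Upsre_lroot good ux; exact: root_case.
- apply: Or33; split; [by right|exact: nonneg_dl|rewrite (cox_dl good); exact: nonneg_dl].
Qed.

Lemma Upsre_cox x : Upsre (cox x) <-> Upsre x.
Proof.
split=> /UpsreP[p [l [r h]]]; apply/UpsreP.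
  by exists (coxinv p), l, r; rewrite -[x]coxK; exact: is_arc_coxinv.
by exists (cox p), l, r; exact: is_arc_cox.
Qed.

Lemma Phic_root x : lroot x -> nonneg x -> E x dl != 0 -> Phic x.
Proof.
move=> rx px ex; right; left; split; last by move/inUE => h; rewrite h eqxx in ex.
by split; [left; exact: (lroot_real good rx)|exact: (nonneg_pos rx px)].
Qed.

Lemma Phic_Pr i : Phic (Pr i).
Proof. by apply: Phic_root; [exact: lroot_Pr|exact: (nonneg_Pr good)|rewrite gt_eqF // E_Pr_dl]. Qed.
Lemma Phic_In i : Phic (In i).
Proof. by apply: Phic_root; [exact: lroot_In|exact: (nonneg_In good)|rewrite lt_eqF // E_In_dl]. Qed.

Lemma Phic_cox x : generic x -> Phic x -> Phic (cox x).
Proof.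
move=> [rx px pc] hx; case: (PhicP hx) => [[i xi]|[rx' _ ex]|ux|->].
- by case: (nonneg_not_negsr px xi).
- by apply: Phic_root; rewrite ?(E_cox_dl good) //; exact: lroot_cox.
- by right; right; left; apply/Upsre_cox.
- by rewrite (cox_dl good); right; right; right.
Qed.

Lemma not_Upsre x : E x dl != 0 -> ~ Upsre x.
Proof. by move=> h /(Upsre_lroot good)[_ _ /inUE e]; rewrite e eqxx in h. Qed.
Lemma Pr_not_Upsre i : ~ Upsre (Pr i).
Proof. by apply: not_Upsre; rewrite gt_eqF // E_Pr_dl. Qed.
Lemma In_not_Upsre i : ~ Upsre (In i).
Proof. by apply: not_Upsre; rewrite lt_eqF // E_In_dl. Qed.

Lemma Phic_tau x : Phic x -> Phic (tau x).
Proof.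
move=> hx; case: (Phic_cases hx) => [[i ->]|[i ->]|gx].
- by rewrite tau_negsr; exact: Phic_Pr.
- by rewrite tau_In; left; exists i.
- by rewrite tau_generic //; exact: Phic_cox.
Qed.

Lemma tau_surj y : Phic y -> exists2 x, Phic x & tau x = y.
Proof.
move=> hy; have root_case : lroot y -> nonneg y -> exists2 x, Phic x & tau x = y.
  move=> ry py; case: (classic (nonneg (coxinv y))) => h; last first.
    rewrite coxinvE in h; have [i _ ->] := neg_proj good (enum_uniq _) ry py h.
    by exists (- sr i); [left; exists i|rewrite tau_negsr].
  have rx : lroot (coxinv y) by apply: lroot_coxinv.
  exists (coxinv y); last by rewrite tau_cox ?coxinvK.
  case: (PhicP hy) => [[i yi]|[_ _ ey]|uy|yd].
  - by case: (nonneg_not_negsr py yi).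
  - by apply: Phic_root; rewrite ?(E_coxinv_dl good).
  - by right; right; left; apply/Upsre_cox; rewrite coxinvK.
  - by move: (lroot_neq_dl good ry); rewrite yd eqxx.
case: (PhicP hy) => [[i ->]|[ry py _]|uy|->].
- by exists (In i); [exact: Phic_In|exact: tau_In].
- exact: root_case.
- by have [ry py _] := Upsre_lroot good uy; exact: root_case.
- by exists dl; [right; right; right|exact: tau_dl].
Qed.

Lemma Pr_inj i j : Pr i = Pr j -> i = j.
Proof.
move=> h; have := E_Pr i (sr i); rewrite h E_Pr !srE eqxx mulr1.
case: eqP => [e _|_ /eqP]; [by rewrite e|by rewrite mulr0 eq_sym gt_eqF ?dpos].
Qed.

Lemma Pr_neq_cox i v : nonneg v -> Pr i <> cox v.
Proof.
move=> pv e; have := coxinv_Pr good i; rewrite e coxK => vE.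
by have := pv i; rewrite vE mxE (In_diag D) oppr_ge0 ler10.
Qed.

Lemma tau_inj x y : Phic x -> Phic y -> tau x = tau y -> x = y.
Proof.
move=> hx hy; have nPr i := nonneg_Pr good i.
case: (Phic_cases hx) => [[i ->]|[i ->]|gx]; case: (Phic_cases hy) => [[j ->]|[j ->]|gy];
  rewrite ?tau_negsr ?tau_In ?tau_generic //.
- by move=> /Pr_inj ->.
- by move/(nonneg_not_negsr (nPr i)).
- by move/Pr_neq_cox; case: gy => _ py _ /(_ py).
- by move=> /esym/(nonneg_not_negsr (nPr j)).
- by move=> /oppr_inj/sr_inj ->.
- by case: gy => _ _ pc /esym/(nonneg_not_negsr pc).
- by move/esym/Pr_neq_cox; case: gx => _ px _ /(_ px).
- by case: gx => _ _ pc /(nonneg_not_negsr pc).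
- by move=> e; rewrite -[x]coxK e coxK.
Qed.

Lemma Supp_cox x z : Upsre x -> Supp (cox x) z <-> Supp x (coxinv z).
Proof.
move=> /UpsreP[p [l [r hx]]]; have hc := is_arc_cox hx.
split=> [/(Supp_arc _ hc)/arcP[i il ->]|/(Supp_arc _ hx)/arcP[i il e]].
  by apply/(Supp_arc _ hx)/arcP; exists i => //; rewrite -[LHS]/(iter i.+1 coxinv (cox p)) iterSr coxK.
by apply/(Supp_arc _ hc)/arcP; exists i => //; rewrite -[z]coxinvK e -{1}[p]coxK -iterSr /= coxinvK.
Qed.

Lemma Upsre_coxinv x : Upsre x -> Upsre (coxinv x).
Proof. by move=> h; apply/Upsre_cox; rewrite coxinvK. Qed.

Lemma Supp_B x b : Upsre x -> Supp x b -> B b.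
Proof. by move=> /UpsreP[p [l [r hx]]] /(Supp_arc _ hx) hb; case: hx => hp _ _ _; apply: (arc_B hp hb). Qed.

Lemma comp_full_cox x y : Upsre x -> Upsre y -> comp_full (cox x) (cox y) <-> comp_full x y.
Proof.
move=> ux uy; split=> [][p0 [pp0 h]]; exists p0; split => // z cz.
  have h0 : B p0 by case: (h p0 (conn_refl _ pp0)); apply: Supp_B; apply/Upsre_cox.
  have hz := conn_B h0 cz.
  have cz' : conn p0 (cox z).
    apply: conn_trans cz _; apply: (conn_sym good).
    by have := conn_orbit 1 (Bc hz); rewrite /= coxK.
  by case: (h _ cz') => [/(Supp_cox _ ux)|/(Supp_cox _ uy)]; rewrite coxK; [left|right].
have h0 : B p0 by case: (h p0 (conn_refl _ pp0)); apply: Supp_B.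
have hz := conn_B h0 cz.
have cz' : conn p0 (coxinv z) by apply: conn_trans cz (conn_orbit 1 hz).
by case: (h _ cz') => hs; [left; apply/Supp_cox|right; apply/Supp_cox].
Qed.

Lemma compat_tube x y : tube_case x y -> compatible x y <->
  forall b, Supp y b -> Supp (cox x) b \/ Supp (coxinv x) b -> Supp x b.
Proof.
move=> tc; split=> [[[_ [m [[t [_ [<- ht]]] /esym/eqP e0]]]|[]//] b yb hb|h].
  move: e0; rewrite pnatr_eq0 => /nilP t0; apply: NNPP => nx.
  by have /ht : Supp y b /\ (Supp (cox x) b \/ Supp (coxinv x) b) /\ ~ Supp x b by []; rewrite t0.
left; split => //; exists 0%N; split => //; exists [::]; split => //; split => // b.
by split=> // [[yb [hb nx]]]; case: nx; exact: h.
Qed.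

Lemma tube_case_cox x y : Upsre x -> Upsre y -> tube_case (cox x) (cox y) <-> tube_case x y.
Proof.
move=> ux uy; split=> [][_ [_ /(comp_full_cox ux uy) h]]; first by split => //; split.
by split; [apply/Upsre_cox|split; [apply/Upsre_cox|]].
Qed.

Lemma compat_tube_cox x y : tube_case x y -> compatible (cox x) (cox y) <-> compatible x y.
Proof.
move=> tc; have [ux [uy _]] := tc.
have uc : Upsre (cox x) by apply/Upsre_cox.
have tc' : tube_case (cox x) (cox y) by apply/tube_case_cox.
rewrite !compat_tube // coxK; split=> h b yb.
  have := h (cox b); rewrite (Supp_cox _ uy) (Supp_cox _ ux) (Supp_cox _ uc) coxK => H.
  move=> hb; apply: (H yb); case: hb => [?|hb]; [by left|right].
  by have := Supp_cox (cox b) (Upsre_coxinv ux); rewrite coxK coxinvK => ->.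
move: yb; rewrite (Supp_cox _ uy) (Supp_cox _ ux) (Supp_cox _ uc) => yb hb.
apply: h => //; case: hb => [?|hb]; [by left|right].
by have := Supp_cox b (Upsre_coxinv ux); rewrite coxinvK => <-.
Qed.

Lemma compat_generic x y : generic x -> generic y -> compatible (cox x) (cox y) <-> compatible x y.
Proof.
move=> [rx px cx] [ry py cy]; case: (classic (tube_case x y)) => [/compat_tube_cox//|nt].
have rc : lrootd (cox x) by case: rx => [h|->]; [left; exact: lroot_cox|right; exact: cox_dl].
have nt' : ~ tube_case (cox x) (cox y).
  by move=> h; have [/Upsre_cox ux [/Upsre_cox uy _]] := h; apply: nt; apply/tube_case_cox.
by rewrite !compat_nn // !(E_cox2 good).
Qed.

Lemma min_eq0 (u v : rat) : 0 <= u -> v <= 0 -> Num.min u v = 0 <-> v = 0.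
Proof. by move=> hu hv; rewrite min_r //; exact: le_trans hu. Qed.

Lemma d_coord_eq0 i (u : rat) : d i * u = 0 <-> u = 0.
Proof.
by split=> [/eqP|->]; rewrite ?mulr0 // mulf_eq0 (gt_eqF (dpos i)) => /eqP.
Qed.

(** Products of [E] with P_i or I_i read off coordinates, which are exactly the degrees against
    -alpha_i. In mixed cases the other product has the opposite sign, so the minimum vanishes only
    with that coordinate. *)
Lemma tau_compat x y : Phic x -> Phic y -> x <> y -> compatible (tau x) (tau y) <-> compatible x y.
Proof.
have rP i : lrootd (Pr i) by left; exact: lroot_Pr.
have rI i : lrootd (In i) by left; exact: lroot_In.
have nP i := nonneg_Pr good i; have nI i := nonneg_In good i.
have rC v : lrootd v -> lrootd (cox v).
  by case=> [h|->]; [left; exact: lroot_cox|right; exact: cox_dl].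
have dn i v : nonneg v -> 0 <= d i * v ord0 i by move=> h; rewrite mulr_ge0 // ltW // dpos.
have dn' i v : nonneg v -> - (d i * v ord0 i) <= 0 by move=> h; rewrite oppr_le0 dn.
have n0 (u : rat) : - u = 0 <-> u = 0 by split=> [/eqP|->]; rewrite ?oppr0 // oppr_eq0 => /eqP.
(* E(P_i, I_j) evaluated through either argument. *)
have EPI i j : d i * (In j) ord0 i = d j * (Pr i) ord0 j by rewrite -E_Pr E_In.
have PI0 i j : (Pr i) ord0 j = 0 <-> (In j) ord0 i = 0.
  by rewrite -(d_coord_eq0 j) -EPI d_coord_eq0.
have sr0 i j : i != j -> (- sr j : V) ord0 i = 0.
  by move=> ij; rewrite mxE srE (negPf ij) oppr0.
(* Distinct negative simple roots are compatible, so P_i and P_j must be too: triangularity makes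
   one of the two coordinates 0. *)
have minPI i j : i <> j -> Num.min (d i * (Pr j) ord0 i) (d j * (Pr i) ord0 j) = 0.
  move=> /eqP ij; have [lt|gt|/val_inj e] := ltngtP i j; last by rewrite e eqxx in ij.
    by rewrite (Pr_gt D lt) mulr0 min_r // dn.
  by rewrite (Pr_gt D gt) mulr0 min_l // dn.
have minII i j : i <> j -> Num.min (d j * (In i) ord0 j) (d i * (In j) ord0 i) = 0.
  by move=> ij; rewrite EPI -EPI !EPI; exact: minPI.
move=> hx hy; case: (Phic_cases hx) => [[i ->]|[i ->]|gx]; case: (Phic_cases hy) => [[j ->]|[j ->]|gy] ne;
  rewrite ?tau_negsr ?tau_In ?tau_generic //.
- have ij : i <> j by move=> e; apply: ne; rewrite e.
  rewrite compat_negsr_l sr0; last exact/eqP.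
  by rewrite compat_nn ?E_Pr ?minPI //; exact: tube_not_l (@Pr_not_Upsre i).
- by rewrite compat_negsr_r // compat_negsr_l PI0.
- have [ry py cy] := gy; rewrite compat_negsr_l compat_nn ?E_Pr //; last exact: tube_not_l (@Pr_not_Upsre i).
  by rewrite (E_cox good) E_Pr min_eq0 ?n0 ?d_coord_eq0 //; [exact: dn|exact: dn'].
- by rewrite compat_negsr_r // compat_negsr_l PI0.
- have ij : i <> j by move=> e; apply: ne; rewrite e.
  rewrite compat_negsr_l sr0; last exact/eqP.
  by rewrite compat_nn ?E_In ?minII //; exact: tube_not_l (@In_not_Upsre i).
- have [ry py cy] := gy; rewrite compat_negsr_l compat_nn //; last exact: tube_not_l (@In_not_Upsre i).
  have -> : E (In i) y = - (d i * (cox y) ord0 i) by rewrite -E_In (E_cox good) opprK.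
  by rewrite E_In minC min_eq0 ?n0 ?d_coord_eq0 //; [exact: dn|exact: dn'].
- have [rx px cx] := gx; rewrite compat_negsr_r // compat_nn //; last exact: tube_not_r (@Pr_not_Upsre j).
  + by rewrite (E_cox good) !E_Pr minC min_eq0 ?n0 ?d_coord_eq0 //; [exact: dn|exact: dn'].
  + exact: rC.
- have [rx px cx] := gx; rewrite compat_negsr_r //; last exact: rC.
  rewrite compat_nn //; last exact: tube_not_r (@In_not_Upsre j).
  have -> : E (In j) x = - (d j * (cox x) ord0 j) by rewrite -E_In (E_cox good) opprK.
  by rewrite E_In min_eq0 ?n0 ?d_coord_eq0 //; [exact: dn|exact: dn'].
- exact: compat_generic.
Qed.
End Tau.

(** * Transport of clusters along tau and orbits of roots of degree one *)

Section Transport.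
Variables (n : nat) (D : cdata n) (gamma : 'rV[rat]_n) (P : 'rV[rat]_n -> Prop).
Local Notation V := 'rV[rat]_n.
Local Notation d := (cd D).
Local Notation E := (eul D).
Local Notation dl := (delta D).
Local Notation q := (q D).
Local Notation lroot := (lroot D).
Local Notation cox := (cox D).
Local Notation coxinv := (coxinv D).
Implicit Types (u v w x y z b p : V) (s t : rat).

Hypothesis good : good_data D.
Hypothesis gaff : gamma ord0 (caff D) = 0.
Hypothesis gcox : cox gamma = gamma + dl.
Hypothesis HP : is_Pic D gamma P.
Local Notation dpos := (dpos good).
Local Notation coxinvK := (coxinvK' good).
Local Notation inUE := (inUE good gcox).
Local Notation lrootd := (lrootd D).
Local Notation Phic := (Phic D gamma).
Local Notation is_cluster := (is_cluster D gamma P).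
Local Notation PhicP := (PhicP good gcox).
Local Notation Pr := (proj D (enum 'I_n)).
Local Notation In := (inj D (enum 'I_n)).
Local Notation lroot_Pr := (lroot_Pr good).
Local Notation lroot_In := (lroot_In good).
Local Notation nonneg_dl := (nonneg_dl good).
Local Notation E_Pr := (E_Pr good).
Local Notation E_In := (E_In good).
Local Notation tau := (tau D).
Local Notation exch_delta := (exch_delta D gamma P).
Local Notation Phic_tau := (Phic_tau good gaff gcox HP).
Local Notation tau_surj := (tau_surj good gaff gcox HP).
Local Notation tau_inj := (tau_inj good gcox).
Local Notation tau_compat := (tau_compat good gaff gcox HP).

Lemma cluster_image C : is_cluster C -> is_cluster (fun y => exists2 x, C x & tau x = y).
Proof.
move=> [hC [hp hm]]; split; first by move=> _ [x /hC hx <-]; exact: Phic_tau.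
split=> [_ _ [x Cx <-] [y Cy <-] ne|C' sub hC' hp' z Cz].
  by apply/tau_compat; [exact: hC|exact: hC|by move=> e; apply: ne; rewrite e|
    by apply: hp => // e; apply: ne; rewrite e].
have [x hx xz] := tau_surj (hC' z Cz); exists x => //.
apply: (hm (fun u => Phic u /\ C' (tau u))) => [u Cu|u []//|u v [hu Cu] [hv Cv] ne|].
- by split; [exact: hC|apply: sub; exists u].
- by apply/tau_compat => //; apply: hp' => // /tau_inj e; apply: ne; exact: e.
- by rewrite xz.
Qed.

Lemma cluster_preimage C : is_cluster C -> is_cluster (fun x => Phic x /\ C (tau x)).
Proof.
move=> [hC [hp hm]]; split; first by move=> x [].
split=> [x y [hx Cx] [hy Cy] ne|C' sub hC' hp' z Cz].
  by apply/tau_compat => //; apply: hp => // /tau_inj e; apply: ne; exact: e.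
have hz := hC' z Cz; split => //.
apply: (hm (fun y => exists2 x, C' x & tau x = y)) => [y Cy|_ [x /hC' hx <-]|_ _ [x Cx <-] [y Cy <-] ne|].
- by have [x hx xy] := tau_surj (hC y Cy); exists x => //; apply: sub; rewrite xy.
- exact: Phic_tau.
- by apply/tau_compat; [exact: hC'|exact: hC'|by move=> e; apply: ne; rewrite e|
    by apply: hp' => // e; apply: ne; rewrite e].
- by exists z.
Qed.

Definition exchangeable x := exists y, Phic y /\ y <> x /\ exch_delta x y.

Lemma Phic_dl : Phic dl. Proof. by right; right; right. Qed.

Lemma exchangeable_tau x : Phic x -> exchangeable (tau x) <-> exchangeable x.
Proof.
move=> hx; have td := tau_dl good; split.
  move=> [y' [hy' [ne [C [C' [hC [hC' [Cd [Cx [Cy h]]]]]]]]]].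
  have [y hy yE] := tau_surj hy'; rewrite -yE in ne Cy h.
  exists y; split => //; split; first by move=> e; apply: ne; rewrite e.
  exists (fun u => Phic u /\ C (tau u)), (fun u => Phic u /\ C' (tau u)).
  split; first exact: cluster_preimage.
  split; first exact: cluster_preimage.
  split; first by split; [exact: Phic_dl|rewrite td].
  split; first by split.
  split; first by split.
  move=> u.
  split=> [][[hu Cu]].
    move=> ud; have [|Cu' [ux uy]] := proj1 (h (tau u)).
      by split => //; rewrite -td => /tau_inj e; apply: ud; apply: e => //; exact: Phic_dl.
    by split => //; split=> e; [apply: ux|apply: uy]; rewrite e.
  move=> [ux uy]; have [|Cu' ud] := proj2 (h (tau u)).
    by split => //; split=> /tau_inj e; [apply: ux|apply: uy]; exact: e.
  by split => //; move=> e; apply: ud; rewrite e.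
move=> [y [hy [ne [C [C' [hC [hC' [Cd [Cx [Cy h]]]]]]]]]].
have sC : forall z, C z -> Phic z by case: hC.
have sC' : forall z, C' z -> Phic z by case: hC'.
exists (tau y); split; first exact: Phic_tau.
split; first by move=> /tau_inj e; apply: ne; exact: e.
exists (fun z => exists2 u, C u & tau u = z), (fun z => exists2 u, C' u & tau u = z).
split; first exact: cluster_image.
split; first exact: cluster_image.
split; first by exists dl.
split; first by exists x.
split; first by exists y.
move=> z; split=> [][[u Cu <-]].
  move=> ud; have [|Cu' [ux uy]] := proj1 (h u).
    by split => // e; apply: ud; rewrite e.
  split; first by exists u.
  by split=> /tau_inj e; [apply: ux|apply: uy]; apply: e => //; exact: sC.
move=> [ux uy]; have [|Cu' ud] := proj2 (h u).
  by split => //; split=> e; [apply: ux|apply: uy]; rewrite e.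
split; first by exists u.
by rewrite -td => /tau_inj e; apply: ud; apply: e; [exact: sC'|exact: Phic_dl].
Qed.

Lemma exchangeable_iter k x : Phic x -> exchangeable (iter k tau x) <-> exchangeable x.
Proof.
move=> hx; suff [] : Phic (iter k tau x) /\ (exchangeable (iter k tau x) <-> exchangeable x) by [].
elim: k => [//|k [h1 h2]] /=; split; first exact: Phic_tau.
by rewrite exchangeable_tau.
Qed.

Local Notation unit_deg := (unit_deg D gamma P).

Lemma special_of_unit i : d i = d (caff D) -> d i * dl ord0 i = d (caff D) -> special D i.
Proof.
move=> h1 h2; apply/(specialP good); have d0 : d (caff D) != 0 by rewrite gt_eqF ?dpos.
have h3 : dl ord0 i = 1 by apply: (mulfI d0); rewrite -{1}h1 h2 mulr1.
by rewrite h3 mul1r h1 divff.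
Qed.

Lemma iter_tau_Pr i k m : (m <= k)%N -> (forall m, (m <= k)%N -> nonneg (iter m cox (Pr i))) ->
  iter m tau (Pr i) = iter m cox (Pr i).
Proof.
move=> mk hn; elim: m mk => // m IH mk; rewrite !iterS IH ?(ltnW mk) //.
apply: (tau_cox good); [|exact: hn (ltnW mk)|exact: hn mk].
by apply: (iter_ind_pred (Q := lroot)); [move=> u; exact: lroot_cox|exact: lroot_Pr].
Qed.

Lemma iter_tau_In i k m : (m <= k)%N -> (forall m, (m <= k)%N -> nonneg (iter m coxinv (In i))) ->
  iter m tau (iter m coxinv (In i)) = In i.
Proof.
move=> mk hn; elim: m mk => // m IH mk; rewrite iterSr.
rewrite (tau_cox good) ?iterS ?coxinvK ?IH ?(ltnW mk) //.
- by rewrite -iterS; apply: (iter_ind_pred (Q := lroot)); [move=> u; exact: lroot_coxinv|exact: lroot_In].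
- by rewrite -iterS; exact: hn mk.
- exact: hn (ltnW mk).
Qed.

(** q and E(-, delta) are constant along c-orbits, so their values on x are those on the P_i or I_i
    it comes from, namely d_i and, up to sign, d_i delta_i; equality with d_aff makes i special.
    Tube roots and delta have degree 0 with delta. *)
Lemma unit_deg_orbit x : Phic x -> unit_deg x ->
  exists2 i, special D i & exists k, iter k tau (- sr i) = x \/ iter k tau x = - sr i.
Proof.
move=> hx ux; case: (PhicP hx) => [[i xi]|[rx px ex]|hu|xd].
- by exists i; [apply/(unit_deg_negsr gamma P good); rewrite -xi|exists 0%N; left].
- have [qx] := proj1 (unit_deg_pos gamma P good rx px) ux.
  have [e0|e0] := ltrP 0 (E x dl).
    have [k [i [xE hn]]] := preprojective good gcox rx px e0.
    rewrite gtr0_norm // => eE; exists i.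
      apply: special_of_unit.
        by rewrite -qx xE (iter_inv (F := q)) ?(q_Pr good) // => u; exact: q_cox.
      by rewrite -eE xE (iter_inv (F := fun u => E u dl)) ?E_Pr // => u; exact: E_cox_dl.
    by exists k.+1; left; rewrite iterSr tau_negsr // (iter_tau_Pr (leqnn k) hn).
  have {}e0 : E x dl < 0 by rewrite lt_neqAle ex.
  have [k [i [xE hn]]] := preinjective good gcox rx px e0.
  rewrite ltr0_norm // => eE; exists i.
    apply: special_of_unit.
      by rewrite -qx xE (iter_inv (F := q)) ?(q_In good) // => u; exact: q_coxinv.
    rewrite -eE xE (iter_inv (F := fun u => E u dl)) ?(E_coxinv_dl good) //.
      by rewrite -(E_dll good) E_In.
    by move=> u; exact: E_coxinv_dl.
  by exists k.+1; right; rewrite iterS xE (iter_tau_In (leqnn k) hn) tau_In.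
- have [rx px /inUE e] := Upsre_lroot good hu.
  have [_] := proj1 (unit_deg_pos gamma P good rx px) ux.
  by rewrite e normr0 => h; have := dpos (caff D); rewrite -h ltxx.
- have rd : lrootd dl by right.
  case: ux; rewrite xd => /(cdeg_nn good _ rd nonneg_dl nonneg_dl (tube_not_l (Upsre_dl good))).
  by rewrite (E_dldl good) mul0r oppr0 maxxx => /eqP; rewrite oner_eq0.
Qed.

Lemma unit_deg_exchangeable x : Phic x -> unit_deg x -> exchangeable x.
Proof.
move=> hx /(unit_deg_orbit hx)[i /(exch_special good gaff gcox HP) hi [k [<-|e]]].
  by apply/exchangeable_iter => //; left; exists i.
by apply/(exchangeable_iter k hx); rewrite e.
Qed.

End Transport.

(** * Diagram automorphisms *)

Section DiagramAutomorphism.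
Variables (n : nat) (D : cdata n).
Local Notation V := 'rV[rat]_n.
Local Notation d := (cd D).
Local Notation K := (K D).
Local Notation dl := (delta D).
Local Notation q := (q D).
Local Notation lroot := (lroot D).
Local Notation word := (word D).
Implicit Types (u v w x y z : V) (s : seq 'I_n) (i j k e : 'I_n).

Hypothesis good : good_data D.
Local Notation dsym := (dsym good).
Local Notation dpos := (dpos good).
Local Notation a2 := (a_diag good).
Local Notation Ksym := (K_symm good).

(** Adding the square of the coordinate at [e] makes [K] positive definite and keeps it invariant
    under the reflections other than s_e, which do not change that coordinate. *)
Definition posform e u v := K u v + u ord0 e * v ord0 e.

Lemma posform_ge0 e u : 0 <= posform e u u.
Proof. by rewrite addr_ge0 ?(K_ge0 good) // -expr2 sqr_ge0. Qed.

Lemma posformDr e u v w : posform e u (v + w) = posform e u v + posform e u w.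
Proof. by rewrite /posform KDr mxE; ring. Qed.
Lemma posformZr e u t w : posform e u (t *: w) = t * posform e u w.
Proof. by rewrite /posform KZr mxE; ring. Qed.
Lemma posformC e u v : posform e u v = posform e v u.
Proof. by rewrite /posform Ksym mulrC. Qed.
Lemma posform_sumr e u (I : Type) (r : seq I) (F : I -> V) :
  posform e u (\sum_(i <- r) F i) = \sum_(i <- r) posform e u (F i).
Proof.
elim: r => [|i r IH]; last by rewrite !big_cons posformDr IH.
by rewrite !big_nil /posform K0r mxE mulr0 addr0.
Qed.

Lemma posform_word e s u v : e \notin s -> posform e (word s u) (word s v) = posform e u v.
Proof. by move=> es; rewrite /posform (K_word dsym dpos a2) !word_notin. Qed.

Lemma posform_cs e u v : posform e u v <= (posform e u u + posform e v v) / 2.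
Proof.
have := posform_ge0 e (u - v); rewrite -scaleN1r posformDr posformZr.
rewrite ![posform e (u + _) _]posformC !posformDr !posformZr (posformC e v u); lra.
Qed.

Lemma posform_riesz e (f : 'I_n -> rat) : exists v, forall i, posform e v (sr i) = f i.
Proof.
pose M : 'M[rat]_n := \matrix_(i, k) posform e (sr i) (sr k).
have ME v k : (v *m M) ord0 k = posform e v (sr k).
  rewrite posformC {2}(vecE v) posform_sumr mxE; apply: eq_bigr => i _.
  by rewrite posformZr mxE posformC.
have uM : M \in unitmx.
  rewrite -row_free_unit -kermx_eq0; apply/rowV0P => v /sub_kermxP vM.
  have v0 : posform e v v = 0.
    rewrite {2}(vecE v) posform_sumr big1 // => k _.
    by rewrite posformZr -ME vM mxE mulr0.
  have [k0 ve] : K v v = 0 /\ v ord0 e = 0.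
    move: v0; rewrite /posform => /eqP.
    rewrite paddr_eq0 ?(K_ge0 good) -?expr2 ?sqr_ge0 // sqrf_eq0 => /andP[/eqP -> /eqP ->] //.
  by rewrite (K_eq0 good e k0) ve mul0r scale0r.
exists ((\row_i f i) *m invmx M) => i; rewrite -ME mulmxKV //.
by rewrite mxE.
Qed.

(** Maximize the pairing of v with w r over words w avoiding [e]. At a word that is not dominant one
    more reflection raises the pairing by at least 1, by integrality, while invariance of the form
    bounds it. *)
Lemma dominant_word e v :
  (forall s i, posform e v (word s (sr i)) \is a Num.int) ->
  exists2 s, e \notin s & forall i, i != e -> 0 <= posform e v (word s (sr i)).
Proof.
move=> vi; have [r hr] := posform_riesz e (fun i => if i == e then 0 else d i).
have rr i : i != e -> refl D i r = r - sr i.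
  move=> ie; rewrite (reflE dsym dpos) Ksym.
  have := hr i; rewrite /posform (negbTE ie) srE eq_sym (negbTE ie) mulr0 addr0 => ->.
  by rewrite divff ?scale1r // gt_eqF ?dpos.
apply: NNPP => nex; have step s : e \notin s -> exists2 i, i != e & posform e v (word s (sr i)) <= -1.
  move=> es; apply: NNPP => nx; apply: nex; exists s => // i ie; rewrite leNgt; apply/negP => lt.
  apply: nx; exists i => //; rewrite lerNr; apply: int_ge1; rewrite ?rpredN // oppr_gt0.
  by [].
have grow (N : nat) : exists2 s, e \notin s & posform e v r + N%:R <= posform e v (word s r).
  elim: N => [|N [s es hs]]; first by exists [::]; rewrite ?addr0.
  have [i ie hi] := step s es; exists (rcons s i).
    by rewrite mem_rcons inE negb_or eq_sym ie.
  rewrite -cats1 word_cat /= rr // linearB /= -scaleN1r posformDr posformZr -natr1; lra.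
pose b := (posform e v v + posform e r r) / 2 - posform e v r.
have [s es hs] := grow (Num.truncn b).+1; have := truncnS_gt b.
have := posform_cs e v (word s r); rewrite posform_word // /b; lra.
Qed.

Lemma intvec_unit_sum x (f : 'I_n -> rat) : intvec x -> nonneg x ->
  (forall i, x ord0 i != 0 -> 1 <= f i) -> \sum_i x ord0 i * f i = 1 ->
  exists2 k, x = sr k & f k = 1.
Proof.
move=> ix px hf s1.
have t0 i : 0 <= x ord0 i * f i.
  case: (eqVneq (x ord0 i) 0) => [->|/hf fi]; first by rewrite mul0r.
  by rewrite mulr_ge0 // (le_trans _ fi).
have [k xk] : exists k, x ord0 k != 0.
  apply: NNPP => nex; have := oner_neq0 rat; rewrite -s1 big1 ?eqxx // => i _.
  by case: (eqVneq (x ord0 i) 0) => [->|h]; [rewrite mul0r|case: nex; exists i].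
have x1 : 1 <= x ord0 k by apply: int_ge1; rewrite // lt_neqAle eq_sym xk px.
have f1 := hf k xk; move: s1; rewrite (bigD1 k) //=.
set r := \sum_(i | _) _ => s1; have r0 : 0 <= r by apply: sumr_ge0.
have e1 : r = 0 by nra.
have fk : f k = 1 by nra.
exists k => //; apply/rowP => i; rewrite srE; case: eqP => [->|/eqP ik].
  by move: s1; rewrite e1 fk mulr1 addr0.
move/eqP: e1; rewrite psumr_eq0 // => /allP/(_ i (mem_index_enum _)).
rewrite ik /= mulf_eq0; case: (eqVneq (x ord0 i) 0) => // /hf fi.
by rewrite (gt_eqF (lt_le_trans ltr01 fi)).
Qed.

Lemma subdl_coord x t i : (x - t *: dl) ord0 i = x ord0 i - t * dl ord0 i.
Proof. by rewrite !mxE. Qed.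

Lemma sr_shift_inj i k m : (sr i : V) = sr k + m *: dl -> i = k.
Proof.
move=> h; apply/eqP/negPn/negP => ik.
have c l : (sr i : V) ord0 l = (sr k : V) ord0 l + m * dl ord0 l.
  by rewrite h mxE; congr (_ + _); rewrite mxE.
have := c i; have := c k; rewrite !srE !eqxx (negbTE ik) eq_sym (negbTE ik) add0r /= => ck ci.
have m0 : 0 < m by rewrite -(pmulr_lgt0 _ (dl_gt0 good i)) -ci ltr01.
have := mulr_gt0 m0 (dl_gt0 good k); move: ck; rewrite mulr1n mulr0n; lra.
Qed.

(** The dominating word w avoids [e], and two height arguments show that it carries simple roots to
    simple roots modulo delta. As [K] ignores delta, the induced permutation preserves the Cartan
    matrix. *)
Lemma special_diagram_aut j e : special D j -> special D e ->
  exists p : {perm 'I_n}, diagram_aut D p /\ p j = e.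
Proof.
move=> sj se; case: (eqVneq j e) => [<-|je].
  by exists 1%g; split=> [i k|]; rewrite !perm1.
have d1 := dl_special sj; have e1 := dl_special se.
(* The height after projection along delta to j-coordinate 0: it is 1 on alpha_i for i different
   from j and 0 on delta. It is nonzero on every root, because the projection is again a root and so
   has a definite sign. *)
pose h x := ht x - x ord0 j * ht dl.
have hD x y : h (x + y) = h x + h y by rewrite /h htD mxE; ring.
have hZ t x : h (t *: x) = t * h x by rewrite /h htZ mxE; ring.
have h0 : h 0 = 0 by rewrite -(scale0r dl) hZ mul0r.
have hdl : h dl = 0 by rewrite /h d1; ring.
have hsr i : i != j -> h (sr i) = 1.
  by move=> ij; rewrite /h ht_sr srE eq_sym (negbTE ij) mul0r subr0.
have hsum x : h x = \sum_i x ord0 i * h (sr i).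
  rewrite {1}(vecE x); elim: (index_enum _) => [|i r IH]; first by rewrite !big_nil.
  by rewrite !big_cons hD hZ IH.
have hint x : lroot x -> h x \is a Num.int.
  by case=> ix _ _; rewrite rpredB ?rpredM ?ht_int // => i; exact: dl_int.
have hroot x : lroot x -> h x != 0.
  move=> /(lroot_proj good sj) rx; apply/eqP => hx; move: (lroot_neq0 rx).
  have : ht (x - x ord0 j *: dl) = 0 by rewrite htD htN htZ.
  case: (lroot_posneg good rx) => px hy; first by rewrite (ht_eq0 px hy) eqxx.
  by rewrite -oppr_eq0 (ht_eq0 px) ?eqxx // htN hy oppr0.
have [v hv] := posform_riesz e (fun i => h (sr i)).
have vh x : posform e v x = h x.
  rewrite {1}(vecE x) posform_sumr hsum; apply: eq_bigr => i _.
  by rewrite posformZr hv.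
have rw s i : lroot (word s (sr i)) by apply: lroot_word => //; apply: lroot_sr.
have [s es hs] : exists2 s, e \notin s & forall i, i != e -> 0 <= posform e v (word s (sr i)).
  by apply: dominant_word => s i; rewrite vh; apply: hint.
have h1 k : k != e -> 1 <= h (word s (sr k)).
  move=> ke; apply: int_ge1; first exact: hint.
  by rewrite lt_neqAle eq_sym hroot // -vh hs.
have hword y : h (word s y) = \sum_k y ord0 k * h (word s (sr k)).
  rewrite {1}(vecE y) linear_sum /=; elim: (index_enum _) => [|i r IH]; first by rewrite !big_nil.
  by rewrite !big_cons hD linearZ hZ IH.
have A i : exists k, i != j -> k != e /\ word s (sr k) = sr i - (sr i : V) ord0 e *: dl.
  (* For i = j the witness is a dummy; [pf] sends j to [e] instead. Otherwise alpha_i, projected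
     along delta to vanish at [e], has h = 1 and is a combination of the w alpha_k with k different
     from [e], each of value at least 1, so it is one of them. *)
  case: (eqVneq i j) => [_|ij]; first by exists i.
  set y := sr i - _; have ry : lroot y by apply: lroot_proj => //; apply: lroot_sr.
  have ye : y ord0 e = 0 by rewrite subdl_coord e1 mulr1 subrr.
  pose x := word (rev s) y; have rx : lroot x by apply: lroot_word.
  have wx : word s x = y by rewrite /x (wordK_rev dsym dpos a2).
  have xe : x ord0 e = 0 by rewrite word_notin ?mem_rev.
  have hy : h y = 1 by rewrite hD -scaleNr hZ hdl mulr0 addr0 hsr.
  have hk k : x ord0 k != 0 -> 1 <= h (word s (sr k)).
    by move=> xk; apply: h1; apply: contraNneq xk => ->; rewrite xe.
  have sx : \sum_k x ord0 k * h (word s (sr k)) = 1 by rewrite -hword wx hy.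
  have px : nonneg x.
    case: (lroot_posneg good rx) => // nx.
    have : \sum_k x ord0 k * h (word s (sr k)) <= 0.
      apply: sumr_le0 => k _; case: (eqVneq (x ord0 k) 0) => [->|/hk fk]; first by rewrite mul0r.
      by rewrite mulr_le0_ge0 // ?(le_trans _ fk) //; have := nx k; rewrite mxE oppr_ge0.
    by rewrite sx ler10.
  have [ix _ _] := rx; have [k xE _] := intvec_unit_sum ix px hk sx.
  exists k => _; split; last by rewrite -xE.
  by apply/eqP => ke; move: xe; rewrite xE srE ke eqxx => /eqP; rewrite oner_eq0.
have [g hg] := fin_all_exists A.
pose pf i := if i == j then e else g i.
have pfj i : i != j -> pf i = g i by rewrite /pf => /negbTE->.
have pinj : injective pf.
  move=> i k; rewrite /pf; case: (eqVneq i j) => [->|ij]; case: (eqVneq k j) => [->|kj] //.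
  - by move=> h'; have [] := hg k kj; rewrite -h' eqxx.
  - by move=> h'; have [] := hg i ij; rewrite h' eqxx.
  move=> gE; have [_ gi] := hg i ij; have [_] := hg k kj; rewrite -gE gi => /eqP.
  rewrite subr_eq => /eqP E1; apply: (@sr_shift_inj i k ((sr i : V) ord0 e - (sr k : V) ord0 e)).
  by rewrite {1}E1 scalerBl [RHS]addrA [LHS]addrAC.
pose p := perm pinj.
have C k : k != e -> h (word s (sr k)) = 1.
  move=> ke; rewrite -(permKV p k); set i := (p^-1)%g k.
  have ij : i != j by apply: contraNneq ke => ij; rewrite -(permKV p k) -/i ij permE /pf eqxx.
  have [_ gi] := hg i ij; rewrite permE pfj // gi hD -scaleNr hZ hdl mulr0 addr0.
  exact: hsr.
(* Apply h to w delta = delta: all w alpha_k with k different from [e] contribute their mark of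
   delta, which leaves this value for k = e. *)
have hwe : h (word s (sr e)) = 1 - ht dl.
  have := hword dl; rewrite (word_dl good) hdl (bigD1 e) //= e1 mul1r => E0.
  have -> : h (word s (sr e)) = - \sum_(i | i != e) dl ord0 i * h (word s (sr i)) by lra.
  rewrite (eq_bigr (fun i => dl ord0 i)) => [|i /C ->]; last by rewrite mulr1.
  by have -> : ht dl = _ := bigD1 e isT; rewrite /= e1 opprD addrA subrr sub0r.
have wE : word s (sr e) = sr j + dl.
  set y := word s (sr e) in hwe *; have ry : lroot y := rw s e.
  (* Shifted to j-coordinate 1, w alpha_e becomes a positive root of height 1, hence alpha_j. The
     coordinate at [e], unchanged by w, shows that the shift is exactly delta. *)
  pose z := y - y ord0 j *: dl + 1 *: dl.
  have zE' : z = y - (y ord0 j - 1) *: dl by rewrite scalerBl opprB addrA addrAC.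
  have qy : q y = d e.
    by rewrite -(q_sr D e); apply: (q_isom good); rewrite (K_word dsym dpos a2).
  have rz : lroot z.
    apply: (lroot_shift good se); [exact: lroot_proj|exact: rpred1|].
    by rewrite -scaleNr (q_dl good) qy mul1r divff ?rpred1 // gt_eqF ?dpos.
  have zj : z ord0 j = 1 by rewrite zE' subdl_coord d1; ring.
  have pz : nonneg z by apply: (nonneg_diag good rz (i := j)); rewrite zj ltr01.
  have hz : ht z = 1.
    have : h z = 1 - ht dl by rewrite !hD hZ -scaleNr hZ hdl hwe; ring.
    by rewrite /h zj; lra.
  have [iz _ _] := rz; have sz : \sum_i z ord0 i * 1 = 1.
    by rewrite -[RHS]hz; apply: eq_bigr => i _; rewrite mulr1.
  have [k zE _] := intvec_unit_sum iz pz (fun i _ => lexx 1) sz.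
  have kj : k = j.
    apply/eqP/negPn/negP => kj; move: zj; rewrite zE srE eq_sym (negbTE kj) => /eqP.
    by rewrite eq_sym oner_eq0.
  have yE : y = sr j + (y ord0 j - 1) *: dl.
    have -> : sr j = z by rewrite zE kj.
    by rewrite zE' subrK.
  have ye : y ord0 e = 1 by rewrite word_notin // srE eqxx.
  have yj : 1 = y ord0 j - 1.
    have := congr1 (fun u : V => u ord0 e) yE; rewrite /= ye mxE srE eq_sym (negbTE je) add0r.
    by rewrite mxE e1 mulr1.
  by rewrite {1}yE -yj scale1r.
have wp i : exists m, word s (sr (p i)) = sr i + m *: dl.
  rewrite permE /pf; case: (eqVneq i j) => [->|ij]; first by exists 1; rewrite scale1r.
  by exists (- (sr i : V) ord0 e); have [_ ->] := hg i ij; rewrite scaleNr.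
(* w is an isometry and delta lies in the radical, so the permutation preserves the Gram matrix, and
   with it [d] and the Cartan matrix. *)
have Kp i k : K (sr (p i)) (sr (p k)) = K (sr i) (sr k).
  rewrite -(K_word dsym dpos a2 s); have [m ->] := wp i; have [m' ->] := wp k.
  by rewrite !KDl !KDr !KZl !KZr !(K_dll good) !(K_dlr good) !mulr0 !addr0.
exists p; split; last by rewrite permE /pf eqxx.
move=> i k; apply: (@intr_inj rat); rewrite -/(a D (p i) (p k)) -/(a D i k).
have dp : d (p i) = d i.
  by have := Kp i i; rewrite !(K_sr2 a2); lra.
by have := Kp i k; rewrite !K_srsr dp => /mulfI -> //; rewrite gt_eqF ?dpos.
Qed.

End DiagramAutomorphism.

Theorem theorem7p5 (n : nat) (D : cdata n) (gamma : vec n) (P : vec n -> Prop) :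
  good_data D ->
  gamma ord0 (caff D) = 0 -> cox D gamma = gamma + delta D ->
  is_Pic D gamma P ->
  forall al : vec n, Phic D gamma al ->
    ((cdeg D gamma P al (delta D) 1 /\ cdeg D gamma P (delta D) al 1) <->
       exists be : vec n, Phic D gamma be /\ be <> al /\ exch_delta D gamma P al be)
    /\
    ((cdeg D gamma P al (delta D) 1 /\ cdeg D gamma P (delta D) al 1) ->
       exists (j : 'I_n) (p : {perm 'I_n}),
         diagram_aut D p /\ p j = caff D /\ in_tau_orbit D (- sr j) al).
Proof.
move=> good gaff gcox HP al hal; split; first split.
- exact: (unit_deg_exchangeable good gaff gcox HP hal).
- by case=> be [hbe [ne ex]]; exact: (exch_unit good gaff gcox HP hal ne ex).
case/(unit_deg_orbit good gcox hal) => j sj [k hk].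
have [p [hp pj]] := special_diagram_aut good sj (special_aff good).
by exists j, p; do 2!split => //; exists k.
Qed.
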